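(* Let $P, Q, R \in \mathbf{C}^{N\times N}$ be pairwise commuting matrices such that $R$, $R-P$, $R-Q$ and $R-Q-P$ are positive stable. Then $${}_3F_2\left(P,\tfrac{Q}{2},\tfrac{Q+I}{2};\tfrac{R}{2},\tfrac{R+I}{2};1\right) = \Gamma(R)\,\Gamma(R-Q-P)\,\Gamma(R-P)^{-1}\,\Gamma(R-Q)^{-1}\; {}_2F_1\left(P, Q; R-P;-1\right).$$
   Context: $\mathbf{C}^{N\times N}$ is the space of complex $N\times N$ matrices, $I$ is the identity matrix. A matrix $A\in\mathbf{C}^{N\times N}$ is positive stable if $\Re(\lambda)>0$ for every eigenvalue $\lambda$ of $A$. For a positive stable matrix $A$, $\Gamma(A)=\int_0^\infty e^{-t}t^{A-I}\,dt$, where $t^{A-I}=\exp((A-I)\ln t)$. The matrix Pochhammer symbol is $(A)_0=I$, $(A)_m=A(A+I)\cdots(A+(m-1)I)$ for $m\ge 1$. The generalized hypergeometric matrix function is defined by $${}_pF_q(P_1,\dots,P_p;Q_1,\dots,Q_q;z)=\sum_{m=0}^\infty \frac{(P_1)_m\cdots(P_p)_m(Q_1)_m^{-1}\cdots(Q_q)_m^{-1}}{m!}z^m,$$ where $P_i,Q_j\in\mathbf{C}^{N\times N}$ and each $Q_j+mI$ is invertible for all integers $m\ge 0$.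
   Formalization: The series 2F1(P,Q;R-P;-1) may diverge under these hypotheses (N=1, P=2, Q=1, R=3.1); the identity is proved with its value at -1 taken as the radial limit from inside the unit disc, and literally as stated whenever the series converges at -1. *)

(* Defs.v *)
From HB Require Import structures.
From mathcomp Require Import all_boot all_order all_algebra.
From mathcomp Require Import complex.
From mathcomp Require Import all_classical all_reals all_analysis.

Set Implicit Arguments.
Unset Strict Implicit.
Unset Printing Implicit Defensive.

Import Order.TTheory GRing.Theory Num.Theory.
Import numFieldNormedType.Exports.

Local Open Scope classical_set_scope.
Local Open Scope ring_scope.
Local Open Scope complex_scope.

(* The usual topology of the complex plane, given by the modulus. Only the
   topological part of the structure of the field over itself is copied, because
   complex.v already makes K[i] a left module over K. *)
HB.instance Definition _ (K : rcfType) :=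
  PseudoPointedMetric.copy K[i] (K[i] : numFieldType)^o.

(* Matrices have size N = n.+1, so that they form a unit ring: in 'M_N the scalar
   k%:R is k I, the product * is *m, and ^-1 is invmx. Their topology is that of
   entrywise convergence. *)

Definition positive_stable (K : realType) (n : nat) (A : 'M[K[i]]_n.+1) : Prop :=
  forall lambda : K[i], eigenvalue A lambda -> 0 < complex.Re lambda.

Definition expmx (K : realType) (n : nat) (A : 'M[K[i]]_n.+1) : 'M[K[i]]_n.+1 :=
  limn (series (fun k : nat => (k`!)%:R^-1 *: A ^+ k)).

(* t ^ A = exp ((ln t) A) for t > 0 *)
Definition powmx (K : realType) (n : nat) (t : K) (A : 'M[K[i]]_n.+1) :
    'M[K[i]]_n.+1 :=
  expmx ((ln t)%:C *: A).

Definition Gamma_integrand (K : realType) (n : nat) (A : 'M[K[i]]_n.+1) (t : K) :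
    'M[K[i]]_n.+1 :=
  (expR (- t))%:C *: powmx t (A - 1).

(* The integral of a matrix-valued function is taken entrywise, on real and
   imaginary parts separately. *)
Definition Gammamx (K : realType) (n : nat) (A : 'M[K[i]]_n.+1) : 'M[K[i]]_n.+1 :=
  \matrix_(i, j)
    ((\int[@lebesgue_measure K]_(t in `]0%R, +oo[)
        complex.Re (Gamma_integrand A t i j))%R
     +i* (\int[@lebesgue_measure K]_(t in `]0%R, +oo[)
        complex.Im (Gamma_integrand A t i j))%R).

Definition poch (K : realType) (n : nat) (A : 'M[K[i]]_n.+1) (m : nat) :
    'M[K[i]]_n.+1 :=
  \prod_(0 <= k < m) (A + k%:R).

(* The lists Ps = [:: P_1; ...; P_p] and Qs = [:: Q_1; ...; Q_q] are multiplied in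
   order. *)
Definition hyp_term (K : realType) (n : nat) (Ps Qs : seq 'M[K[i]]_n.+1)
    (z : K[i]) (m : nat) : 'M[K[i]]_n.+1 :=
  (z ^+ m / (m`!)%:R) *:
    ((\prod_(P <- Ps) poch P m) * (\prod_(Q <- Qs) (poch Q m)^-1)).

Definition hyp_cvg (K : realType) (n : nat) (Ps Qs : seq 'M[K[i]]_n.+1)
    (z : K[i]) : Prop :=
  cvgn (series (hyp_term Ps Qs z)).

(* To be used together with hyp_cvg: limn is a default value on a divergent
   sequence. *)
Definition hypF (K : realType) (n : nat) (Ps Qs : seq 'M[K[i]]_n.+1)
    (z : K[i]) : 'M[K[i]]_n.+1 :=
  limn (series (hyp_term Ps Qs z)).

(* The value of pFq at a point z of the unit circle, as a radial limit from inside
   the disc of convergence. It is the sum of the series when the series converges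
   at z (Abel), and the value of the analytic continuation of pFq whenever the
   latter is defined at z. *)
Definition hyp_boundary_cvg (K : realType) (n : nat) (Ps Qs : seq 'M[K[i]]_n.+1)
    (z : K[i]) : Prop :=
  cvg (hypF Ps Qs (r%:C * z) @[r --> (1 : K)^'-]).

Definition hypF_boundary (K : realType) (n : nat) (Ps Qs : seq 'M[K[i]]_n.+1)
    (z : K[i]) : 'M[K[i]]_n.+1 :=
  lim (hypF Ps Qs (r%:C * z) @[r --> (1 : K)^'-]).

(* Main.v *)
(* Write c_k(r) for the coefficient of x^k in (1 - x)^(-P) (1 + r x)^(-P), and put
   H(r) = sum_k (Q)_k (R)_k^(-1) c_k(r).

   - At r = 1 the product is (1 - x^2)^(-P), so only even k contribute and H(1) is
     the 3F2 at 1, since (Q)_2m = 4^m (Q/2)_m ((Q+I)/2)_m.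
   - For 0 <= r < 1 the double series converges absolutely. Summing first over the
     power of x taken from (1 - x)^(-P) gives Gauss series 2F1(P, Q+jI; R+jI; 1), and
     H(r) is the Gamma quotient times 2F1(P, Q; R-P; -r).
   - When r -> 1, dominated convergence applies: c_k(r) satisfies a recurrence with
     two terms, which is a convex combination (weights 1-r and r) of two steps that
     both contract like 1 - (1+eta)/k in a norm adapted to R-P-Q. This gives a bound
     of order k^(-1-eta), uniform in r.

   Gauss's sum follows from the contiguity relation
   R (R-P-Q) F(R) = (R-P) (R-Q) F(R+I), iterated with F(R+mI) -> I and
   Gamma(A+mI) m^(-A) / (m-1)! -> I.

   All this happens in a complete normed commutative ring: the bicommutant of
   {P, Q, R}, which contains Gamma of its positive stable elements. *)

From HB Require Import structures.
Require Import Defs.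
From mathcomp Require Import all_boot all_order all_algebra.
From mathcomp Require Import complex.
From mathcomp Require Import spectral mxred.
From mathcomp Require Import all_classical all_reals all_analysis.
From mathcomp Require Import measurable_realfun.
From mathcomp Require Import ring lra.
Import Order.TTheory GRing.Theory Num.Theory.
Import numFieldNormedType.Exports.
Local Open Scope classical_set_scope.
Local Open Scope ring_scope.
Local Open Scope complex_scope.

Set Implicit Arguments.
Unset Strict Implicit.
Unset Printing Implicit Defensive.

(** * Normed rings and convergence *)

(** The detour through r < 1 is forced: the terms of 2F1(P, Q; R-P; -1) are of order j^(2P+Q-R-I),
    which the hypotheses do not make small, so at r = 1 the double series need not converge
    absolutely. The estimates multiply norms of consecutive ratios. An arbitrary norm, such as the
    maximal row sum, does not see the sign of the real parts of the eigenvalues, because nilpotent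
    parts spoil the bound of each factor. Hence the predicate [stable], which asks for some
    submultiplicative norm with |c I - S| <= c - delta. Then (k - c) I + (c I - S) has norm at most
    k - delta for k >= c, and this is what makes ratios of the form 1 - S/k contract. The norm may
    depend on S: convergence of the series uses the one of R-P-Q, the Gamma integral of A the one of
    A. The limit of Gamma(A+mI) m^(-A) / (m-1)! is obtained without Stirling's formula: the error is
    bounded by integrals of powers of t against e^(-t), which are factorials, and only quotients of
    nearby factorials remain. *)

Record algnorm (K : realType) (A : nzRingType) (iota : {rmorphism K -> A}) :=
  AlgNorm {
    nrm :> A -> K;
    nrmD : forall x y, nrm (x + y) <= nrm x + nrm y;
    nrmM : forall x y, nrm (x * y) <= nrm x * nrm y;
    nrmZ : forall c x, nrm (iota c * x) = `|c| * nrm x;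
    nrm1 : nrm 1 = 1;
    nrm_eq0 : forall x, nrm x = 0 -> x = 0 }.

Section NormedRing.
Context {K : realType} {A : nzRingType} {iota : {rmorphism K -> A}}.
Variable nu : algnorm iota.
Implicit Types (u v : nat -> A) (w : nat -> K).

Lemma nrm0 : nu 0 = 0.
Proof. by have := nrmZ nu 0 0; rewrite rmorph0 mul0r normr0 mul0r. Qed.

Lemma nrmN (x : A) : nu (- x) = nu x.
Proof. by have := nrmZ nu (- 1) x; rewrite rmorphN1 mulN1r normrN1 mul1r. Qed.

Lemma nrm_ge0 (x : A) : 0 <= nu x.
Proof.
have := nrmD nu x (- x); rewrite subrr nrm0 nrmN; lra.
Qed.

Lemma nrm_iota c : nu (iota c) = `|c|.
Proof. by rewrite -[iota c]mulr1 nrmZ nrm1 mulr1. Qed.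

Lemma nrm_nat k : nu k%:R = k%:R.
Proof. by rewrite -(rmorph_nat iota) nrm_iota ger0_norm. Qed.

Lemma nrmB (x y : A) : nu (x - y) <= nu x + nu y.
Proof. by rewrite (le_trans (nrmD _ _ _))// nrmN. Qed.

Lemma nrmX (x : A) k : nu (x ^+ k) <= nu x ^+ k.
Proof.
elim: k => [|k IH]; first by rewrite !expr0 nrm1.
by rewrite !exprS (le_trans (nrmM _ _ _))// ler_wpM2l// nrm_ge0.
Qed.

Lemma nrm_sum I (r : seq I) (P : pred I) (F : I -> A) :
  nu (\sum_(i <- r | P i) F i) <= \sum_(i <- r | P i) nu (F i).
Proof.
elim/big_ind2: _ => //; first by rewrite nrm0.
by move=> x a y b xa yb; rewrite (le_trans (nrmD _ _ _))// lerD.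
Qed.

(** Convergence is expressed by the norm and not by a topology on [A]: one ring carries several
    norms, and the bicommutant is used as a bare ring. *)
Definition ncvg {T} (F : set_system T) (u : T -> A) (l : A) :=
  nu (u x - l) @[x --> F] --> (0 : K).

Definition nsum u s := ncvg \oo (fun n => \sum_(0 <= k < n) u k) s.

(** Completeness in the form in which it is used: absolutely convergent series converge. *)
Definition ncomplete := forall u, cvgn (series (nu \o u)) -> exists s, nsum u s.

Section Filter.
Context {T : Type} {F : set_system T} {FF : ProperFilter F}.
Implicit Types (f g : T -> A).

Lemma ncvg_le f l (e : T -> K) : (\forall x \near F, nu (f x - l) <= e x) ->
  e x @[x --> F] --> (0 : K) -> ncvg F f l.
Proof.
move=> fe e0; apply: (squeeze_cvgr (f := cst 0) (h := e)) => //; last exact: cvg_cst.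
by near=> x; rewrite nrm_ge0 /=; near: x.
Unshelve. all: by end_near. Qed.

Lemma ncvg_cst l : ncvg F (cst l) l.
Proof. by rewrite /ncvg /= subrr nrm0; exact: cvg_cst. Qed.

Lemma ncvg_near f g l : (\forall x \near F, f x = g x) -> ncvg F f l ->
  ncvg F g l.
Proof.
move=> fg fl; apply: (ncvg_le _ fl).
by near=> x; rewrite (near fg x).
Unshelve. all: by end_near. Qed.

Lemma ncvgD f g l m : ncvg F f l -> ncvg F g m ->
  ncvg F (fun x => f x + g x) (l + m).
Proof.
move=> fl gm; apply: (@ncvg_le _ _ (fun x => nu (f x - l) + nu (g x - m))).
  by near=> x; rewrite opprD addrACA nrmD.
by rewrite -[0]addr0; exact: cvgD.
Unshelve. all: by end_near. Qed.

Lemma ncvgMl a f l : ncvg F f l -> ncvg F (fun x => a * f x) (a * l).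
Proof.
move=> fl; apply: (@ncvg_le _ _ (fun x => nu a * nu (f x - l))).
  by near=> x; rewrite -mulrBr nrmM.
by rewrite -[0](mulr0 (nu a)); apply: cvgMr.
Unshelve. all: by end_near. Qed.

Lemma ncvgMr a f l : ncvg F f l -> ncvg F (fun x => f x * a) (l * a).
Proof.
move=> fl; apply: (@ncvg_le _ _ (fun x => nu (f x - l) * nu a)).
  by near=> x; rewrite -mulrBl nrmM.
by rewrite -[0](mul0r (nu a)); apply: cvgMl.
Unshelve. all: by end_near. Qed.

Lemma ncvgM f g l m : ncvg F f l -> ncvg F g m ->
  ncvg F (fun x => f x * g x) (l * m).
Proof.
move=> fl gm; apply: (@ncvg_le _ _ (fun x => nu (f x - l) * nu (g x - m)
   + (nu (f x - l) * nu m + nu l * nu (g x - m)))).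
  near=> x.
  have -> : f x * g x - l * m = (f x - l) * (g x - m)
      + ((f x - l) * m + l * (g x - m)).
    by rewrite addrA -mulrDr subrK mulrBl mulrBr addrA subrK.
  rewrite (le_trans (nrmD _ _ _))// lerD ?nrmM//.
  by rewrite (le_trans (nrmD _ _ _))// lerD ?nrmM.
rewrite [X in _ --> X](_ : 0 = 0 * 0 + (0 * nu m + nu l * 0)); last by ring.
by apply: cvgD; [exact: cvgM|apply: cvgD; [exact: cvgMl|exact: cvgMr]].
Unshelve. all: by end_near. Qed.

Lemma ncvgN f l : ncvg F f l -> ncvg F (fun x => - f x) (- l).
Proof.
move=> fl; apply: ncvg_le fl; near=> x.
by rewrite -opprD nrmN.
Unshelve. all: by end_near. Qed.

Lemma ncvgB f g l m : ncvg F f l -> ncvg F g m ->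
  ncvg F (fun x => f x - g x) (l - m).
Proof. by move=> fl gm; apply: ncvgD => //; exact: ncvgN. Qed.

Lemma ncvg_sum I (r : seq I) (f : I -> T -> A) (l : I -> A) :
  (forall i, ncvg F (f i) (l i)) ->
  ncvg F (fun x => \sum_(i <- r) f i x) (\sum_(i <- r) l i).
Proof.
move=> fl; elim: r => [|i r IH].
  by under eq_fun do rewrite big_nil; rewrite big_nil; exact: ncvg_cst.
by under eq_fun do rewrite big_cons; rewrite big_cons; exact: ncvgD.
Qed.

Lemma ncvg_unique f l m : ncvg F f l -> ncvg F f m -> l = m.
Proof.
move=> fl fm; apply/subr0_eq/(nrm_eq0 (a := nu)).
have := ncvgB fl fm; rewrite /ncvg.
under eq_cvg do rewrite subrr sub0r nrmN.
move=> h; apply: (@cvg_unique _ (@Rhausdorff K) (nu (l - m) @[_ --> F])) => //.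
exact: cvg_cst.
Qed.

Lemma ncvg_nrm f l : ncvg F f l -> nu (f x) @[x --> F] --> nu l.
Proof.
move=> fl; apply: cvg_zero.
apply: norm_cvg0.
apply: (squeeze_cvgr (f := cst 0) (h := fun x => nu (f x - l))) => //.
  near=> x; rewrite normr_ge0 /= ler_norml.
  have := nrmD nu (f x - l) l; rewrite subrK.
  have := nrmB (f x) (f x - l); rewrite subKr.
  by rewrite !fctE => ? ?; apply/andP; split; lra.
exact: cvg_cst.
Unshelve. all: by end_near. Qed.

Lemma ncvg_nrm_le f l c : (\forall x \near F, nu (f x) <= c) -> ncvg F f l ->
  nu l <= c.
Proof.
move=> fc /ncvg_nrm fl; rewrite -(cvg_lim _ fl)//.
by apply: limr_le => //; apply/cvg_ex; exists (nu l).
Qed.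

End Filter.

Lemma nsum_unique u s t : nsum u s -> nsum u t -> s = t.
Proof. exact: ncvg_unique. Qed.

Lemma nsum_eq u v s : u =1 v -> nsum u s -> nsum v s.
Proof. by move=> /funext ->. Qed.

Lemma nsumMl a u s : nsum u s -> nsum (fun k => a * u k) (a * s).
Proof.
move=> us; rewrite /nsum; under eq_fun do rewrite -mulr_sumr.
exact: ncvgMl.
Qed.

Lemma nsumB u v s t : nsum u s -> nsum v t -> nsum (fun k => u k - v k) (s - t).
Proof.
move=> us vt; rewrite /nsum; under eq_fun do rewrite sumrB.
exact: ncvgB.
Qed.

Lemma nsum_fin u n : (forall k, (n <= k)%N -> u k = 0) ->
  nsum u (\sum_(0 <= k < n) u k).
Proof.
move=> u0; apply: (ncvg_near _ (ncvg_cst _)); near=> m.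
rewrite /= [RHS](@big_cat_nat _ _ _ n)//=; last by near: m; exact: nbhs_infty_ge.
rewrite [X in _ + X]big1_seq ?addr0// => k /andP[_].
by rewrite mem_index_iota => /andP[nk _]; exact: u0.
Unshelve. all: by end_near. Qed.

Lemma nsum_tail u s w n : (forall k, nu (u k) <= w k) -> cvgn (series w) ->
  nsum u s ->
  nu (s - \sum_(0 <= k < n) u k) <= limn (series w) - series w n.
Proof.
move=> uw cw us.
apply: (@ncvg_nrm_le _ \oo _
  (fun m => \sum_(0 <= k < m) u k - \sum_(0 <= k < n) u k)).
  near=> m; have nm : (n <= m)%N by near: m; exact: nbhs_infty_ge.
  rewrite (@big_cat_nat _ _ _ n)//= addrAC subrr add0r.
  rewrite (le_trans (nrm_sum _ _ _))//.
  apply: (@le_trans _ _ (series w m - series w n)).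
    by rewrite sub_series_geq//; apply: ler_sum => k _; exact: uw.
  rewrite lerD2r; apply: nondecreasing_cvgn_le => //.
  apply/nondecreasing_seqP => k; rewrite seriesEnat /= big_nat_recr//= lerDl.
  by rewrite (le_trans _ (uw k))// nrm_ge0.
by apply: ncvgB => //; exact: ncvg_cst.
Unshelve. all: by end_near. Qed.

(* Dominated convergence for series. *)
Lemma tannery {T : Type} {F : set_system T} {FF : ProperFilter F}
    (f : T -> nat -> A) v w (s : T -> A) t :
  cvgn (series w) -> (\forall x \near F, forall k, nu (f x k) <= w k) ->
  (forall k, ncvg F (f^~ k) (v k)) ->
  (\forall x \near F, nsum (f x) (s x)) -> nsum v t -> ncvg F s t.
Proof.
move=> cw fw fv fs vt.
have vw k : nu (v k) <= w k.
  by apply: ncvg_nrm_le (fv k); near=> x; exact: (near fw x).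
apply/cvgrPdist_lt => e e0.
have [N tailN] : exists N, limn (series w) - series w N < e / 4.
  have e40 : 0 < e / 4 by rewrite divr_gt0.
  have /cvgrPdist_lt /(_ _ e40)[N _ /(_ N (leqnn N)) h] := cw; exists N.
  by rewrite (le_lt_trans _ h)// ler_norm.
have finN : ncvg F (fun x => \sum_(0 <= k < N) f x k) (\sum_(0 <= k < N) v k).
  exact: ncvg_sum.
have e2 : 0 < e / 2 by rewrite divr_gt0.
have /cvgrPdist_lt /(_ _ e2) {}finN := finN.
near=> x; rewrite sub0r normrN ger0_norm ?nrm_ge0//.
have h1 : nu (s x - \sum_(0 <= k < N) f x k) < e / 4.
  by apply: (le_lt_trans _ tailN); apply: nsum_tail => //; near: x.
have h2 : nu (t - \sum_(0 <= k < N) v k) < e / 4.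
  by apply: (le_lt_trans _ tailN); exact: nsum_tail.
have h3 : nu (\sum_(0 <= k < N) f x k - \sum_(0 <= k < N) v k) < e / 2.
  have : `|0 - nu (\sum_(0 <= k < N) f x k - \sum_(0 <= k < N) v k)| < e / 2.
    by near: x.
  by rewrite sub0r normrN ger0_norm ?nrm_ge0.
set a := \sum_(_ <= _ < _) _ in h1 h3; set b := \sum_(_ <= _ < _) _ in h2 h3.
have -> : s x - t = (s x - a) + ((a - b) - (t - b)).
  by rewrite opprB !addrA !subrK.
have := nrmD nu (s x - a) (a - b - (t - b)); have := nrmB (a - b) (t - b); lra.
Unshelve. all: by end_near. Qed.

(* Replaces positive stability by a condition without spectra: some norm that
   controls nu puts S in a disc inside the right half-plane. *)
Definition stable (S : A) := exists (mu : algnorm iota) (C c delta : K),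
  [/\ 0 < delta, (forall x, nu x <= C * mu x) & mu (iota c - S) <= c - delta].

Lemma stableD S m : stable S -> stable (S + m%:R).
Proof.
move=> [mu [C [c [d [d0 nuC Sd]]]]]; exists mu, C, (c + m%:R), d; split => //.
by rewrite rmorphD rmorph_nat opprD addrACA subrr addr0 addrAC (le_trans Sd)// lerDl.
Qed.

End NormedRing.
Arguments stable {K A iota} nu S.
Arguments ncvg {K A iota} nu {T} F u l.

(** * Raabe majorants *)

Section Raabe.
Context {K : realType}.
Implicit Types (u v : nat -> K) (eta : K).

(** Equal to 1 - (1+eta)/(k+1); written as a quotient, it makes k w_k telescope in [cvg_raabe]. *)
Definition raabe_ratio eta (k : nat) : K := (k%:R - eta) / k.+1%:R.

(* A sequence of order k^(-1-eta). *)
Definition raabe eta (k0 k : nat) : K :=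
  \prod_(0 <= j < k) (if (j < k0)%N then 1 else raabe_ratio eta j).

(** This is why the factors below [k0] are replaced by 1: [raabe_ratio eta j] is not positive for j
    <= eta. *)
Lemma raabe_gt0 eta k0 k : eta < k0%:R -> 0 < raabe eta k0 k.
Proof.
move=> etak0; apply: prodr_gt0 => j _; case: ltnP => // k0j.
by rewrite divr_gt0// subr_gt0 (lt_le_trans etak0)// ler_nat.
Qed.

Lemma raabeS eta k0 k : (k0 <= k)%N ->
  raabe eta k0 k.+1 = raabe eta k0 k * raabe_ratio eta k.
Proof. by move=> k0k; rewrite /raabe big_nat_recr//= ltnNge k0k. Qed.

(** For k >= k0 the terms satisfy eta w_k = k w_k - (k+1) w_(k+1), so the partial sums telescope and
    stay bounded. *)
Lemma cvg_raabe eta k0 : 0 < eta < k0%:R -> cvgn (series (raabe eta k0)).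
Proof.
move=> /andP[eta0 etak0].
pose w := raabe eta k0.
have w0 k : 0 < w k by exact: raabe_gt0.
apply: nondecreasing_is_cvgn.
  apply/nondecreasing_seqP => k.
  by rewrite !seriesEnat/= big_nat_recr//= lerDl ltW.
exists (series w k0 + k0%:R * w k0 / eta) => _ [n _ <-].
have step m : series w (k0 + m)%N
    = series w k0 + (k0%:R * w k0 - (k0 + m)%:R * w (k0 + m)%N) / eta.
  elim: m => [|m IH]; first by rewrite addn0 subrr mul0r addr0.
  rewrite addnS seriesSr IH.
  rewrite /w raabeS ?leq_addr// /raabe_ratio -/w.
  have : (k0 + m).+1%:R != 0 :> K by rewrite pnatr_eq0.
  rewrite -natr1 => z1.
  by field; rewrite lt0r_neq0// -natrD.
have mono : {homo series w : a b / (a <= b)%N >-> a <= b}.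
  apply/nondecreasing_seqP => k.
  by rewrite !seriesEnat/= big_nat_recr//= lerDl ltW.
apply: (@le_trans _ _ (series w (k0 + n)%N)); first exact/mono/leq_addl.
rewrite step lerD2l ler_pM2r ?invr_gt0// gerBl.
by rewrite mulr_ge0// ltW.
Qed.

(** The recurrence is a convex combination of one step and of two steps of the majorant, so the
    constant [C] of the initial values survives whatever r is. *)
Lemma raabe_bound2 eta k0 (r C : K) v : eta < k0%:R -> 0 <= r <= 1 -> 0 <= C ->
  (forall k, (k <= k0.+1)%N -> v k <= C * raabe eta k0 k) ->
  (forall k, (k0 <= k)%N -> v k.+2 <= (1 - r) * (raabe_ratio eta k.+1 * v k.+1)
    + r * (raabe_ratio eta k.+1 * raabe_ratio eta k * v k)) ->
  forall k, v k <= C * raabe eta k0 k.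
Proof.
move=> etak0 /andP[r0 r1] C0 vk0 vS k.
have ratio_ge0 j : (k0 <= j)%N -> 0 <= raabe_ratio eta j.
  move=> k0j; rewrite divr_ge0// subr_ge0 (le_trans (ltW etak0))//.
  by rewrite ler_nat.
suff H j : v (k0 + j)%N <= C * raabe eta k0 (k0 + j)
    /\ v (k0 + j).+1 <= C * raabe eta k0 (k0 + j).+1.
  have [kk0|k0k] := leqP k k0; first by apply: vk0; exact: leqW.
  by have [+ _] := H (k - k0)%N; rewrite subnKC// ltnW.
elim: j => [|j [IH1 IH2]]; first by rewrite addn0; split; apply: vk0.
rewrite addnS; split => //.
have k0j : (k0 <= k0 + j)%N by exact: leq_addr.
have a0 := ratio_ge0 _ k0j; have b0 := ratio_ge0 _ (leqW k0j).
apply: (le_trans (vS _ k0j)).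
rewrite raabeS; last exact: leqW.
have h1 : raabe_ratio eta (k0 + j).+1 * v (k0 + j).+1
   <= C * (raabe eta k0 (k0 + j).+1 * raabe_ratio eta (k0 + j).+1).
  by rewrite mulrC mulrA ler_wpM2r.
have h2 : raabe_ratio eta (k0 + j).+1 * raabe_ratio eta (k0 + j) * v (k0 + j)%N
   <= C * (raabe eta k0 (k0 + j).+1 * raabe_ratio eta (k0 + j).+1).
  rewrite raabeS// [leRHS](_ : _ = raabe_ratio eta (k0 + j).+1
    * raabe_ratio eta (k0 + j) * (C * raabe eta k0 (k0 + j))); last by ring.
  by rewrite ler_wpM2l// mulr_ge0.
rewrite [leRHS](_ : _ = (1 - r) * (C * (raabe eta k0 (k0 + j).+1
  * raabe_ratio eta (k0 + j).+1)) + r * (C * (raabe eta k0 (k0 + j).+1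
  * raabe_ratio eta (k0 + j).+1))); last by ring.
by apply: lerD; rewrite ler_wpM2l// subr_ge0.
Qed.

Lemma cvg_series_le u v : (forall k, 0 <= u k <= v k) -> cvgn (series v) ->
  cvgn (series u).
Proof.
move=> uv; apply: series_le_cvg => k; have /andP[u0 uvk] := uv k => //.
exact: le_trans uvk.
Qed.

Lemma raabe_cvg eta u : 0 < eta -> (forall k, 0 <= u k) ->
  (\forall k \near \oo, u k.+1 <= u k * raabe_ratio eta k) ->
  cvgn (series u).
Proof.
move=> eta0 u0 [N _ uN].
have [k0 k0P] : exists k0, eta < k0%:R /\ (N <= k0)%N.
  exists (maxn N (Num.bound eta)); split; last exact: leq_maxl.
  apply: (lt_le_trans (archi_boundP (ltW eta0))).
  by rewrite ler_nat leq_maxr.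
case: k0P => etak0 Nk0.
have w0 k := raabe_gt0 k etak0.
(* A sum of nonnegative quotients, used as an upper bound for each of them. *)
pose C := \sum_(0 <= k < k0.+1) u k / raabe eta k0 k.
have C0 k : 0 <= u k / raabe eta k0 k by rewrite divr_ge0// ltW.
have uC k : u k <= C * raabe eta k0 k.
  elim: k => [|k IH].
    rewrite -ler_pdivrMr// /C big_nat_recl//= lerDl.
    exact: sumr_ge0.
  have [kk0|k0k] := ltnP k k0.
    rewrite -ler_pdivrMr// /C (bigD1_seq k.+1) ?iota_uniq ?mem_index_iota//=.
    by rewrite lerDl; exact: sumr_ge0.
  rewrite (le_trans (uN k _))//=; first exact: leq_trans k0k.
  rewrite raabeS// mulrA ler_wpM2r// divr_ge0// subr_ge0.
  by rewrite (le_trans (ltW etak0))// ler_nat.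
apply: (@cvg_series_le _ (C *: raabe eta k0)) => [k|].
  by rewrite u0 uC.
by apply: is_cvg_seriesZ; apply: cvg_raabe; rewrite eta0.
Qed.

End Raabe.

(** * Hypergeometric series in a normed commutative ring *)

Section Pochhammer.
Context {A : pzRingType}.
Implicit Types x : A.

Definition rpoch x m : A := \prod_(0 <= k < m) (x + k%:R).

Lemma rpoch0 x : rpoch x 0 = 1.
Proof. by rewrite /rpoch big_geq. Qed.

Lemma rpochS x m : rpoch x m.+1 = rpoch x m * (x + m%:R).
Proof. by rewrite /rpoch big_nat_recr. Qed.

Lemma rpochD x m k : rpoch x (m + k) = rpoch x m * rpoch (x + m%:R) k.
Proof.
elim: k => [|k IH]; first by rewrite addn0 rpoch0 mulr1.
by rewrite addnS !rpochS IH -mulrA natrD addrA.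
Qed.

End Pochhammer.

Lemma rpoch_unit (A : unitRingType) (x : A) m :
  (forall k, x + k%:R \is a GRing.unit) -> rpoch x m \is a GRing.unit.
Proof. by move=> xu; apply: rpred_prod => k _; exact: xu. Qed.

Section Convolution.
Context {A : comPzRingType}.
Implicit Types (a b c : nat -> A).

Definition conv a b k : A := \sum_(0 <= j < k.+1) a (k - j)%N * b j.

(** Summation over the triangle i + j < M: cutting the convolution at M cuts the inner sum at M - j,
    hence no error term. *)
Lemma sum_conv a b c M : \sum_(0 <= k < M) c k * conv a b k
  = \sum_(0 <= j < M) b j * \sum_(0 <= i < M - j) a i * c (i + j)%N.
Proof.
elim: M => [|M IH]; first by rewrite !big_geq.
rewrite big_nat_recr//= IH.
have -> : \sum_(0 <= j < M) b j * \sum_(0 <= i < M - j) a i * c (i + j)%N =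
    \sum_(0 <= j < M.+1) b j * \sum_(0 <= i < M - j) a i * c (i + j)%N.
  by rewrite big_nat_recr//= subnn [X in _ * X]big_geq// mulr0 addr0.
rewrite mulr_sumr -big_split/=; apply: eq_big_nat => j /andP[_].
rewrite ltnS => jM; rewrite subSn// big_nat_recr//= subnK//.
by ring.
Qed.

Section Recurrence.
Variables (p s : A) (a b : nat -> A).
Hypothesis aS : forall i, i.+1%:R * a i.+1 = (p + i%:R) * a i.
Hypothesis bS : forall i, i.+1%:R * b i.+1 = s * (p + i%:R) * b i.

(** [X] and [Y] are the coefficients of x f' g and x f g', where f and g have the coefficients [a]
    and [b]; their sum belongs to x (f g)'. *)
Let X k := \sum_(0 <= j < k.+1) ((k - j)%:R * a (k - j)%N) * b j.
Let Y k := \sum_(0 <= j < k.+1) a (k - j)%N * (j%:R * b j).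

Let XY k : X k + Y k = k%:R * conv a b k.
Proof.
rewrite -big_split/= mulr_sumr; apply: eq_big_nat => j /andP[_].
by rewrite ltnS => jk; rewrite natrB//; ring.
Qed.

Let XS k : X k.+1 = p * conv a b k + X k.
Proof.
rewrite /X big_nat_recr//= subnn !mul0r addr0 mulr_sumr -big_split/=.
apply: eq_big_nat => j /andP[_]; rewrite ltnS => jk.
by rewrite subSn// aS; ring.
Qed.

Let YS k : Y k.+1 = s * (p * conv a b k + Y k).
Proof.
rewrite /Y big_nat_recl//= mul0r mulr0 add0r mulr_sumr -big_split/= mulr_sumr.
by apply: eq_big_nat => j _; rewrite subSS bS; ring.
Qed.

(** The recurrence [conv_rec] at k = -1, where its last term is absent. *)
Lemma conv_rec0 : conv a b 1 = (1 + s) * p * conv a b 0.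
Proof.
have := XY 1; rewrite mul1r => <-; rewrite XS YS.
have -> : X 0 = 0 by rewrite /X big_nat1 subnn !mul0r.
have -> : Y 0 = 0 by rewrite /Y big_nat1 mul0r mulr0.
by ring.
Qed.

(* If a and b are the coefficients of (1 - x)^(-p) and (1 - s x)^(-p), their product
   y satisfies (1 - x) (1 - s x) y' = p (1 + s - 2 s x) y. *)
Lemma conv_rec k : k.+2%:R * conv a b k.+2 =
  (1 + s) * (p + k.+1%:R) * conv a b k.+1 - s * (p + p + k%:R) * conv a b k.
Proof.
rewrite -XY [X _]XS [Y _]YS.
have e1 := XY k.+1; have e0 := XY k.
have -> : s * (p + p + k%:R) * conv a b k = s * X k.+1 + Y k.+1.
  by rewrite XS YS mulrDr mulrDl mulrDr -[s * k%:R * _]mulrA -e0; ring.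
have -> : (1 + s) * (p + k.+1%:R) * conv a b k.+1
    = (1 + s) * (p * conv a b k.+1 + (X k.+1 + Y k.+1)) by rewrite e1; ring.
by ring.
Qed.

End Recurrence.
End Convolution.

Section Bounds.
Context {K : realType} {A : comUnitRingType} {iota : {rmorphism K -> A}}.
Implicit Types (nu : algnorm iota) (x P Q R S : A).

(* The coefficients of (1 - t)^(-x). *)
Definition alpha x i : A := iota i`!%:R^-1 * rpoch x i.

Lemma iota_nat_unit k : (k.+1%:R : A) \is a GRing.unit.
Proof.
by rewrite -(rmorph_nat iota); apply: rmorph_unit; rewrite unitfE pnatr_eq0.
Qed.

Lemma iotaVnat k : iota k.+1%:R^-1 = k.+1%:R^-1.
Proof. by rewrite rmorphV ?rmorph_nat// unitfE pnatr_eq0. Qed.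

Lemma alpha0 x : alpha x 0 = 1.
Proof. by rewrite /alpha rpoch0 fact0 invr1 rmorph1 mulr1. Qed.

Lemma alphaS x i : i.+1%:R * alpha x i.+1 = (x + i%:R) * alpha x i.
Proof.
rewrite /alpha factS rpochS natrM invfM rmorphM iotaVnat.
by rewrite !mulrA mulrV ?iota_nat_unit// mul1r; ring.
Qed.

Lemma alphaSV x i : alpha x i.+1 = iota i.+1%:R^-1 * ((x + i%:R) * alpha x i).
Proof. by rewrite -alphaS mulrA iotaVnat mulVr ?mul1r// iota_nat_unit. Qed.

Definition poch_ratio Q R k : A := rpoch Q k * (rpoch R k)^-1.

Definition units_from R := forall k, R + k%:R \is a GRing.unit.

Lemma units_fromD R j : units_from R -> units_from (R + j%:R).
Proof. by move=> Ru k; rewrite -addrA -natrD. Qed.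

Lemma poch_ratio0 Q R : poch_ratio Q R 0 = 1.
Proof. by rewrite /poch_ratio !rpoch0 invr1 mulr1. Qed.

Lemma poch_ratioS Q R k : units_from R ->
  poch_ratio Q R k.+1 = poch_ratio Q R k * ((Q + k%:R) * (R + k%:R)^-1).
Proof.
move=> Ru; rewrite /poch_ratio !rpochS invrM ?rpoch_unit//.
by ring.
Qed.

Lemma poch_ratioD Q R j k : units_from R ->
  poch_ratio Q R (j + k) = poch_ratio Q R j * poch_ratio (Q + j%:R) (R + j%:R) k.
Proof.
move=> Ru; rewrite /poch_ratio !rpochD invrM ?rpoch_unit//; last first.
  exact: units_fromD.
by ring.
Qed.

(** For large k the identity k (R+k)^(-1) = 1 - R (R+k)^(-1) gives the bound; the finitely many
    other k only enlarge the constant. *)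
Lemma resolvent_bound nu R : units_from R ->
  exists2 C, 0 <= C & forall k, nu (R + k%:R)^-1 <= C / k.+1%:R.
Proof.
move=> Ru; pose X k := (R + k%:R)^-1.
(* For k >= 2 nu R + 1 one has k + 1 <= 2 (k - nu R), whence the constant 2 in [large]. *)
pose k0 := Num.bound (2 * nu R + 1).
have k0P : 2 * nu R + 1 < k0%:R.
  by apply: archi_boundP; rewrite addr_ge0// mulr_ge0// nrm_ge0.
have large k : (k0 <= k)%N -> nu (X k) * k.+1%:R <= 2.
  move=> k0k; have kk0 : (k0%:R : K) <= k%:R by rewrite ler_nat.
  have : nu (k%:R * X k) <= 1 + nu R * nu (X k).
    have -> : k%:R * X k = 1 - R * X k.
      by apply: (mulIr (Ru k)); rewrite mulrBl !mulrVK// mul1r addrC addKr.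
    by rewrite (le_trans (nrmB _ _ _))// nrm1 lerD2l nrmM.
  rewrite -(rmorph_nat iota) nrmZ ger0_norm// -natr1.
  have := nrm_ge0 nu (X k); have := nrm_ge0 nu R; nra.
exists (2 + \sum_(0 <= k < k0) nu (X k) * k.+1%:R) => [|k].
  by rewrite addr_ge0//; apply: sumr_ge0 => k _; rewrite mulr_ge0// nrm_ge0.
rewrite ler_pdivlMr//; have [k0k|kk0] := leqP k0 k.
  rewrite (le_trans (large _ k0k))// lerDl.
  by apply: sumr_ge0 => j _; rewrite mulr_ge0// nrm_ge0.
rewrite (bigD1_seq k) ?iota_uniq ?mem_index_iota//= addrCA lerDl addr_ge0//.
by apply: sumr_ge0 => j _; rewrite mulr_ge0// nrm_ge0.
Qed.

Lemma ratio_bound nu Q R : units_from R ->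
  exists2 C, 0 <= C &
    forall k, nu ((Q + k%:R) * (R + k%:R)^-1) <= 1 + C / k.+1%:R.
Proof.
move=> Ru; have [C C0 HC] := resolvent_bound nu Ru.
exists (nu (Q - R) * C) => [|k]; first by rewrite mulr_ge0// nrm_ge0.
have -> : (Q + k%:R) * (R + k%:R)^-1 = 1 + (Q - R) * (R + k%:R)^-1.
  by apply: (mulIr (Ru k)); rewrite [RHS]mulrDl !mulrVK// mul1r; ring.
rewrite (le_trans (nrmD _ _ _))// nrm1 lerD2l -mulrA.
by rewrite (le_trans (nrmM _ _ _))// ler_wpM2l// nrm_ge0.
Qed.

(* The factors in the two-term recurrence of the terms (Q)_k (R)_k^(-1) c_k(r), see
   kummer_termSS; tau is also the ratio of consecutive terms of the Gauss series. *)
Definition tau P Q R k : A :=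
  iota k.+1%:R^-1 * ((P + k%:R) * (Q + k%:R) * (R + k%:R)^-1).

Definition sigma P Q R k : A :=
  iota k.+2%:R^-1 * ((P + P + k%:R) * ((Q + k%:R) * (R + k%:R)^-1)
    * ((Q + k.+1%:R) * (R + k.+1%:R)^-1)).

Lemma near_ge_nat (c : K) : \forall k \near \oo, c <= k%:R.
Proof. exact: nbhs_infty_ger. Qed.

Section Stable.
Variables (nu : algnorm iota) (P Q R : A) (c delta : K).
Hypotheses (Ru : units_from R) (delta0 : 0 < delta).
Hypothesis nuS : nu (iota c - (R - P - Q)) <= c - delta.

(** With S = R-P-Q, (P+k)(Q+k) = (R+k)(k-S) + PQ + RS. The first summand contributes k - S, of norm
    at most k - delta; the rest is O(1/k) after division by R+k and costs half of delta. *)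
Lemma tau_bound : \forall k \near \oo, nu (tau P Q R k) <= raabe_ratio (delta / 2) k.
Proof.
have [C C0 HC] := resolvent_bound nu Ru.
near=> k.
have kc : c <= k%:R by near: k; exact: near_ge_nat.
have kC : nu (P * Q + R * (R - P - Q)) * C / (delta / 2) <= k%:R.
  by near: k; exact: near_ge_nat.
rewrite nrmZ ger0_norm ?invr_ge0// mulrC ler_pM2r ?invr_gt0//.
have -> : (P + k%:R) * (Q + k%:R) * (R + k%:R)^-1 =
   iota (k%:R - c) + (iota c - (R - P - Q))
   + (P * Q + R * (R - P - Q)) * (R + k%:R)^-1.
  rewrite rmorphB rmorph_nat addrA subrK.
  by apply: (mulIr (Ru k)); rewrite [RHS]mulrDl !mulrVK//; ring.
rewrite (le_trans (nrmD _ _ _))//.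
have h1 : nu (iota (k%:R - c) + (iota c - (R - P - Q))) <= k%:R - delta.
  rewrite (le_trans (nrmD _ _ _))// nrm_iota ger0_norm ?subr_ge0//.
  by have := nuS; lra.
have h2 : nu ((P * Q + R * (R - P - Q)) * (R + k%:R)^-1) <= delta / 2.
  rewrite (le_trans (nrmM _ _ _))//.
  apply: (@le_trans _ _ (nu (P * Q + R * (R - P - Q)) * (C / k.+1%:R))).
    by rewrite ler_wpM2l ?nrm_ge0.
  rewrite mulrA ler_pdivrMr//.
  move: kC; rewrite ler_pdivrMr ?divr_gt0// => /le_trans; apply.
  by rewrite mulrC ler_wpM2l ?ler_nat// divr_ge0// ltW.
lra.
Unshelve. all: by end_near. Qed.

(** Since (P+k+1)(P+k) = (2P+k)(k+1) + P(P-1), sigma is the product of two consecutive tau up to a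
    term of order k^(-2). Passing from delta/2 to delta/4 gains about delta/(2k), which absorbs
    it. *)
Lemma sigma_bound : \forall k \near \oo, nu (sigma P Q R k) <=
  raabe_ratio (delta / 4) k.+1 * raabe_ratio (delta / 4) k.
Proof.
have [C C0 HC] := ratio_bound nu Q Ru.
have /= HS := tau_bound; have HS1 := (cvg_addnr 1) _ HS.
pose D := nu (P * (P - 1)) * (1 + C) * (1 + C).
near=> k.
have t0 : nu (tau P Q R k) <= raabe_ratio (delta / 2) k by near: k; exact: HS.
have t1 : nu (tau P Q R k.+1) <= raabe_ratio (delta / 2) k.+1.
  by rewrite -addn1; near: k; exact: HS1.
have kd : delta <= k%:R by near: k; exact: near_ge_nat.
have kD : D * 2 / delta + delta <= k%:R by near: k; exact: near_ge_nat.
have q j : nu ((Q + j%:R) * (R + j%:R)^-1) <= 1 + C.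
  rewrite (le_trans (HC j))// lerD2l ler_pdivrMr// ler_peMr//.
  by rewrite ler1n.
have -> : sigma P Q R k = tau P Q R k.+1 * tau P Q R k
  - iota (k.+2%:R^-1 * k.+1%:R^-1) * (P * (P - 1)
   * ((Q + k%:R) * (R + k%:R)^-1) * ((Q + k.+1%:R) * (R + k.+1%:R)^-1)).
  rewrite /sigma /tau rmorphM.
  rewrite -[(P + _) * (Q + _) / _]mulrA.
  rewrite -[(P + k%:R) * (Q + _) / _]mulrA.
  set q0 := (Q + k%:R) / _; set q1 := (Q + k.+1%:R) / _.
  set i2 := iota k.+2%:R^-1; set i1 := iota k.+1%:R^-1.
  have e1 : (k%:R + 1) * i1 = 1.
    by rewrite natr1 /i1 iotaVnat mulrV ?iota_nat_unit.
  transitivity (i2 * ((P + P + k%:R) * q0 * q1) * ((k%:R + 1) * i1)).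
    by rewrite e1 mulr1.
  rewrite -natr1.
  by ring.
rewrite (le_trans (nrmB _ _ _))//.
have h1 : nu (tau P Q R k.+1 * tau P Q R k) <=
    raabe_ratio (delta / 2) k.+1 * raabe_ratio (delta / 2) k.
  by rewrite (le_trans (nrmM _ _ _))// ler_pM// nrm_ge0.
have h2 : nu (iota (k.+2%:R^-1 * k.+1%:R^-1) * (P * (P - 1)
   * ((Q + k%:R) * (R + k%:R)^-1) * ((Q + k.+1%:R) * (R + k.+1%:R)^-1))) <=
   k.+2%:R^-1 * k.+1%:R^-1 * D.
  rewrite nrmZ ger0_norm ?mulr_ge0 ?invr_ge0// ler_wpM2l ?mulr_ge0 ?invr_ge0//.
  rewrite (le_trans (nrmM _ _ _))// ler_pM ?nrm_ge0//.
  by rewrite (le_trans (nrmM _ _ _))// ler_pM ?nrm_ge0.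
apply: (le_trans (lerD h1 h2)).
have D0 : 0 <= D by rewrite !mulr_ge0 ?nrm_ge0// addr_ge0.
rewrite /raabe_ratio.
have -> : forall a b d : K, a / k.+2%:R * (b / k.+1%:R) + k.+2%:R^-1 / k.+1%:R * d =
   (a * b + d) * (k.+2%:R^-1 / k.+1%:R) by move=> *; ring.
have -> : forall a b : K, a / k.+2%:R * (b / k.+1%:R) =
   a * b * (k.+2%:R^-1 / k.+1%:R) by move=> *; ring.
rewrite ler_wpM2r ?mulr_ge0 ?invr_ge0//.
have {}kD : D * 2 <= (k%:R - delta) * delta.
  by rewrite -ler_pdivrMr//; lra.
have d2 : 0 < delta * delta by rewrite mulr_gt0.
rewrite -natr1 -subr_ge0.
rewrite [X in 0 <= X](_ : _ = ((k%:R - delta) * delta - D * 2) / 2 + delta / 4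
  + delta * delta * 5 / 16); last by field.
rewrite -subr_ge0 in kD; rewrite addr_ge0//; last by rewrite divr_ge0// mulr_ge0// ltW.
by rewrite addr_ge0// divr_ge0// ltW.
Unshelve. all: by end_near. Qed.

(** Weakened so that tau and sigma share one exponent, as [raabe_bound2] requires. *)
Lemma tau_bound4 : \forall k \near \oo, nu (tau P Q R k) <= raabe_ratio (delta / 4) k.
Proof.
have HS := tau_bound; near=> k.
have t0 : nu (tau P Q R k) <= raabe_ratio (delta / 2) k by near: k; exact: HS.
by rewrite (le_trans t0)// ler_pM2r ?invr_gt0// lerD2l lerN2; have := delta0; lra.
Unshelve. all: by end_near. Qed.

End Stable.
End Bounds.
Arguments alpha {K A} iota x i.
Arguments tau {K A} iota P Q R k.
Arguments sigma {K A} iota P Q R k.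

Lemma cvg_series_le_near {K : realType} (u v : nat -> K) :
  (forall k, 0 <= u k) ->
  (\forall k \near \oo, u k <= v k) -> cvgn (series v) -> cvgn (series u).
Proof.
move=> u0 [N _ uv] cv; rewrite -(is_cvg_series_restrict N) in cv.
rewrite -(is_cvg_series_restrict N); apply: nondecreasing_is_cvgn.
  apply/nondecreasing_seqP => n; have [nN|Nn] := ltnP n N.
    by rewrite [leLHS]big_geq ?(ltnW nN)//; exact: sumr_ge0.
  by rewrite [leRHS]big_nat_recr//= lerDl.
have [M Mv] := cvg_has_ub cv.
exists M => _ [n _ <-].
apply: le_trans (Mv _ _); last by exists n.
rewrite (le_trans _ (ler_norm _))//= big_nat [leRHS]big_nat.
apply: ler_sum => k /andP[Nk _]; exact: uv.
Qed.

Section Growth.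
Context {K : realType}.
Implicit Types a b r : K.

(** Equal to (1+a)_j / j!, hence of order j^a, which r^j beats for r < 1. *)
Definition growth a j : K := \prod_(0 <= l < j) (1 + a / l.+1%:R).

Lemma growth_ge0 a j : 0 <= a -> 0 <= growth a j.
Proof. by move=> a0; apply: prodr_ge0 => l _; rewrite addr_ge0// divr_ge0. Qed.

Lemma growthS a j : growth a j.+1 = growth a j * (1 + a / j.+1%:R).
Proof. by rewrite /growth big_nat_recr. Qed.

Lemma cvg_growth a b r : 0 <= a -> 0 <= b -> 0 <= r < 1 ->
  cvgn (series (fun j => r ^+ j * (growth a j * growth b j))).
Proof.
move=> a0 b0 /andP[r0 r1]; apply: (@raabe_cvg _ 1) => //.
  by move=> k; rewrite !mulr_ge0 ?exprn_ge0 ?growth_ge0.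
near=> k.
rewrite exprSr !growthS.
rewrite [leLHS](_ : _ = r ^+ k * (growth a k * growth b k)
  * (r * ((1 + a / k.+1%:R) * (1 + b / k.+1%:R)))); last by ring.
rewrite ler_wpM2l ?mulr_ge0 ?exprn_ge0 ?growth_ge0// /raabe_ratio.
have kM : (a + b + a * b + 2) / (1 - r) <= k%:R by near: k; exact: near_ge_nat.
move: kM; rewrite ler_pdivrMr ?subr_gt0// => kM.
rewrite ler_pdivlMr//.
have k1 : 1 <= k.+1%:R :> K by rewrite ler1n.
have -> : r * ((1 + a / k.+1%:R) * (1 + b / k.+1%:R)) * k.+1%:R =
    r * (k.+1%:R + a + b + a * b / k.+1%:R).
  by field; rewrite gt_eqF// (lt_le_trans ltr01).
have : r * (k.+1%:R + a + b + a * b / k.+1%:R) <= r * (k.+1%:R + a + b + a * b).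
  rewrite ler_wpM2l// lerD2l ler_pdivrMr ?ler_peMr ?mulr_ge0//.
have : 0 <= a * b by rewrite mulr_ge0.
move=> ab0 /le_trans; apply; rewrite -natr1; move: (a * b) ab0 kM => c c0.
move: (k%:R : K) => x kM.
have : 0 <= (1 - r) * (a + b + c) by rewrite mulr_ge0 ?subr_ge0 ?(ltW r1)// !addr_ge0.
nra.
Unshelve. all: by end_near. Qed.

End Growth.

Section Summation.
Context {K : realType} {A : comUnitRingType} {iota : {rmorphism K -> A}}.
Variable nu : algnorm iota.
Implicit Types P Q R S : A.
Local Notation alpha := (alpha iota).
Local Notation tau := (tau iota).
Local Notation sigma := (sigma iota).

Local Notation stable := (stable nu).

Lemma nrm_alpha P j : nu (alpha P j) <= growth (nu P) j.
Proof.
elim: j => [|j IH]; first by rewrite alpha0 nrm1 /growth big_geq.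
rewrite alphaSV growthS mulrA mulrC (le_trans (nrmM _ _ _))//.
rewrite ler_pM ?nrm_ge0// nrmZ ger0_norm ?invr_ge0// mulrC ler_pdivrMr//.
rewrite mulrDl mul1r divfK ?pnatr_eq0//.
rewrite (le_trans (nrmD _ _ _))// nrm_nat addrC lerD2r// ler_nat.
by [].
Qed.

(** One constant serves all shifts i, because the bound C/(i+l+1) for the ratio at i+l is at most
    C/(l+1). *)
Lemma nrm_poch_ratio Q R : units_from R -> exists2 C, 0 <= C &
  forall i j, nu (poch_ratio (Q + i%:R) (R + i%:R) j) <= growth C j.
Proof.
move=> Ru; have [C C0 HC] := ratio_bound nu Q Ru; exists C => // i.
elim=> [|j IH]; first by rewrite poch_ratio0 nrm1 /growth big_geq.
rewrite poch_ratioS ?growthS; last exact: units_fromD.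
rewrite (le_trans (nrmM _ _ _))// ler_pM ?nrm_ge0// -!addrA -!natrD.
rewrite (le_trans (HC _))// lerD2l ler_wpM2l// lef_pV2 ?posrE//.
by rewrite ler_nat ltnS leq_addl.
Qed.

Lemma disc_cvg P Q R (z : A) : units_from R -> nu z < 1 ->
  cvgn (series (fun j => nu (alpha P j * poch_ratio Q R j * z ^+ j))).
Proof.
move=> Ru z1; have [C C0 HC] := nrm_poch_ratio Q Ru.
have z01 : 0 <= nu z < 1 by rewrite nrm_ge0.
apply: cvg_series_le (cvg_growth (nrm_ge0 nu P) C0 z01).
move=> k; rewrite nrm_ge0/= (le_trans (nrmM _ _ _))// mulrC.
rewrite ler_pM ?nrm_ge0// ?nrmX//.
rewrite (le_trans (nrmM _ _ _))// ler_pM ?nrm_ge0// ?nrm_alpha//.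
by have := HC 0%N k; rewrite !addr0.
Qed.

Section Stable.
Variables P Q R : A.
Hypothesis Ru : units_from R.
Hypothesis RPQ : stable (R - P - Q).

(** Raabe's test is applied in the adapted norm [mu], in which the ratios tau contract; [nuC]
    carries the result over to [nu]. *)
Lemma gauss_summable :
  cvgn (series (fun i => nu (alpha P i * poch_ratio Q R i))).
Proof.
have [mu [C [c [d [d0 nuC Sd]]]]] := RPQ.
apply: (@cvg_series_le _ _ (C *: (fun i => mu (alpha P i * poch_ratio Q R i)))).
  by move=> k; rewrite nrm_ge0/=; exact: nuC.
apply: is_cvg_seriesZ; apply: (@raabe_cvg _ (d / 2)); first by rewrite divr_gt0.
  by move=> k; exact: nrm_ge0.
have tb := tau_bound Ru d0 Sd; near=> k.
have -> : alpha P k.+1 * poch_ratio Q R k.+1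
    = alpha P k * poch_ratio Q R k * tau P Q R k.
  by rewrite alphaSV poch_ratioS// /tau; ring.
rewrite (le_trans (nrmM _ _ _))// ler_wpM2l ?nrm_ge0//.
by near: k.
Unshelve. all: by end_near. Qed.

(* The coefficients of (1 + r t)^(-P). *)
Definition beta (r : K) j : A := iota ((- r) ^+ j) * alpha P j.

Lemma betaS r j :
  j.+1%:R * beta r j.+1 = iota (- r) * (P + j%:R) * beta r j.
Proof. by rewrite /beta exprS rmorphM mulrCA alphaS; ring. Qed.

Definition kummer_term r k := poch_ratio Q R k * conv (alpha P) (beta r) k.

(** This is [conv_rec] with s = -r: the coefficients 1 + s and -s become the weights 1 - r and r. *)
Lemma kummer_termSS r k : kummer_term r k.+2 =
  iota (1 - r) * (tau P Q R k.+1 * kummer_term r k.+1)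
  + iota r * (sigma P Q R k * kummer_term r k).
Proof.
rewrite /kummer_term -[conv _ _ k.+2]mul1r -(mulVr (@iota_nat_unit _ _ iota k.+1)).
rewrite -(@iotaVnat _ _ iota) -[iota _ * _ * _]mulrA (conv_rec (alphaS P) (betaS r)).
rewrite /tau /sigma !poch_ratioS// rmorphB rmorph1 rmorphN.
by ring.
Qed.

Lemma kummer_unif_bound : exists2 w, cvgn (series w) &
  forall r k, 0 <= r <= 1 -> nu (kummer_term r k) <= w k.
Proof.
have [mu [C [c [d [d0 nuC Sd]]]]] := RPQ.
have C0 : 0 <= C by have := nuC 1; rewrite !nrm1 mulr1; exact: le_trans.
have [N1 _ t1] := tau_bound4 Ru d0 Sd.
have [N2 _ s1] := sigma_bound Ru d0 Sd.
pose eta := d / 4.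
have eta0 : 0 < eta by rewrite divr_gt0.
pose k0 := maxn (maxn N1 N2) (Num.bound eta).
have k0eta : eta < k0%:R.
  apply: (lt_le_trans (archi_boundP (ltW eta0))).
  by rewrite ler_nat leq_maxr.
(* A bound for the k-th term that is valid for all r in [0, 1], because |(-r)^j| <= 1; it is applied
   to the initial indices only. *)
pose B k := mu (poch_ratio Q R k)
  * \sum_(0 <= j < k.+1) mu (alpha P (k - j)) * mu (alpha P j).
have B0 k : 0 <= B k.
  by rewrite mulr_ge0 ?nrm_ge0//; apply: sumr_ge0 => j _; rewrite mulr_ge0 ?nrm_ge0.
pose w := raabe eta k0; have w0 k : 0 < w k by exact: raabe_gt0.
(* The range includes [k0.+1], since a recurrence with two terms needs two initial values. *)
pose D := \sum_(0 <= k < k0.+2) B k / w k.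
have Bw0 k : 0 <= B k / w k by rewrite divr_ge0// ltW.
have D0 : 0 <= D by exact: sumr_ge0.
exists (C *: (D *: w)).
  by apply/is_cvg_seriesZ/is_cvg_seriesZ; apply: cvg_raabe; rewrite eta0.
move=> r k r01; rewrite (le_trans (nuC _))// ler_wpM2l//.
apply: (@raabe_bound2 _ eta k0 r D (fun k => mu (kummer_term r k))) => //.
  move=> j jk0; apply: (@le_trans _ _ (B j)).
    rewrite (le_trans (nrmM _ _ _))// ler_wpM2l ?nrm_ge0//.
    rewrite (le_trans (nrm_sum _ _ _ _))//; apply: ler_sum => l _.
    rewrite (le_trans (nrmM _ _ _))// ler_wpM2l ?nrm_ge0// nrmZ.
    rewrite ler_piMl ?nrm_ge0// normrX normrN.
    by have /andP[r0 r1] := r01; rewrite exprn_ile1// ger0_norm.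
  rewrite -ler_pdivrMr// /D (bigD1_seq j) ?iota_uniq ?mem_index_iota//=.
  by rewrite lerDl; exact: sumr_ge0.
move=> j k0j; have /andP[r0 r1] := r01.
rewrite kummer_termSS (le_trans (nrmD _ _ _))// !nrmZ.
rewrite !ger0_norm ?subr_ge0// lerD// ler_wpM2l ?subr_ge0//.
  rewrite (le_trans (nrmM _ _ _))// ler_wpM2r ?nrm_ge0//; apply: t1 => /=.
  by rewrite leqW// (leq_trans _ k0j)// !leq_max leqnn.
rewrite (le_trans (nrmM _ _ _))// ler_wpM2r ?nrm_ge0//; apply: s1 => /=.
by rewrite (leq_trans _ k0j)// !leq_max leqnn orbT.
Qed.

End Stable.
End Summation.
Arguments beta {K A} iota P r j.
Arguments kummer_term {K A} iota P Q R r k.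

(** * Gauss's summation theorem by contiguity *)

Section Gauss.
Context {K : realType} {A : comUnitRingType} {iota : {rmorphism K -> A}}.
Variable nu : algnorm iota.
Hypothesis nuC : ncomplete nu.
Implicit Types P Q R S : A.
Local Notation alpha := (alpha iota).
Local Notation stable := (stable nu).

Definition gauss_term P Q R i : A := alpha P i * poch_ratio Q R i.

Lemma gauss_termS_shift P Q R i : units_from R ->
  (R + i%:R) * gauss_term P Q (R + 1) i = R * gauss_term P Q R i.
Proof.
move=> Ru; rewrite /gauss_term /poch_ratio.
have Ru1 : units_from (R + 1) by exact: (units_fromD 1 Ru).
have e : R * rpoch (R + 1) i = rpoch R i * (R + i%:R).
  have := rpochD R 1 i; rewrite add1n rpochS => ->.
  by rewrite /rpoch big_nat1 addr0.
have Ri := rpoch_unit i Ru; have R1i := rpoch_unit i Ru1.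
have {}e : (R + i%:R) * (rpoch (R + 1) i)^-1 = R * (rpoch R i)^-1.
  apply: (mulIr R1i); rewrite mulrVK//; apply: (mulIr Ri).
  by rewrite mulrC -e mulrAC mulrVK.
transitivity (alpha P i * rpoch Q i * ((R + i%:R) * (rpoch (R + 1) i)^-1)).
  by ring.
by rewrite e; ring.
Qed.

Lemma gauss_termS P Q R i : units_from R ->
  (R + i%:R) * (i.+1%:R * gauss_term P Q R i.+1)
  = (P + i%:R) * (Q + i%:R) * gauss_term P Q R i.
Proof.
move=> Ru; rewrite /gauss_term poch_ratioS// [_ * (alpha _ _ * _)]mulrA alphaS.
apply: etrans (_ : ((P + i%:R) * alpha P i * (poch_ratio Q R i * (Q + i%:R)))
   * ((R + i%:R) * (R + i%:R)^-1) = _); first by ring.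
by rewrite mulrV//; ring.
Qed.

(** The contiguity relation holds termwise up to a telescoping difference. Multiplication by R+i
    turns the term with R+1 and the term of index i+1 into multiples of [gauss_term P Q R i], after
    which it is a polynomial identity. *)
Lemma gauss_telescope P Q R i : units_from R ->
  R * (R - P - Q) * gauss_term P Q R i
  - (R - P) * (R - Q) * gauss_term P Q (R + 1) i
  = R * (i%:R * gauss_term P Q R i - i.+1%:R * gauss_term P Q R i.+1).
Proof.
move=> Ru; apply: (mulrI (Ru i)).
have e1 := gauss_termS_shift P Q i Ru; have e2 := gauss_termS P Q i Ru.
transitivity ((R + i%:R) * (R * (R - P - Q) * gauss_term P Q R i)
    - (R - P) * (R - Q) * ((R + i%:R) * gauss_term P Q (R + 1) i)); first by ring.
transitivity (R * ((R + i%:R) * (i%:R * gauss_term P Q R i)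
    - (R + i%:R) * (i.+1%:R * gauss_term P Q R i.+1))); last by ring.
by rewrite e1 e2; ring.
Qed.

Lemma gauss_exists P Q R : units_from R -> stable (R - P - Q) ->
  exists s, nsum nu (gauss_term P Q R) s.
Proof. by move=> Ru RPQ; apply: nuC; exact: gauss_summable. Qed.

(* Otherwise u would be comparable with the harmonic series. *)
Lemma nlim_0 (u : nat -> A) l : cvgn (series (fun i => nu (u i))) ->
  ncvg nu \oo (fun n => n%:R * u n) l -> l = 0.
Proof.
move=> cu ul; apply: (nrm_eq0 (a := nu)); apply/eqP/negPn/negP => l0.
have {}l0 : 0 < nu l by rewrite lt_neqAle eq_sym l0 nrm_ge0.
have := @dvg_harmonic K; apply.
apply: (@cvg_series_le_near _ _ ((2 / nu l) *: (fun i => nu (u i)))); last 2 first.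
- near=> k.
  have h : nu l / 2 < nu (k%:R * u k).
    near: k; apply: (cvgr_gt (nu l)); first exact: ncvg_nrm.
    by rewrite ltr_pdivrMr// ltr_pMr// ltr1n.
  move: h; rewrite -(rmorph_nat iota) nrmZ ger0_norm// => h.
  have : nu l / 2 < k.+1%:R * nu (u k).
    by rewrite (lt_le_trans h)// ler_wpM2r ?nrm_ge0// ler_nat.
  move=> {}h; rewrite /= -[X in X <= _]mul1r ler_pdivrMr//.
  rewrite [X in X <= _](_ : _ = 2 / nu l * (nu l / 2)); last first.
    by field; rewrite gt_eqF.
  rewrite [X in _ <= X * _](_ : _ = 2 / nu l * nu (u k))//.
  rewrite -[leRHS]mulrA ler_wpM2l ?divr_ge0 ?(ltW l0)// [leRHS]mulrC.
  exact: ltW.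
- exact: is_cvg_seriesZ.
- by move=> k; rewrite /= invr_ge0.
Unshelve. all: by end_near. Qed.

(** The partial sums of the difference are -R n u_n, with u the Gauss terms. As both series
    converge, n u_n has a limit, which is 0 by [nlim_0]. *)
Lemma gauss_contig P Q R F F1 : units_from R -> stable (R - P - Q) ->
  nsum nu (gauss_term P Q R) F -> nsum nu (gauss_term P Q (R + 1)) F1 ->
  R * (R - P - Q) * F = (R - P) * (R - Q) * F1.
Proof.
move=> Ru RPQ HF HF1; apply/eqP; rewrite -subr_eq0; apply/eqP.
have R0 : R \is a GRing.unit by have := Ru 0%N; rewrite addr0.
have H := nsumB (nsumMl (R * (R - P - Q)) HF) (nsumMl ((R - P) * (R - Q)) HF1).
set L := R * _ * F - _ in H *.
have psum n : \sum_(0 <= k < n) (R * (R - P - Q) * gauss_term P Q R k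
    - (R - P) * (R - Q) * gauss_term P Q (R + 1) k)
    = - R * (n%:R * gauss_term P Q R n).
  elim: n => [|n IH]; first by rewrite big_geq// mul0r mulr0.
  by rewrite big_nat_recr//= IH gauss_telescope//; ring.
have H1 : ncvg nu \oo (fun n => n%:R * gauss_term P Q R n) (- R^-1 * L).
  apply: (ncvg_near _ (ncvgMl (- R^-1) H)); near=> n.
  by rewrite /= psum mulrA mulrNN mulVr// mul1r.
have := nlim_0 (gauss_summable Ru RPQ) H1.
move/(congr1 ( *%R (- R))); rewrite mulrA mulrNN mulrV// mul1r mulr0.
by [].
Unshelve. all: by end_near. Qed.

Lemma gauss_iter P Q R F Fm m : units_from R -> stable (R - P - Q) ->
  nsum nu (gauss_term P Q R) F -> nsum nu (gauss_term P Q (R + m%:R)) Fm ->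
  rpoch R m * rpoch (R - P - Q) m * F = rpoch (R - P) m * rpoch (R - Q) m * Fm.
Proof.
move=> Ru RPQ HF; elim: m Fm => [|m IH] Fm.
  by rewrite addr0 !rpoch0 => HFm; rewrite !mul1r; exact: nsum_unique HF HFm.
move=> HFm.
have Rmu : units_from (R + m%:R) by exact: units_fromD.
have RmPQ : stable (R + m%:R - P - Q).
  by rewrite [_ - P]addrAC [_ - Q]addrAC; exact: stableD.
have [G HG] := gauss_exists Rmu RmPQ.
have IHG := IH _ HG.
have := gauss_contig Rmu RmPQ HG.
rewrite -addrA natr1 => /(_ _ HFm) e.
rewrite !rpochS.
transitivity ((R + m%:R) * (R + m%:R - P - Q)
    * (rpoch R m * rpoch (R - P - Q) m * F)); first by ring.
rewrite IHG; transitivity (rpoch (R - P) m * rpoch (R - Q) m *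
   ((R + m%:R) * (R + m%:R - P - Q) * G)); first by ring.
by rewrite e; ring.
Qed.

(** The terms of index at least 1 are compared with those of a convergent scalar series 2F1(p, q;
    c0; 1), and they carry an additional factor of order 1/m. *)
Lemma gauss_shift_to1 P Q R (F : nat -> A) : units_from R ->
  (forall m, nsum nu (gauss_term P Q (R + m%:R)) (F m)) -> ncvg nu \oo F 1.
Proof.
move=> Ru HF.
(* The excess c0 - p - q = 1 is positive, so the scalar series with terms [d] converges. *)
pose p := nu P; pose q := nu Q; pose c0 := p + q + 1.
have p0 : 0 <= p by exact: nrm_ge0.
have q0 : 0 <= q by exact: nrm_ge0.
have c0gt : 0 < c0 by rewrite /c0; lra.
have [C C0 HC] := resolvent_bound nu Ru.
pose d i : K := \prod_(0 <= l < i) ((p + l%:R) * (q + l%:R)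
  / (l.+1%:R * (c0 + l%:R))).
have fac0 l : 0 <= (p + l%:R) * (q + l%:R) / (l.+1%:R * (c0 + l%:R)).
  by rewrite divr_ge0// mulr_ge0// addr_ge0// ltW.
have d0 i : 0 <= d i by apply: prodr_ge0 => l _.
have dS i : d i.+1 = d i * ((p + i%:R) * (q + i%:R) / (i.+1%:R * (c0 + i%:R))).
  by rewrite /d big_nat_recr.
have cd : cvgn (series d).
  apply: (@raabe_cvg _ (1 / 2)) => //; near=> k.
  rewrite dS ler_wpM2l// /raabe_ratio [k.+1%:R * _]mulrC invfM mulrA.
  rewrite ler_wpM2r ?invr_ge0// ler_pdivrMr; last by rewrite ltr_wpDr.
  have : 2 * p * q + c0 <= k%:R by near: k; exact: near_ge_nat.
  by rewrite /c0; move: (k%:R : K) => x; nra.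
have [M0 M0P] : exists M0 : nat, nu R + c0 <= M0%:R.
  by exists (Num.bound (nu R + c0)); rewrite ltW// archi_boundP// addr_ge0 ?nrm_ge0// ltW.
(* The factor for l = 0 keeps its denominator m - nu R and makes the bound tend to 0 with m; in the
   later factors m - nu R is replaced by the smaller c0. *)
have bound m i : (M0 <= m)%N ->
    nu (gauss_term P Q (R + m%:R) i.+1) <= d i.+1 * (c0 / (m%:R - nu R)).
  move=> M0m.
  have mM : nu R + c0 <= m%:R by rewrite (le_trans M0P)// ler_nat.
  have cpos : 0 < m%:R - nu R by lra.
  have Rmu : units_from (R + m%:R) by exact: units_fromD.
  have res l : nu (R + m%:R + l%:R)^-1 <= (m%:R - nu R + l%:R)^-1.
    set X := _^-1.
    have xpos : 0 < m%:R - nu R + l%:R by rewrite ltr_wpDr.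
    rewrite -[leRHS]mul1r ler_pdivlMr//.
    have : nu ((m + l)%:R * X) <= 1 + nu R * nu X.
      have -> : (m + l)%:R * X = 1 - R * X.
        apply: (mulIr (Rmu l)); rewrite mulrBl !mulrVK// mul1r natrD.
        by ring.
      by rewrite (le_trans (nrmB _ _ _))// nrm1 lerD2l nrmM.
    rewrite -(rmorph_nat iota) nrmZ ger0_norm// natrD; lra.
  have ratio l : nu (iota l.+1%:R^-1 * ((P + l%:R) * (Q + l%:R)
       * (R + m%:R + l%:R)^-1)) <=
      (p + l%:R) * (q + l%:R) / (l.+1%:R * (m%:R - nu R + l%:R)).
    rewrite nrmZ ger0_norm ?invr_ge0// [leRHS](_ : _ = l.+1%:R^-1 *
      ((p + l%:R) * (q + l%:R) / (m%:R - nu R + l%:R))); last first.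
      by rewrite invfM; ring.
    rewrite ler_wpM2l ?invr_ge0// (le_trans (nrmM _ _ _))// ler_pM ?nrm_ge0//.
    rewrite (le_trans (nrmM _ _ _))// ler_pM ?nrm_ge0//.
    - by rewrite (le_trans (nrmD _ _ _))// nrm_nat.
    - by rewrite (le_trans (nrmD _ _ _))// nrm_nat.
  have gS l : gauss_term P Q (R + m%:R) l.+1 = gauss_term P Q (R + m%:R) l *
     (iota l.+1%:R^-1 * ((P + l%:R) * (Q + l%:R) * (R + m%:R + l%:R)^-1)).
    by rewrite /gauss_term alphaSV poch_ratioS//; ring.
  elim: i => [|i IH].
    rewrite gS {1}/gauss_term alpha0 poch_ratio0 !mul1r (le_trans (ratio 0%N))//.
    rewrite dS /d big_geq// !addr0 !mul1r -[leRHS]mulrA ler_wpM2l ?mulr_ge0//.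
    by rewrite mulrA mulVf ?gt_eqF// mul1r.
  rewrite gS (le_trans (nrmM _ _ _))// dS [leRHS]mulrAC ler_pM ?nrm_ge0//.
  rewrite (le_trans (ratio _))// ler_wpM2l ?mulr_ge0 ?addr_ge0//.
  have a0 : 0 < m%:R - nu R + i.+1%:R by rewrite ltr_wpDr.
  have b0 : 0 < c0 + i.+1%:R by rewrite ltr_wpDr.
  have le_ab : c0 + i.+1%:R <= m%:R - nu R + i.+1%:R by rewrite lerD2r; lra.
  by rewrite lef_pV2 ?posrE ?(mulr_gt0 _ a0) ?(mulr_gt0 _ b0)// ler_wpM2l.
apply: (@ncvg_le _ _ _ _ _ _ _ _ _
  (fun m => (limn (series d)) * (c0 / (m%:R - nu R)))).
  near=> m.
  have M0m : (M0 <= m)%N by near: m; exact: nbhs_infty_ge.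
  have mM : nu R + c0 <= m%:R by rewrite (le_trans M0P)// ler_nat.
  have cpos : 0 <= c0 / (m%:R - nu R) by rewrite divr_ge0 ?(ltW c0gt)//; lra.
  have g0 : gauss_term P Q (R + m%:R) 0 = 1.
    by rewrite /gauss_term alpha0 poch_ratio0 mul1r.
  pose u := fun i => if i is i'.+1 then gauss_term P Q (R + m%:R) i else 0.
  have uF : nsum nu u (F m - 1).
    have := nsumB (HF m) (nsum_fin nu (u := fun k => if k is 0 then 1 else 0) (n := 1) _).
    rewrite big_nat1 => H; apply: nsum_eq (H _) => [[|i]|[|i]]//.
      by rewrite g0 subrr.
    by rewrite subr0.
  apply: ncvg_nrm_le uF; near=> n.
  rewrite (le_trans (nrm_sum _ _ _ _))//.
  apply: (@le_trans _ _ (\sum_(0 <= k < n) d k * (c0 / (m%:R - nu R)))).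
    apply: ler_sum => -[|i] _; first by rewrite nrm0 mulr_ge0.
    exact: bound.
  rewrite -mulr_suml ler_wpM2r//.
  apply: (@nondecreasing_cvgn_le _ (series d)) => //.
  by apply/nondecreasing_seqP => k; rewrite seriesSr lerDl.
rewrite -[X in _ --> X](mulr0 (limn (series d))); apply: cvgMr.
rewrite -[X in _ --> X](mulr0 c0); apply: cvgMr.
apply/cvgrPdist_lt => e e0; near=> m.
rewrite sub0r normrN normfV.
have mM : nu R + e^-1 + 1 <= m%:R by near: m; exact: near_ge_nat.
have einv : 0 < e^-1 by rewrite invr_gt0.
rewrite ger0_norm; last lra.
rewrite -[ltRHS]invrK ltf_pV2 ?posrE//; lra.
Unshelve. all: by end_near. Qed.

(* Gi stands for 1/Gamma, and E x m for m^(-x) / (m-1)!. *)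
Lemma gauss_sum P Q R F (Gi : A -> A) (E : A -> nat -> A) :
  units_from R -> stable (R - P - Q) -> nsum nu (gauss_term P Q R) F ->
  (forall X, X \in [:: R; R - P - Q; R - P; R - Q] ->
     ncvg nu \oo (fun m => rpoch X m * E X m) (Gi X)) ->
  (forall m, E R m * E (R - P - Q) m = E (R - P) m * E (R - Q) m) ->
  Gi R * Gi (R - P - Q) * F = Gi (R - P) * Gi (R - Q).
Proof.
move=> Ru RPQ HF HG HE.
have ex m : exists Fm, nsum nu (gauss_term P Q (R + m%:R)) Fm.
  apply: gauss_exists; first exact: units_fromD.
  by rewrite [_ - P]addrAC [_ - Q]addrAC; exact: stableD.
have {}ex m := cid (ex m).
have F1 := gauss_shift_to1 Ru (fun m => projT2 (ex m)).
apply: (@ncvg_unique _ _ _ nu _ \oo _ (fun m => rpoch R m * E R m *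
  (rpoch (R - P - Q) m * E (R - P - Q) m) * F)).
  apply: ncvgMr; apply: ncvgM; apply: HG; rewrite !inE eqxx ?orbT//.
rewrite -[X in ncvg _ _ _ X]mulr1.
apply: (ncvg_near _ (ncvgM (ncvgM (HG (R - P) _) (HG (R - Q) _)) F1)); last 2 first.
- by rewrite !inE eqxx ?orbT.
- by rewrite !inE eqxx ?orbT.
near=> m.
transitivity (rpoch (R - P) m * rpoch (R - Q) m * projT1 (ex m)
  * (E (R - P) m * E (R - Q) m)); first by ring.
by rewrite -HE -(gauss_iter Ru RPQ HF (projT2 (ex m))); ring.
Unshelve. all: by end_near. Qed.

End Gauss.
Arguments gauss_term {K A} iota P Q R i.

(** * The limit r -> 1 *)

Section Kummer.
Context {K : realType} {A : comUnitRingType} {iota : {rmorphism K -> A}}.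
Variable nu : algnorm iota.
Hypothesis nuC : ncomplete nu.
Variables P Q R G : A.
Local Notation alpha := (alpha iota).
Local Notation beta := (beta iota).
Hypothesis Ru : units_from R.
Hypothesis RPQ : stable nu (R - P - Q).
Hypothesis HG : forall j,
  nsum nu (gauss_term iota P (Q + j%:R) (R + j%:R))
    (G * (rpoch R j * (rpoch (R - P) j)^-1)).

(** The M-th partial sum equals the sum over j of [F M j], which contains the Gauss series cut off
    at M - j. [tannery] lets M tend to infinity in all of these at once. *)
Lemma kummer_disc r f : 0 <= r < 1 ->
  nsum nu (fun j => alpha P j * poch_ratio Q (R - P) j * iota (- r) ^+ j) f ->
  nsum nu (kummer_term iota P Q R r) (G * f).
Proof.
move=> /andP[r0 r1] Hf.
have [C C0 HC] := nrm_poch_ratio nu Q Ru.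
pose T := limn (series (fun i => nu (alpha P i * poch_ratio Q R i))).
have sT := gauss_summable Ru RPQ.
pose u j i := alpha P i * poch_ratio Q R (i + j)%N.
(* The quotient (Q)_(i+j) / (R)_(i+j) is split at i: a summable Gauss term remains, and the other
   factor is bounded uniformly in i. *)
have ub j n : \sum_(0 <= i < n) nu (u j i) <= T * growth C j.
  apply: (@le_trans _ _ (\sum_(0 <= i < n) nu (alpha P i * poch_ratio Q R i)
      * growth C j)).
    apply: ler_sum => i _; rewrite /u poch_ratioD// mulrA.
    by rewrite (le_trans (nrmM _ _ _))// ler_wpM2l ?nrm_ge0.
  rewrite -mulr_suml ler_wpM2r ?growth_ge0//.
  apply: (@nondecreasing_cvgn_le _ (series _)) => //.
  by apply/nondecreasing_seqP => k; rewrite seriesSr lerDl nrm_ge0.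
pose F M j := if (j < M)%N then beta P r j * \sum_(0 <= i < M - j) u j i else 0.
pose w := T *: (fun j => r ^+ j * (growth (nu P) j * growth C j)).
have T0 : 0 <= T by have := ub 0%N 0%N; rewrite big_geq// /growth big_geq// mulr1.
have HGf := nsumMl G Hf.
apply: (@tannery _ _ _ nu _ _ _ F _ w _ _ _ _ _ _ HGf).
- by apply: is_cvg_seriesZ; apply: cvg_growth; rewrite ?nrm_ge0// r0.
- near=> M => j; rewrite /F; case: ifP => _; last first.
    by rewrite nrm0 mulr_ge0// mulr_ge0 ?exprn_ge0 ?mulr_ge0 ?growth_ge0 ?nrm_ge0.
  rewrite (le_trans (nrmM _ _ _))//.
  rewrite [leRHS](_ : _ = r ^+ j * growth (nu P) j * (T * growth C j)); last first.
    rewrite -[LHS]/(T * (r ^+ j * (growth (nu P) j * growth C j))); ring.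
  rewrite ler_pM ?nrm_ge0//.
    rewrite nrmZ normrX normrN ger0_norm// ler_wpM2l ?exprn_ge0//.
    exact: nrm_alpha.
  by rewrite (le_trans (nrm_sum _ _ _ _)).
- move=> j.
  have e : G * (alpha P j * poch_ratio Q (R - P) j * iota (- r) ^+ j) =
     beta P r j * (poch_ratio Q R j * (G * (rpoch R j * (rpoch (R - P) j)^-1))).
    rewrite /beta rmorphXn /poch_ratio.
    transitivity (iota (- r) ^+ j * alpha P j * (rpoch Q j
       * (G * (rpoch (R - P) j)^-1)) * ((rpoch R j)^-1 * rpoch R j)).
      by rewrite mulVr ?rpoch_unit//; ring.
    by ring.
  rewrite e.
  (* Now the split is at j, which leaves the Gauss series with Q and R both shifted by j. *)
  have H : nsum nu (u j) (poch_ratio Q R j * (G * (rpoch R j * (rpoch (R - P) j)^-1))).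
    apply: nsum_eq (nsumMl _ (HG j)) => i.
    by rewrite /u /gauss_term addnC poch_ratioD//; ring.
  have H' : ncvg nu \oo (fun M => \sum_(0 <= i < M - j) u j i)
      (poch_ratio Q R j * (G * (rpoch R j * (rpoch (R - P) j)^-1))).
    by have := cvg_comp _ _ (cvg_subnr j) H.
  apply: (ncvg_near _ (ncvgMl (beta P r j) H')); near=> M.
  have jM : (j < M)%N by near: M; exact: nbhs_infty_gt.
  by rewrite /F jM.
- near=> M.
  have -> : \sum_(0 <= k < M) kummer_term iota P Q R r k = \sum_(0 <= j < M) F M j.
    rewrite /kummer_term sum_conv; apply: eq_big_nat => j /andP[_ jM].
    by rewrite /F jM.
  by apply: nsum_fin => j Mj; rewrite /F ltnNge Mj.
Unshelve. all: by end_near. Qed.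

Lemma kummer_limit : exists L, nsum nu (kummer_term iota P Q R 1) L /\
  forall f : K -> A, (forall r, 0 <= r < 1 ->
    nsum nu (fun j => alpha P j * poch_ratio Q (R - P) j * iota (- r) ^+ j) (f r)) ->
  ncvg nu (1 : K)^'- (fun r => G * f r) L.
Proof.
have [w cw wP] := kummer_unif_bound Ru RPQ.
have [L HL] : exists L, nsum nu (kummer_term iota P Q R 1) L.
  apply: nuC; apply: cvg_series_le cw => k.
  by rewrite nrm_ge0 /= wP// ler01 lexx.
exists L; split=> // f Hf.
have r01 : \forall r \near (1 : K)^'-, 0 <= r < 1.
  near=> r; apply/andP; split; near: r; [exact: nbhs_left_ge|exact: nbhs_left_lt].
apply: (@tannery _ _ _ nu _ _ _ (kummer_term iota P Q R) _ w _ _ cw _ _ _ HL).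
- near=> r => k; have /andP[r0 r1] : 0 <= r < 1 by near: r.
  by apply: wP; rewrite r0 ltW.
- move=> k; apply: ncvgMl; rewrite /conv; apply: ncvg_sum => j.
  apply: ncvgMl; apply: ncvgMr; rewrite /ncvg.
  have : (fun r : K => `|(- r) ^+ j - (- 1) ^+ j|) r @[r --> (1 : K)^'-] --> (0 : K).
    rewrite -(normr0 K) -[X in `|X|](subrr ((- 1) ^+ j)).
    apply: cvg_norm; apply: cvgB; last exact: cvg_cst.
    apply: (@continuous_cvg _ _ _ _ _ _ (fun x : K => x ^+ j)).
      exact: exprn_continuous.
    by apply: cvgN; apply: cvg_at_left_filter; exact: cvg_id.
  by apply: cvg_trans; apply: near_eq_cvg; near=> r; rewrite -rmorphB nrm_iota.
- near=> r; have r01' : 0 <= r < 1 by near: r.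
  exact: kummer_disc (Hf _ _).
Unshelve. all: by end_near. Qed.

(** At r = 1 the factor 1 + s of the middle term of [conv_rec] is 0, so the recurrence links indices
    of equal parity, and the odd coefficients start with 0. *)
Lemma conv_one m : conv (alpha P) (beta P 1) m.*2 = alpha P m
  /\ conv (alpha P) (beta P 1) m.*2.+1 = 0.
Proof.
have s0 : 1 + iota (- 1) = 0 by rewrite rmorphN1 subrr.
elim: m => [|m [IH1 IH2]].
  rewrite double0; split; first by rewrite /conv big_nat1 /beta !alpha0 expr0 rmorph1 !mulr1.
  by rewrite (conv_rec0 (alphaS P) (betaS P 1)) s0 !mul0r.
split; last first.
  apply: (mulrI (@iota_nat_unit _ _ iota m.*2.+2)).
  rewrite (conv_rec (alphaS P) (betaS P 1)) s0 -doubleS.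
  by rewrite IH2 !mul0r !mulr0 subrr.
apply: (mulrI (@iota_nat_unit _ _ iota m.*2.+1)).
rewrite (conv_rec (alphaS P) (betaS P 1)) s0 !mul0r add0r IH1 rmorphN1.
have -> : m.*2.+2%:R = 2 * m.+1%:R :> A by rewrite -natrM mul2n doubleS.
transitivity (2 * ((P + m%:R) * alpha P m)).
  by rewrite -mul2n natrM; ring.
by rewrite -alphaS; ring.
Qed.

(** Partial sums of even length suffice, as [L] is already the limit of all of them. *)
Lemma kummer_term_one_sum L : nsum nu (kummer_term iota P Q R 1) L ->
  nsum nu (fun m => alpha P m * poch_ratio Q R m.*2) L.
Proof.
move=> HL; rewrite /nsum /ncvg.
have dbl : double n @[n --> \oo] --> \oo.
  move=> S [N _ NS]; exists N => // n /= Nn; apply: NS => /=.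
  by rewrite (leq_trans Nn)// -addnn leq_addr.
have e n : \sum_(0 <= k < n.*2) kummer_term iota P Q R 1 k
    = \sum_(0 <= m < n) alpha P m * poch_ratio Q R m.*2.
  elim: n => [|n IH]; first by rewrite !big_geq.
  rewrite doubleS !big_nat_recr//= IH /kummer_term.
  by have [-> ->] := conv_one n; rewrite mulr0 addr0 [in RHS]mulrC.
have := cvg_comp _ _ dbl HL; apply: cvg_trans; apply: near_eq_cvg.
by near=> n; rewrite /= e.
Unshelve. all: by end_near. Qed.

End Kummer.

(** * Matrix norms and stability *)

Lemma cvg_sum {K : realType} {T : Type} {F : set_system T} {FF : Filter F}
    (I : Type) (r : seq I) (f : I -> T -> K) (l : I -> K) :
  (forall i, f i x @[x --> F] --> l i) ->
  \sum_(i <- r) f i x @[x --> F] --> \sum_(i <- r) l i.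
Proof.
move=> fl; elim: r => [|i r IH].
  by under eq_fun do rewrite big_nil; rewrite big_nil; exact: cvg_cst.
by under eq_fun do rewrite big_cons; rewrite big_cons; exact: cvgD.
Qed.

Section PullNorm.
Context {K : realType} {A B : nzRingType} {iA : {rmorphism K -> A}}.
Context {iB : {rmorphism K -> B}} (phi : {rmorphism B -> A}).
Hypotheses (phi_iota : forall c, phi (iB c) = iA c) (phi_inj : injective phi).
Variable nu : algnorm iA.

(** Restricts norms to a subring; the bicommutant receives both the row-sum norm and the adapted
    norms in this way. *)
Program Definition pull_norm : algnorm iB :=
  @AlgNorm K B iB (nu \o phi) _ _ _ _ _.
Next Obligation. by move=> x y /=; rewrite rmorphD nrmD. Qed.
Next Obligation. by move=> x y /=; rewrite rmorphM nrmM. Qed.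
Next Obligation. by move=> c x /=; rewrite rmorphM phi_iota nrmZ. Qed.
Next Obligation. by rewrite /= rmorph1 nrm1. Qed.
Next Obligation.
by move=> x /= /nrm_eq0 => x0; apply: phi_inj; rewrite x0 rmorph0.
Qed.

End PullNorm.

Section ConjNorm.
Context {K : realType} {A : unitRingType} {iota : {rmorphism K -> A}}.
Variables (nu : algnorm iota) (T : A).
Hypotheses (Tu : T \is a GRing.unit).
Hypothesis iotaC : forall c, iota c * T = T * iota c.

(** A change of basis expressed as a change of norm, so that the matrices themselves stay where they
    are. *)
Program Definition conj_norm : algnorm iota :=
  @AlgNorm K A iota (fun x => nu (T * x * T^-1)) _ _ _ _ _.
Next Obligation. by move=> x y /=; rewrite mulrDr mulrDl nrmD. Qed.
Next Obligation.
move=> x y /=; rewrite (le_trans _ (nrmM _ _ _))//.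
by rewrite !mulrA mulrVK.
Qed.
Next Obligation. by move=> c x /=; rewrite mulrA -iotaC -!mulrA nrmZ !mulrA. Qed.
Next Obligation. by rewrite /= mulr1 mulrV// nrm1. Qed.
Next Obligation.
move=> x /= /nrm_eq0 => x0; apply: (mulrI Tu); rewrite mulr0.
by apply: (@mulIr _ T^-1); rewrite ?unitrV// x0 mul0r.
Qed.

Lemma le_conj_norm x : nu x <= nu T^-1 * nu T * conj_norm x.
Proof.
have {1}-> : x = T^-1 * (T * x * T^-1) * T by rewrite -!mulrA mulVr// mulr1 mulKr.
rewrite (le_trans (nrmM _ _ _))// mulrAC ler_wpM2r ?nrm_ge0//.
exact: nrmM.
Qed.

End ConjNorm.

Section MatrixNorm.
Context {K : realType} {n : nat}.
Local Notation M := 'M[K[i]]_n.+1.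
Local Notation nc := (@Normc.normc K).
Implicit Types (X Y : M) (z : K[i]).

Definition mxiota (r : K) : M := r%:C%:M.

HB.instance Definition _ :=
  GRing.RMorphism.copy mxiota (@scalar_mx K[i] n.+1 \o @real_complex K).

Lemma mxiotaZ r X : mxiota r * X = r%:C *: X.
Proof. exact: mul_scalar_mx. Qed.

Lemma mxiotaC r X : mxiota r * X = X * mxiota r.
Proof. exact/esym/scalar_mxC. Qed.

Lemma normc_ge0 z : 0 <= nc z.
Proof. by case: z => a b; exact: sqrtr_ge0. Qed.

Lemma normc_real (r : K) : nc r%:C = `|r|.
Proof. by rewrite /= expr0n addr0 sqrtr_sqr. Qed.

Lemma normr_normc z : `|z| = (nc z)%:C.
Proof. by case: z. Qed.

Lemma Re_le_normc z : `|complex.Re z| <= nc z.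
Proof.
case: z => a b /=; rewrite -sqrtr_sqr ler_sqrt ?lerDl ?sqr_ge0//.
by rewrite addr_ge0 ?sqr_ge0.
Qed.

Lemma Im_le_normc z : `|complex.Im z| <= nc z.
Proof.
case: z => a b /=; rewrite -sqrtr_sqr ler_sqrt ?lerDr ?sqr_ge0//.
by rewrite addr_ge0 ?sqr_ge0.
Qed.

Lemma normc_le z : nc z <= `|complex.Re z| + `|complex.Im z|.
Proof.
case: z => a b /=.
rewrite -[leRHS]ger0_norm ?addr_ge0// -sqrtr_sqr ler_sqrt ?sqr_ge0//.
rewrite sqrrD !real_normK ?num_real// -addrA [X in _ <= _ + X]addrC addrA lerDl.
by rewrite mulrn_wge0// mulr_ge0.
Qed.

Definition rowsum X i : K := \sum_j nc (X i j).

(** The operator norm induced by the maximum norm on column vectors. *)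
Definition mxn X : K := \big[Num.max/0]_i rowsum X i.

Lemma rowsum_ge0 X i : 0 <= rowsum X i.
Proof. by apply: sumr_ge0 => j _; exact: normc_ge0. Qed.

Lemma rowsum_le_mxn X i : rowsum X i <= mxn X.
Proof. exact: le_bigmax. Qed.

Lemma mxn_le X c : 0 <= c -> (forall i, rowsum X i <= c) -> mxn X <= c.
Proof. by move=> c0 h; apply: bigmax_le => // i _. Qed.

Lemma mxn_ge0 X : 0 <= mxn X.
Proof. exact: bigmax_ge_id. Qed.

Lemma normc_le_mxn X i j : nc (X i j) <= mxn X.
Proof.
apply: le_trans (rowsum_le_mxn X i).
by rewrite /rowsum (bigD1 j)//= lerDl sumr_ge0// => k _; exact: normc_ge0.
Qed.

Lemma normc_sum I (r : seq I) (P : pred I) (f : I -> K[i]) :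
  nc (\sum_(k <- r | P k) f k) <= \sum_(k <- r | P k) nc (f k).
Proof.
elim/big_ind2: _ => [|x a y b xa yb|//]; first by rewrite Normc.normc0.
by rewrite (le_trans (le_normcD _ _))// lerD.
Qed.

Program Definition mxnorm : algnorm mxiota :=
  @AlgNorm K M mxiota mxn _ _ _ _ _.
Next Obligation.
move=> X Y; apply: mxn_le => [|i]; first by rewrite addr_ge0 ?mxn_ge0.
apply: (@le_trans _ _ (rowsum X i + rowsum Y i)).
  rewrite -big_split; apply: ler_sum => j _.
  by rewrite mxE; exact: le_normcD.
by rewrite lerD ?rowsum_le_mxn.
Qed.
Next Obligation.
move=> X Y; apply: mxn_le => [|i]; first by rewrite mulr_ge0 ?mxn_ge0.
apply: (@le_trans _ _ (\sum_k nc (X i k) * rowsum Y k)).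
  rewrite (_ : \sum_k _ = \sum_j \sum_k nc (X i k) * nc (Y k j)).
    apply: ler_sum => j _; rewrite mxE (le_trans (normc_sum _ _ _))//.
    by apply: ler_sum => k _; rewrite Normc.normcM.
  by rewrite exchange_big; apply: eq_bigr => k _; rewrite mulr_sumr.
apply: (@le_trans _ _ (\sum_k nc (X i k) * mxn Y)).
  by apply: ler_sum => k _; rewrite ler_wpM2l ?normc_ge0// rowsum_le_mxn.
by rewrite -mulr_suml ler_wpM2r ?mxn_ge0// rowsum_le_mxn.
Qed.
Next Obligation.
have rZ c (X : M) i : rowsum (mxiota c * X) i = `|c| * rowsum X i.
  rewrite mulr_sumr; apply: eq_bigr => j _.
  by rewrite mxiotaZ mxE Normc.normcM normc_real.
move=> c X; apply/le_anti/andP; split.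
  apply: mxn_le => [|i]; first by rewrite mulr_ge0 ?mxn_ge0.
  by rewrite rZ ler_wpM2l// rowsum_le_mxn.
have [->|c0] := eqVneq c 0; first by rewrite normr0 mul0r mxn_ge0.
have nc0 : 0 < `|c| by rewrite normr_gt0.
rewrite mulrC -ler_pdivlMr//; apply: mxn_le => [|i].
  by rewrite divr_ge0 ?mxn_ge0.
by rewrite ler_pdivlMr// mulrC -rZ rowsum_le_mxn.
Qed.
Next Obligation.
have r1 i : rowsum 1 i = 1.
  rewrite /rowsum (bigD1 i)//= mxE eqxx Normc.normc1 big1 ?addr0// => j ij.
  by rewrite mxE eq_sym (negbTE ij) Normc.normc0.
apply/le_anti/andP; split; first by apply: mxn_le => // i; rewrite r1.
by rewrite -(r1 ord0) rowsum_le_mxn.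
Qed.
Next Obligation.
move=> X X0; apply/matrixP => i j; rewrite mxE.
apply: Normc.eq0_normc; apply/le_anti/andP; split; last exact: normc_ge0.
by rewrite -X0 normc_le_mxn.
Qed.

Lemma mxn_le_sum X : mxn X <= \sum_i \sum_j nc (X i j).
Proof.
apply: mxn_le => [|i].
  by apply: sumr_ge0 => i _; exact: rowsum_ge0.
rewrite (bigD1 i)//= lerDl; apply: sumr_ge0 => k _; exact: rowsum_ge0.
Qed.

Section Cvg.
Context {T : Type} {F : set_system T} {FF : ProperFilter F}.
Implicit Types (u : T -> M) (L : M).

Lemma ncvg_mxP u L : ncvg mxnorm F u L <-> forall i j,
  complex.Re (u x i j) @[x --> F] --> complex.Re (L i j) /\
  complex.Im (u x i j) @[x --> F] --> complex.Im (L i j).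
Proof.
split=> [uL i j|uL].
  have sq (f : K[i] -> K) : (forall z, `|f z| <= nc z) ->
      (forall z w, f (z - w) = f z - f w) -> f (u x i j) @[x --> F] --> f (L i j).
    move=> fn fB; apply: cvg_zero; apply: norm_cvg0.
    apply: (squeeze_cvgr (f := cst 0) (h := fun x => mxnorm (u x - L))) => //.
      near=> x; rewrite normr_ge0 /= !fctE -fB (le_trans (fn _))//.
      by have := normc_le_mxn (u x - L) i j; rewrite !mxE.
    exact: cvg_cst.
  split; apply: sq; [exact: Re_le_normc| |exact: Im_le_normc|];
  by move=> [a b] [c d].
apply: (@ncvg_le _ _ _ _ _ _ _ _ _ (fun x => \sum_i \sum_j
  (`|complex.Re (u x i j) - complex.Re (L i j)|
   + `|complex.Im (u x i j) - complex.Im (L i j)|))).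
  near=> x; rewrite (le_trans (mxn_le_sum _))//.
  apply: ler_sum => i _; apply: ler_sum => j _.
  rewrite (le_trans (normc_le _))// !mxE.
  by case: (u x i j) => a b; case: (L i j).
rewrite [X in _ --> X](_ : 0 = \sum_(i < n.+1) \sum_(j < n.+1) 0); last first.
  by rewrite big1// => i _; rewrite big1.
apply: cvg_sum => i; apply: cvg_sum => j; have [uR uI] := uL i j.
rewrite -[X in _ --> X]addr0 -{1}[X in X + _](normr0 K) -[X in _ + X](normr0 K).
apply: cvgD; apply: cvg_norm.
  by rewrite -(subrr (complex.Re (L i j))); apply: cvgB => //; exact: cvg_cst.
by rewrite -(subrr (complex.Im (L i j))); apply: cvgB => //; exact: cvg_cst.
Unshelve. all: by end_near. Qed.

Lemma mx_cvgP u L : u x @[x --> F] --> L <-> ncvg mxnorm F u L.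
Proof.
split=> [/cvg_ballP uL|uL].
  apply: (@ncvg_le _ _ _ _ _ _ _ _ _ (fun x => \sum_i \sum_j nc ((u x - L) i j))).
    by near=> x; exact: mxn_le_sum.
  rewrite [X in _ --> X](_ : 0 = \sum_(i < n.+1) \sum_(j < n.+1) 0); last first.
    by rewrite big1// => i _; rewrite big1.
  apply: cvg_sum => i; apply: cvg_sum => j.
  apply/cvgrPdist_lt => e e0; have := uL e%:C; rewrite ltcR => /(_ e0) H.
  near=> x; have [_ /(_ i j)] : ball L e%:C (u x) by near: x.
  rewrite /ball/= /ball_ normr_normc ltcR sub0r normrN ger0_norm ?normc_ge0//.
  by rewrite !mxE -normcN opprB.
apply/cvg_ballP => e; rewrite ltcE => /andP[/eqP e1 e0]; near=> x; split.
  by rewrite ltcE e1 eqxx.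
move=> i j; rewrite /ball/= /ball_ normr_normc ltcE/= e1 eqxx/=.
rewrite -normcN opprB; have := normc_le_mxn (u x - L) i j; rewrite !mxE.
move=> /le_lt_trans; apply.
have : `|0 - mxnorm (u x - L)| < complex.Re e.
  by near: x; exact: (cvgrPdist_lt _ _).1.
by rewrite sub0r normrN ger0_norm ?mxn_ge0.
Unshelve. all: by end_near. Qed.

(** [lim] picks some limit in the entrywise topology; that it is [L] follows from uniqueness for the
    norm. *)
Lemma mx_lim u L : ncvg mxnorm F u L -> lim (u x @[x --> F]) = L.
Proof.
move=> uL; have := uL; move/mx_cvgP => uL'.
apply: (ncvg_unique (nu := mxnorm) (F := F) (f := u)) => //; apply/mx_cvgP.
by apply: (@getPex _ (fun l => u x @[x --> F] --> l)); exists L.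
Qed.

End Cvg.

Lemma mx_complete : ncomplete mxnorm.
Proof.
move=> u cu.
have ex (f : K[i] -> K) i j : (forall z, `|f z| <= nc z) ->
    cvgn (series (fun k => f (u k i j))).
  move=> fn; apply: normed_cvg.
  apply: series_le_cvg cu => k //=; first exact: mxn_ge0.
  by rewrite (le_trans (fn _))// normc_le_mxn.
exists (\matrix_(i, j) (limn (series (fun k => complex.Re (u k i j)))
  +i* limn (series (fun k => complex.Im (u k i j))))).
apply/ncvg_mxP => i j; rewrite mxE /=.
have sumE (f : {additive K[i] -> K}) m :
    f ((\sum_(0 <= k < m) u k) i j) = series (fun k => f (u k i j)) m.
  by rewrite summxE raddf_sum.
split.
  under eq_fun do rewrite (sumE (@complex.Re K)).
  exact: ex (Re_le_normc).
under eq_fun do rewrite (sumE (@complex.Im K)).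
exact: ex (Im_le_normc).
Qed.

End MatrixNorm.

Section AdaptedNorm.
Context {K : realType} {n : nat}.
Local Notation M := 'M[K[i]]_n.+1.
Local Notation nc := (@Normc.normc K).

Lemma triangularize (S : M) : exists2 P : M, P \is a GRing.unit &
  is_trig_mx (P * S * P^-1) /\
  forall i, eigenvalue S ((P * S * P^-1) i i).
Proof.
have [P Pu trP] := @Schur K[i] n.+1 S isT.
have Punit := unitarymx_unit Pu.
have trig : is_trig_mx (P * S * P^-1).
  by move: trP; rewrite /similar_to /= conjumx.
exists P => //; split=> // i.
apply: (@eigenvalue_conjmx _ _ _ P S).
- by rewrite stablemx_unit.
- by rewrite row_free_unit.
rewrite -[_ \in _]/(eigenvalue (conjmx P S) ((P * S * P^-1) i i)).
rewrite conjumx// eigenvalue_root_char.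
rewrite (char_poly_trig (A := P *m S *m invmx P))// rootE horner_prod.
by rewrite (bigD1 i)//= hornerXsubC subrr mul0r.
Qed.

(* The half-plane Re z >= 3 d is exhausted by discs that stay at distance 2 d from
   the imaginary axis. *)
Lemma normc_half_plane (z : K[i]) (B d : K) : 0 < d -> nc z <= B ->
  3 * d <= complex.Re z ->
  nc ((B ^+ 2 / (2 * d) + 2 * d)%:C - z) <= B ^+ 2 / (2 * d).
Proof.
move=> d0; case: z => a b /= zB ad.
set c := _ + _.
have s0 : 0 <= a ^+ 2 + b ^+ 2 by rewrite addr_ge0 ?sqr_ge0.
have zB2 : a ^+ 2 + b ^+ 2 <= B ^+ 2.
  by rewrite -(sqr_sqrtr s0) lerXn2r// ?nnegrE ?sqrtr_ge0// (le_trans _ zB)// sqrtr_ge0.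
set e := B ^+ 2 / (2 * d) in c *.
have e0 : 0 <= e by rewrite divr_ge0 ?sqr_ge0// mulr_ge0// ltW.
have eB : e * (2 * d) = B ^+ 2 by rewrite divfK// mulf_neq0// gt_eqF.
rewrite -[leRHS](ger0_norm e0) -sqrtr_sqr ler_sqrt ?sqr_ge0// /c add0r sqrrN.
nra.
Qed.

(* Conjugating a triangular form by diag(t^i) with t small makes the off-diagonal
   part negligible. *)
Lemma positive_stable_stable (S : M) : positive_stable S -> stable mxnorm S.
Proof.
move=> posS; have [P Pu [trig eigX]] := triangularize S.
set X := P * S * P^-1 in trig eigX.
have XE : X = P * S * P^-1 by []; clearbody X.
pose B := mxn X.
(* By [normc_half_plane], real parts of at least 3 d bound the diagonal of c I - Y by c - 2 d; the
   off-diagonal row sums use another d, which leaves c - d. The cap at 1 ensures t <= 1. *)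
pose d : K := \big[Num.min/1]_i complex.Re (X i i) / 3.
have d0 : 0 < d.
  rewrite divr_gt0//; apply: lt_bigmin => // i _; exact/posS/eigX.
have d1 : d <= 1.
  by rewrite ler_pdivrMr// mul1r (le_trans (bigmin_le_id _ _ _ _))// ler1n.
have dX i : 3 * d <= complex.Re (X i i).
  by rewrite mulrC divfK// bigmin_le_cond.
pose t : K := d / (B + 1).
have B0 : 0 <= B by exact: mxn_ge0.
have t0 : 0 < t by rewrite divr_gt0// ltr_wpDl.
have t1 : t <= 1 by rewrite ler_pdivrMr ?mul1r ?ltr_wpDl// (le_trans d1)// lerDr.
have tB : t * B <= d.
  rewrite /t mulrAC ler_pdivrMr ?ltr_wpDl// ler_wpM2l ?(ltW d0)// lerDl//.
pose D : M := diag_mx (\row_i (t ^+ i)%:C).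
have Du : D \is a GRing.unit.
  rewrite -[_ \is a _]/(D \in unitmx) unitmxE det_diag unitfE.
  apply/prodf_neq0 => i _; rewrite mxE fmorph_eq0 expf_neq0// gt_eqF//.
(* For i < j the truncated exponent is 0, in accordance with [DXY] because X vanishes above the
   diagonal. *)
pose Y : M := \matrix_(i, j) ((t ^+ (i - j))%:C * X i j).
have DXY : D * X = Y * D.
  apply/matrixP => i j.
  rewrite [LHS](_ : _ = (t ^+ i)%:C * X i j); last first.
    by rewrite -[D * X]/(D *m X) mul_diag_mx !mxE.
  rewrite [RHS](_ : _ = Y i j * (t ^+ j)%:C); last first.
    by rewrite -[Y * D]/(Y *m D) mul_mx_diag !mxE.
  rewrite mxE; have [ij|ji] := ltnP i j.
    by rewrite (is_trig_mxP trig _ _ ij) !mulr0 mul0r.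
  by rewrite mulrAC -rmorphM/= -exprD subnK.
have [T Tu TST] : exists2 T : M, T \is a GRing.unit & T * S * T^-1 = Y.
  move: D Y Du DXY => D Y Du DXY; exists (D * P); first by rewrite unitrMl.
  have Tu : D * P \is a GRing.unit by rewrite unitrMl.
  apply: (mulIr Tu); rewrite (mulrVK Tu) mulrA -DXY XE -!mulrA.
  by rewrite (mulVr Pu) mulr1.
have TC r : mxiota r * T = T * mxiota r by exact: mxiotaC.
exists (@conj_norm K M (@mxiota K n) mxnorm T Tu TC).
exists (mxnorm T^-1 * mxnorm T), (B ^+ 2 / (2 * d) + 2 * d), d.
split=> //; first by move=> x; exact: le_conj_norm.
set c := _ + _ * d.
have -> : @conj_norm K M (@mxiota K n) mxnorm T Tu TC (mxiota c - S)
    = mxn (mxiota c - Y).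
  by rewrite /= mulrBr mulrBl TST -mxiotaC (mulrK Tu).
have c0 : 0 <= B ^+ 2 / (2 * d) by rewrite divr_ge0 ?sqr_ge0// mulr_ge0// ltW.
apply: mxn_le => [|i]; first by rewrite /c; lra.
rewrite /rowsum (bigD1 i)//=.
have Xii : Y i i = X i i by rewrite mxE subnn expr0 rmorph1 mul1r.
have h1 : nc ((mxiota c - Y) i i) <= B ^+ 2 / (2 * d).
  rewrite mxE [X in X + _]mxE eqxx mulr1n [X in _ + X]mxE Xii.
  by apply: normc_half_plane => //; exact: normc_le_mxn.
have h2 : \sum_(j | j != i) nc ((mxiota c - Y) i j) <= d.
  apply: (le_trans _ tB).
  apply: (@le_trans _ _ (\sum_(j | j != i) t * nc (X i j))).
    apply: ler_sum => j ji.
    rewrite mxE [X in X + _]mxE eq_sym (negbTE ji) mulr0n add0r mxE normcN mxE.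
    have [ij|ji'] := ltnP i j.
      by rewrite (is_trig_mxP trig _ _ ij) mulr0 Normc.normc0 mulr0.
    rewrite Normc.normcM ler_wpM2r ?normc_ge0// normc_real ger0_norm ?exprn_ge0 ?(ltW t0)//.
    have : (0 < i - j)%N by rewrite subn_gt0 ltn_neqAle ji' andbT.
    case: (i - j)%N => // m _; rewrite exprS ler_piMr ?(ltW t0)//.
    by rewrite exprn_ile1// ltW.
  rewrite -mulr_sumr ler_wpM2l ?(ltW t0)// (le_trans _ (rowsum_le_mxn X i))//.
  by rewrite /rowsum [leRHS](bigD1 i)//= lerDr normc_ge0.
apply: (le_trans (lerD h1 h2)); rewrite /c; lra.
Qed.

Lemma positive_stable_unit (S : M) k : positive_stable S ->
  S + k%:R \is a GRing.unit.
Proof.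
move=> posS; apply: contraT => nu.
have : eigenvalue S (- k%:R).
  rewrite /eigenvalue /eigenspace.
  rewrite rmorphN opprK rmorph_nat kermx_eq0 row_free_unit.
  exact: nu.
move=> /posS; rewrite raddfN /= -(rmorph_nat (@real_complex K)) /=.
by rewrite oppr_gt0 ltNge ler0n.
Qed.

(** On the left kernel of X, multiplication by X - 1 is the negative of the identity, which a norm
    below 1 permits only if the kernel is 0. *)
Lemma unit_near1 (X : M) : mxnorm (X - 1) < 1 -> X \is a GRing.unit.
Proof.
move=> X1; rewrite -[_ \is a _]/(X \in unitmx) -row_free_unit -kermx_eq0.
have kX : kermx X * X = 0 by exact: mulmx_ker.
have h : mxnorm (kermx X) <= mxnorm (kermx X) * mxnorm (X - 1).
  by have := nrmM mxnorm (kermx X) (X - 1); rewrite mulrBr kX mulr1 sub0r nrmN.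
apply/eqP/(nrm_eq0 (a := mxnorm)); apply/le_anti/andP; split; last exact: nrm_ge0.
have := nrm_ge0 mxnorm (kermx X); nra.
Qed.

End AdaptedNorm.

(* The bicommutant of a commuting family is a commutative ring that also contains the
   inverses and the limits of its elements. *)
Record commfam (K : realType) (n : nat) := CommFam {
  fam :> 'M[K[i]]_n.+1 -> Prop;
  famC : forall X Y, fam X -> fam Y -> X * Y = Y * X }.

Section Bicommutant.
Context {K : realType} {n : nat}.
Local Notation M := 'M[K[i]]_n.+1.
Variable c : commfam K n.

Definition bicommutant : {pred M} := fun X =>
  `[< forall Z, (forall Y, c Y -> Y * Z = Z * Y) -> X * Z = Z * X >].

Lemma bicommutantP X : reflect
  (forall Z, (forall Y, c Y -> Y * Z = Z * Y) -> X * Z = Z * X)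
  (X \in bicommutant).
Proof. exact: asboolP. Qed.

Lemma bicommutant_divring : divring_closed bicommutant.
Proof.
split=> [|X Y /bicommutantP XZ /bicommutantP YZ|X Y /bicommutantP XZ /bicommutantP YZ].
- by apply/bicommutantP => Z _; rewrite mulr1 mul1r.
- by apply/bicommutantP => Z cZ; rewrite mulrBl mulrBr XZ// YZ.
- apply/bicommutantP => Z cZ; apply/esym/commrM; first exact/esym/XZ.
  exact/commrV/esym/YZ.
Qed.

HB.instance Definition _ :=
  GRing.isDivringClosed.Build M bicommutant bicommutant_divring.

Record bicom := Bicom { bicom_val :> M; _ : bicom_val \in bicommutant }.

HB.instance Definition _ := [isSub for bicom_val].
HB.instance Definition _ := [Choice of bicom by <:].
HB.instance Definition _ := [SubChoice_isSubUnitRing of bicom by <:].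

Lemma fam_bicommutant X : c X -> X \in bicommutant.
Proof. by move=> cX; apply/bicommutantP => Z; exact. Qed.

(** Members of a commuting family lie in its commutant, so Y commutes with the family; hence X,
    which commutes with all such matrices, commutes with Y. *)
Lemma bicom_mulC : commutative (@GRing.mul bicom).
Proof.
move=> X Y; apply: val_inj => /=.
have /bicommutantP XZ := valP X; have /bicommutantP YZ := valP Y.
apply: XZ => W cW; apply/esym; apply: YZ => V cV.
exact: famC cV cW.
Qed.

HB.instance Definition _ := GRing.PzRing_hasCommutativeMul.Build bicom bicom_mulC.

Lemma scalar_bicommutant (a : K[i]) : a%:M \in bicommutant.
Proof. by apply/bicommutantP => Z _; apply/esym; exact: scalar_mxC. Qed.

End Bicommutant.

(** * Matrix exponential and Gamma function *)

Section MatrixExp.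
Context {K : realType} {n : nat}.
Local Notation M := 'M[K[i]]_n.+1.
Local Notation nc := (@Normc.normc K).
Implicit Types (A B X : M).

Definition exp_term A k : M := mxiota k`!%:R^-1 * A ^+ k.

Lemma exp_termE A k : exp_term A k = (k`!)%:R^-1 *: A ^+ k.
Proof. by rewrite /exp_term mxiotaZ fmorphV rmorph_nat. Qed.

Lemma nrm_exp_term (nu : algnorm (@mxiota K n)) A k :
  nu (exp_term A k) <= exp_coeff (nu A) k.
Proof.
rewrite nrmZ /exp_coeff /= ger0_norm ?invr_ge0// mulrC ler_wpM2r ?invr_ge0//.
exact: nrmX.
Qed.

Lemma expmx_nsum A : nsum mxnorm (exp_term A) (expmx A).
Proof.
have [s Hs] : exists s, nsum mxnorm (exp_term A) s.
  apply: mx_complete; apply: series_le_cvg (is_cvg_series_exp_coeff (mxnorm A)).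
  - by move=> k; exact: nrm_ge0.
  - by move=> k; apply: exp_coeff_ge0; exact: nrm_ge0.
  - by move=> k; exact: nrm_exp_term.
rewrite (_ : expmx A = s)//; apply: mx_lim; apply: (ncvg_near _ Hs).
by near=> m; rewrite /series /=; apply: eq_bigr => k _; exact: exp_termE.
Unshelve. all: by end_near. Qed.

Lemma exp_partial_sum_le (nu : algnorm (@mxiota K n)) A m :
  nu (\sum_(0 <= k < m) exp_term A k) <= expR (nu A).
Proof.
rewrite (le_trans (nrm_sum _ _ _ _))//.
apply: (@le_trans _ _ (series (exp_coeff (nu A)) m)).
  by apply: ler_sum => k _; exact: nrm_exp_term.
apply: nondecreasing_cvgn_le; last exact: is_cvg_series_exp_coeff.
apply/nondecreasing_seqP => k; rewrite seriesSr lerDl.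
by apply: exp_coeff_ge0; exact: nrm_ge0.
Qed.

(** The exponent is measured in an adapted norm, where it can be kept small; returning to the
    row-sum norm costs only the factor [C]. *)
Lemma nrm_expmx (nu : algnorm (@mxiota K n)) C A :
  (forall X, mxnorm X <= C * nu X) -> mxnorm (expmx A) <= C * expR (nu A).
Proof.
move=> nuC.
have C0 : 0 <= C by have := nuC 1; rewrite !nrm1 mulr1; exact: le_trans.
apply: ncvg_nrm_le (expmx_nsum A); near=> m.
by rewrite (le_trans (nuC _))// ler_wpM2l// exp_partial_sum_le.
Unshelve. all: by end_near. Qed.

Lemma mxn_expmx A : mxnorm (expmx A) <= expR (mxnorm A).
Proof. by rewrite -[leRHS]mul1r; apply: nrm_expmx => X; rewrite mul1r. Qed.

Lemma mxn_expmxB1 A : mxnorm (expmx A - 1) <= expR (mxnorm A) - 1.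
Proof.
have e0 : exp_term A 0 = 1 by rewrite /exp_term fact0 invr1 rmorph1 mul1r.
have c0 : exp_coeff (mxnorm A) 0 = 1 by rewrite /exp_coeff /= fact0 expr0 divr1.
have := nsum_tail 1 (nrm_exp_term mxnorm A) (is_cvg_series_exp_coeff _) (expmx_nsum A).
by rewrite big_nat1 e0 /series /= big_nat1 c0.
Qed.

Lemma exp_termD A B k : A * B = B * A ->
  exp_term (A + B) k = \sum_(0 <= j < k.+1) exp_term A (k - j) * exp_term B j.
Proof.
move=> AB; rewrite /exp_term exprDn_comm// mulr_sumr big_mkord.
apply: eq_bigr => j _; have jk : (j <= k)%N by rewrite -ltnS.
rewrite -mulrA [A ^+ _ * (_ * _)]mulrA -mxiotaC -[in RHS]mulrA mulrA -rmorphM.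
rewrite -[_ *+ 'C(_, _)]mulr_natl mulrA -(rmorph_nat (@mxiota K n)) -rmorphM.
congr (mxiota _ * _); rewrite -(bin_fact jk) !natrM.
by field; rewrite !pnatr_eq0 -!lt0n !fact_gt0 bin_gt0 jk.
Qed.

(** The Cauchy product, treated like the double series in [kummer_disc]: triangular partial sums
    [F m j] and [tannery]. *)
Lemma expmxD A B : A * B = B * A -> expmx (A + B) = expmx A * expmx B.
Proof.
move=> AB; apply: nsum_unique (expmx_nsum (A + B)) _.
pose F m j := if (j < m)%N then (\sum_(0 <= i < m - j) exp_term A i) * exp_term B j
  else 0.
pose w := expR (mxnorm A) *: exp_coeff (mxnorm B).
have cw : cvgn (series w) by apply: is_cvg_seriesZ; exact: is_cvg_series_exp_coeff.
have HB : nsum mxnorm (fun j => expmx A * exp_term B j) (expmx A * expmx B).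
  exact/nsumMl/expmx_nsum.
apply: (@tannery _ _ _ mxnorm _ _ _ F _ w _ _ cw _ _ _ HB).
- near=> m => j; rewrite /F; case: ifP => _; last first.
    by rewrite nrm0 mulr_ge0 ?expR_ge0// exp_coeff_ge0// nrm_ge0.
  rewrite (le_trans (nrmM _ _ _))// ler_pM ?nrm_ge0//.
    exact: exp_partial_sum_le.
  exact: nrm_exp_term.
- move=> j.
  have := cvg_comp _ _ (cvg_subnr j) (expmx_nsum A) => H.
  have H' : ncvg mxnorm \oo (fun m => \sum_(0 <= i < m - j) exp_term A i) (expmx A).
    exact: H.
  apply: (ncvg_near _ (ncvgMr (exp_term B j) H')); near=> m.
  have jm : (j < m)%N by near: m; exact: nbhs_infty_gt.
  by rewrite /F jm.
- near=> m.
  have -> : \sum_(0 <= k < m) exp_term (A + B) k = \sum_(0 <= j < m) F m j.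
    transitivity (\sum_(0 <= j < m) (\sum_(0 <= i < m - j) exp_term A i) * exp_term B j).
      elim: (m) => [|p IH]; first by rewrite !big_geq.
      rewrite big_nat_recr//= IH exp_termD//.
      have -> : \sum_(0 <= j < p) (\sum_(0 <= i < p - j) exp_term A i) * exp_term B j
        = \sum_(0 <= j < p.+1) (\sum_(0 <= i < p - j) exp_term A i) * exp_term B j.
        by rewrite big_nat_recr//= subnn [X in X * _]big_geq// mul0r addr0.
      rewrite -big_split; apply: eq_big_nat => j /andP[_]; rewrite ltnS => jp.
      by rewrite subSn// big_nat_recr//= mulrDl.
    by apply: eq_big_nat => j /andP[_ jm]; rewrite /F jm.
  by apply: nsum_fin => j mj; rewrite /F ltnNge mj.
Unshelve. all: by end_near. Qed.

Lemma expmx_iota (r : K) : expmx (mxiota r : M) = mxiota (expR r).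
Proof.
apply: nsum_unique (expmx_nsum _) _.
have cr := is_cvg_series_exp_coeff r.
apply: (@ncvg_le _ _ _ _ _ _ _ _ _
  (fun m => `|series (exp_coeff r) m - expR r|)).
  near=> m; rewrite (_ : \sum_(0 <= k < m) _ = mxiota (series (exp_coeff r) m)).
    by rewrite -rmorphB nrm_iota.
  rewrite rmorph_sum; apply: eq_bigr => k _.
  by rewrite /exp_term -rmorphXn -rmorphM /exp_coeff /= mulrC.
rewrite -[X in _ --> X](normr0 K); apply: cvg_norm.
by rewrite -(subrr (expR r)); apply: cvgB => //; exact: cvg_cst.
Unshelve. all: by end_near. Qed.

Lemma expmx_comm A B : A * B = B * A -> expmx A * B = B * expmx A.
Proof.
move=> AB; apply: nsum_unique (nsumMl B (expmx_nsum A)).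
apply: (ncvg_near _ (ncvgMr B (expmx_nsum A))); near=> m.
rewrite mulr_suml; apply: eq_bigr => k _; rewrite /exp_term.
by rewrite mulrA -mxiotaC -!mulrA (commrX k (esym AB : GRing.comm B A)).
Unshelve. all: by end_near. Qed.

(* One function for both components, to treat real and imaginary parts uniformly. *)
Definition part (b : bool) (z : K[i]) : K := if b then complex.Re z else complex.Im z.

Lemma partB b : {morph part b : x y / x - y}.
Proof. by case: b => -[? ?] [? ?]. Qed.

Lemma partD b : {morph part b : x y / x + y}.
Proof. by case: b => -[? ?] [? ?]. Qed.

Lemma part0 b : part b 0 = 0.
Proof. by case: b. Qed.

Lemma part_sum b I (r : seq I) (P : pred I) (f : I -> K[i]) :
  part b (\sum_(i <- r | P i) f i) = \sum_(i <- r | P i) part b (f i).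
Proof. exact: (big_morph (part b) (partD b) (part0 b)). Qed.

Lemma partZ b (r : K) z : part b (r%:C * z) = r * part b z.
Proof. by case: b; case: z => x y /=; rewrite mul0r ?subr0 ?addr0. Qed.

Lemma le_part b z : `|part b z| <= nc z.
Proof. by case: b; [exact: Re_le_normc|exact: Im_le_normc]. Qed.

Lemma ncvg_part {T} {F : set_system T} {FF : ProperFilter F} (u : T -> M) L :
  ncvg mxnorm F u L <->
  forall b i j, part b (u x i j) @[x --> F] --> part b (L i j).
Proof.
rewrite ncvg_mxP; split=> [uL [] i j|uL i j]; [by case: (uL i j)|by case: (uL i j)|].
by split; [exact: (uL true)|exact: (uL false)].
Qed.

(** Coefficients of the real power series in s of one part of an entry of B exp(sA). The left factor
    B makes the family closed under differentiation, which replaces B by BA. *)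
Definition exp_coef A B b i j k : K := k`!%:R^-1 * part b ((B * A ^+ k) i j).

Lemma exp_coef_pseries A B b i j s :
  series (fun k => exp_coef A B b i j k * s ^+ k) @ \oo
    --> part b ((B * expmx (s%:C *: A)) i j).
Proof.
have /ncvg_part/(_ b i j) := nsumMl B (expmx_nsum (s%:C *: A)).
apply: cvg_trans; apply: near_eq_cvg; near=> m.
rewrite /= summxE part_sum /series /=; apply: eq_bigr => k _.
rewrite exp_termE exprZn scalerA -[X in X *: _](_ : (k`!%:R^-1 * s ^+ k)%:C = _).
  by rewrite -scalerAr mxE partZ /exp_coef mulrAC.
by rewrite rmorphM fmorphV rmorph_nat rmorphXn.
Unshelve. all: by end_near. Qed.

Lemma is_derive_expmx A B b i j (s : K) :
  is_derive s 1 (fun s => part b ((B * expmx (s%:C *: A)) i j))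
    (part b ((B * A * expmx (s%:C *: A)) i j)).
Proof.
have diffs C : pseries_diffs (exp_coef A C b i j) = exp_coef A (C * A) b i j.
  apply/funext => k; rewrite /pseries_diffs /exp_coef factS natrM invfM.
  by rewrite exprS !mulrA divff ?pnatr_eq0// mul1r.
have cv C t : cvgn (pseries (exp_coef A C b i j) t).
  by apply/cvg_ex; eexists; exact: exp_coef_pseries.
have lm C : (fun t => limn (pseries (exp_coef A C b i j) t)) =
    (fun t => part b ((C * expmx (t%:C *: A)) i j)).
  by apply/funext => t; apply/cvg_lim => //; exact: exp_coef_pseries.
have := @pseries_snd_diffs K (exp_coef A B b i j) (`|s| + 1) s.
rewrite !diffs lm (congr1 (fun f => f s) (lm _)) => h.
by apply: h => //; rewrite [ltRHS]ger0_norm ?addr_ge0// ltrDl.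
Qed.

End MatrixExp.

(** * Integration of derivatives over the open half-line *)

Section HalfLine.
Context {K : realType}.
Notation mu := (@lebesgue_measure K).
Local Notation D := (`]0%R, +oo[%classic : set K).
Implicit Types (f g F G : K -> K).

(** A compact exhaustion; the shift by 2 keeps the first interval from shrinking to a point, as the
    fundamental theorem needs distinct end points. *)
Let J (k : nat) : set K := `[(k.+2%:R)^-1, k.+2%:R]%classic.

Let bigcupJ : \bigcup_k J k = D.
Proof.
apply/seteqP; split => x /=.
  move=> [k _]; rewrite /J /= !in_itv/= => /andP[kx _]; rewrite andbT.
  by rewrite (lt_le_trans _ kx)// invr_gt0.
rewrite in_itv/= andbT => x0.
exists (maxn (Num.bound x) (Num.bound x^-1)) => //; rewrite /J /= in_itv/=.
apply/andP; split.
  rewrite -[leRHS]invrK lef_pV2 ?posrE ?invr_gt0//.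
  rewrite (le_trans (ltW (archi_boundP _)))// ?invr_ge0 ?(ltW x0)//.
  by rewrite ler_nat leqW// leqW// leq_maxr.
rewrite (le_trans (ltW (archi_boundP (ltW x0))))//.
by rewrite ler_nat leqW// leqW// leq_maxl.
Qed.

Lemma measurable_half_line f : (forall t, 0 < t -> derivable f t 1) ->
  measurable_fun D f.
Proof.
move=> df; apply: open_continuous_measurable_fun => //.
move=> t; rewrite inE /= in_itv/= andbT => t0.
by apply: differentiable_continuous; apply/derivable1_diffP; exact: df.
Qed.

(** Monotone convergence along the intervals [J k], on each of which the fundamental theorem gives
    the value. The limits of F are therefore taken along their end points. *)
Lemma ge0_integral_half_line f F (l0 l1 : K) : (forall t, 0 < t -> 0 <= f t) ->
  (forall t, 0 < t -> derivable f t 1) ->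
  (forall t : K, 0 < t -> is_derive t 1 F (f t)) ->
  F (k.+2%:R)^-1 @[k --> \oo] --> l0 -> F k.+2%:R @[k --> \oo] --> l1 ->
  (\int[mu]_(t in D) (f t)%:E = (l1 - l0)%:E)%E.
Proof.
move=> f0 df dF F0 F1.
have Jpos k t : J k t -> 0 < t.
  by rewrite /J /= in_itv/= => /andP[+ _]; apply: lt_le_trans; rewrite invr_gt0.
have mJ k : measurable (J k) by exact: measurable_itv.
have mf k : measurable_fun (J k) (EFin \o f).
  apply/measurable_EFinP; apply: measurable_funS (measurable_half_line df) => //.
  by rewrite -bigcupJ; exact: bigcup_sup.
have homJ : {homo J : n m / (n <= m)%N >-> (n <= m)%O}.
  move=> a b ab; apply/subsetPset => t; rewrite /J /= !in_itv/= => /andP[ta tb].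
  apply/andP; split; last by rewrite (le_trans tb)// ler_nat.
  by rewrite (le_trans _ ta)// lef_pV2 ?posrE// ler_nat.
have f0' k t : J k t -> (0 <= (EFin \o f) t)%E.
  by move=> /Jpos t0; rewrite lee_fin f0.
have := ge0_nondecreasing_set_cvg_integral (mu := mu) homJ mJ mf f0'.
rewrite bigcupJ => cvgI.
have FTC k : (\int[mu]_(t in J k) (f t)%:E = (F k.+2%:R - F (k.+2%:R)^-1)%:E)%E.
  have kk : (k.+2%:R)^-1 < k.+2%:R :> K.
    by rewrite (@lt_trans _ _ 1)// ?invf_lt1 ?ltr1n.
  have dFin t : t \in `[(k.+2%:R)^-1, k.+2%:R] -> derivable F t 1.
    move=> tJ; have t0 : 0 < t by apply: (Jpos k).
    by have [] := dF t t0.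
  rewrite EFinB; apply: continuous_FTC2 => //.
  - apply: derivable_within_continuous => t tJ; apply: df; exact: (Jpos k).
  - have /(continuous_within_itvP _ kk)[_ ca cb] :
        {within `[(k.+2%:R)^-1, k.+2%:R], continuous F}.
      exact: derivable_within_continuous.
    split => //; move=> t tJ; apply: dFin.
    by move: tJ; rewrite !in_itv/= => /andP[ta tb]; rewrite !ltW.
  - move=> t tJ; have t0 : 0 < t.
      apply: (Jpos k); rewrite /J /= in_itv/=.
      by move: tJ; rewrite !in_itv/= => /andP[ta tb]; rewrite !ltW.
    by rewrite derive1E; have /@derive_val := dF t t0.
rewrite -(cvg_lim (@ereal_hausdorff K) cvgI); apply/(cvg_lim (@ereal_hausdorff K)).
under eq_fun do rewrite /= FTC.
apply: cvg_EFin; first exact: nearW.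
exact: cvgB.
Qed.

Lemma ge0_integrable_half_line f F (l0 l1 : K) : (forall t, 0 < t -> 0 <= f t) ->
  (forall t, 0 < t -> derivable f t 1) ->
  (forall t : K, 0 < t -> is_derive t 1 F (f t)) ->
  F (k.+2%:R)^-1 @[k --> \oo] --> l0 -> F k.+2%:R @[k --> \oo] --> l1 ->
  mu.-integrable D (EFin \o f).
Proof.
move=> f0 df dF F0 F1; apply/integrableP; split.
  by apply/measurable_EFinP; exact: (measurable_half_line df).
rewrite [X in (X < _)%E](_ : _ = \int[mu]_(t in D) (f t)%:E)%E; last first.
  apply: eq_integral => t; rewrite inE /= in_itv/= andbT => t0.
  by rewrite ger0_norm// f0.
by rewrite (ge0_integral_half_line f0 df dF F0 F1) ltry.
Qed.

Lemma le_integrable_half_line f g : (forall t, 0 < t -> derivable f t 1) ->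
  (forall t, 0 < t -> `|f t| <= g t) -> mu.-integrable D (EFin \o g) ->
  mu.-integrable D (EFin \o f).
Proof.
move=> df fg ig; apply: (le_integrable _ _ _ ig) => //.
  by apply/measurable_EFinP; exact: (measurable_half_line df).
move=> t; rewrite /= in_itv/= andbT => t0; rewrite lee_fin.
by rewrite (le_trans (fg t t0))// ler_norm.
Qed.

(** The preceding computation needs a nonnegative integrand. It is applied to f + g and to g; both
    integrals are l1 - l0, since F vanishes at both ends. *)
Lemma integral_derive_half_line f F g G : (forall t, 0 < t -> derivable f t 1) ->
  (forall t, 0 < t -> derivable g t 1) ->
  (forall t, 0 < t -> `|f t| <= g t) ->
  (forall t : K, 0 < t -> is_derive t 1 F (f t)) ->
  (forall t : K, 0 < t -> is_derive t 1 G (g t)) ->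
  forall l0 l1 : K, G (k.+2%:R)^-1 @[k --> \oo] --> l0 -> G k.+2%:R @[k --> \oo] --> l1 ->
  F (k.+2%:R)^-1 @[k --> \oo] --> (0 : K) -> F k.+2%:R @[k --> \oo] --> (0 : K) ->
  \int[mu]_(t in D) f t = 0.
Proof.
move=> df dg fg dF dG l0 l1 G0 G1 F0 F1.
have g0 t : 0 < t -> 0 <= g t by move=> t0; rewrite (le_trans _ (fg t t0)).
have ig := ge0_integrable_half_line g0 dg dG G0 G1.
have i_f := le_integrable_half_line df fg ig.
have sum0 t : 0 < t -> 0 <= f t + g t.
  by move=> t0; have := fg t t0; rewrite ler_norml => /andP[]; lra.
have dsum t : 0 < t -> derivable (f \+ g) t 1.
  by move=> t0; apply: derivableD; [exact: df|exact: dg].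
have dS (t : K) : 0 < t -> is_derive t 1 (F \+ G) (f t + g t).
  by move=> t0; have := dF t t0; have := dG t t0 => ? ?; exact: is_deriveD.
have Ig : \int[mu]_(t in D) g t = l1 - l0.
  by rewrite /Rintegral (ge0_integral_half_line g0 dg dG G0 G1).
have Ifg : \int[mu]_(t in D) (f t + g t) = l1 - l0.
  rewrite /Rintegral (ge0_integral_half_line sum0 dsum dS (l0 := 0 + l0) (l1 := 0 + l1)).
  - by rewrite !add0r.
  - exact: cvgD.
  - exact: cvgD.
have := RintegralD (mu := mu) (measurable_itv _) i_f ig.
rewrite Ifg Ig; set I := \int[_]_(_ in _) f _; move=> e.
by apply: (@addIr _ (l1 - l0)); rewrite -e add0r.
Qed.

End HalfLine.

Section MatrixIntegral.
Context {K : realType} {n : nat}.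
Local Notation M := 'M[K[i]]_n.+1.
Notation mu := (@lebesgue_measure K).
Local Notation D := (`]0%R, +oo[%classic : set K).
Implicit Types (f g : K -> M).

Lemma Rintegral_sum (I : Type) (r : seq I) (h : I -> K -> K) :
  (forall p, mu.-integrable D (EFin \o h p)) ->
  mu.-integrable D (EFin \o (fun t => \sum_(p <- r) h p t)) /\
  \int[mu]_(t in D) (\sum_(p <- r) h p t) = \sum_(p <- r) \int[mu]_(t in D) h p t.
Proof.
move=> ih.
have ir s : mu.-integrable D (EFin \o (fun t => \sum_(p <- s) h p t)).
  rewrite (_ : EFin \o _ = (fun t => \sum_(p <- s) (h p t)%:E)%E).
    by apply: integrable_sum => // p _; exact: ih.
  by apply/funext => t /=; rewrite sumEFin.
split=> //; elim: r => [|p r IH].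
  under eq_Rintegral do rewrite big_nil.
  by rewrite big_nil /Rintegral integral0.
under eq_Rintegral do rewrite big_cons.
by rewrite big_cons RintegralD ?IH//; exact: measurable_itv.
Qed.

Lemma integrableMr (h : K -> K) c : mu.-integrable D (EFin \o h) ->
  mu.-integrable D (EFin \o (fun t => h t * c)).
Proof.
move=> ih; have := integrableZr (mu := mu) (measurable_itv _) c ih.
by apply: eq_integrable => //; exact: measurable_itv.
Qed.

Definition mxint f := forall b i j,
  mu.-integrable D (EFin \o (fun t => part b (f t i j))).

Definition Imx f : M := \matrix_(i, j)
  ((\int[mu]_(t in D) complex.Re (f t i j)) +i*
   (\int[mu]_(t in D) complex.Im (f t i j))).

Lemma part_Imx f b i j :
  part b (Imx f i j) = \int[mu]_(t in D) part b (f t i j).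
Proof. by rewrite mxE; case: b. Qed.

Lemma mx_partP (X Y : M) :
  (forall b i j, part b (X i j) = part b (Y i j)) -> X = Y.
Proof.
move=> XY; apply/matrixP => i j; have := XY true i j; have := XY false i j.
by case: (X i j) => a b; case: (Y i j) => c d /= -> ->.
Qed.

Lemma eq_Imx f g : (forall t, 0 < t -> f t = g t) -> Imx f = Imx g.
Proof.
move=> fg; apply: mx_partP => b i j; rewrite !part_Imx; apply: eq_Rintegral => t.
by rewrite inE /= in_itv/= andbT => /fg ->.
Qed.

Lemma mxintB f g : mxint f -> mxint g -> mxint (fun t => f t - g t).
Proof.
move=> fi gi b i j.
have := integrableB (mu := mu) (measurable_itv _) (fi b i j) (gi b i j).
apply: eq_integrable; first exact: measurable_itv.
by move=> t _; rewrite /= !mxE partB.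
Qed.

Lemma ImxB f g : mxint f -> mxint g -> Imx (fun t => f t - g t) = Imx f - Imx g.
Proof.
move=> fi gi; apply: mx_partP => b i j.
rewrite [in RHS]mxE partD [X in _ = _ + part b X]mxE -[- Imx g i j]sub0r partB part0 sub0r.
rewrite !part_Imx -RintegralB; [|exact: measurable_itv|exact: fi|exact: gi].
by apply: eq_Rintegral => t _; rewrite !mxE partB.
Qed.

Section Linear.
Variable L : M -> M.
Hypothesis LD : {morph L : X Y / X + Y}.
Hypothesis LZ : forall (r : K) X, L (r%:C *: X) = r%:C *: L X.

Let L0 : L 0 = 0.
Proof. by have := LZ 0 0; rewrite !scale0r. Qed.

(** Coordinates of the real-linear map L in the real basis of elementary matrices and their
    multiples by the imaginary unit; they reduce integration of L f to finite real linear
    combinations. *)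
Let coef b i j (p : bool * ('I_n.+1 * 'I_n.+1)) : K :=
  part b (L (if p.1 then delta_mx p.2.1 p.2.2 else 'i%C *: delta_mx p.2.1 p.2.2) i j).

Let linE X b i j : part b (L X i j) =
  \sum_p part p.1 (X p.2.1 p.2.2) * coef b i j p.
Proof.
rewrite {1}[X]matrix_sum_delta.
have Lsum I (r : seq I) (F : I -> M) : L (\sum_(k <- r) F k) = \sum_(k <- r) L (F k).
  exact: (big_morph L LD L0).
rewrite pair_bigA /= Lsum summxE part_sum.
rewrite -(pair_bigA _ (fun c q => part c (X q.1 q.2) * coef b i j (c, q))) /=.
rewrite exchange_big /=; apply: eq_bigr => q _.
rewrite big_bool /coef /= -!partZ.
have -> : X q.1 q.2 *: delta_mx q.1 q.2 = (complex.Re (X q.1 q.2))%:C *: delta_mx q.1 q.2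
    + (complex.Im (X q.1 q.2))%:C *: ('i%C *: delta_mx q.1 q.2) :> M.
  rewrite scalerA -scalerDl; congr (_ *: _).
  by rewrite [LHS]complexE mulrC.
by rewrite LD !LZ mxE partD !mxE.
Qed.

Lemma mxint_lin f : mxint f -> mxint (L \o f).
Proof.
move=> fi b i j; rewrite (_ : (fun t => _) = (fun t => \sum_p
    part p.1 (f t p.2.1 p.2.2) * coef b i j p)).
  by have [] := Rintegral_sum (index_enum _) (fun p => integrableMr (coef b i j p) (fi p.1 p.2.1 p.2.2)).
by apply/funext => t; exact: linE.
Qed.

Lemma Imx_lin f : mxint f -> Imx (L \o f) = L (Imx f).
Proof.
move=> fi; apply: mx_partP => b i j; rewrite part_Imx linE.
under eq_Rintegral do rewrite linE.
have [_ ->] := Rintegral_sum (index_enum _) (fun p => integrableMr (coef b i j p) (fi p.1 p.2.1 p.2.2)).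
apply: eq_bigr => p _; rewrite part_Imx RintegralZr//; exact: fi.
Qed.

End Linear.

Lemma mxint_mull B f : mxint f -> mxint (fun t => B * f t).
Proof.
by apply: (@mxint_lin (fun X => B * X)) => [X Y|r X]; rewrite ?mulrDr -?scalerAr.
Qed.

Lemma Imx_mull B f : mxint f -> Imx (fun t => B * f t) = B * Imx f.
Proof.
by apply: (@Imx_lin (fun X => B * X)) => [X Y|r X]; rewrite ?mulrDr -?scalerAr.
Qed.

Lemma mxint_mulr B f : mxint f -> mxint (fun t => f t * B).
Proof.
by apply: (@mxint_lin (fun X => X * B)) => [X Y|r X]; rewrite ?mulrDl -?scalerAl.
Qed.

Lemma Imx_mulr B f : mxint f -> Imx (fun t => f t * B) = Imx f * B.
Proof.
by apply: (@Imx_lin (fun X => X * B)) => [X Y|r X]; rewrite ?mulrDl -?scalerAl.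
Qed.

Lemma part_Imx_le f (g : K -> K) b i j : mxint f ->
  mu.-integrable D (EFin \o g) ->
  (forall t, 0 < t -> mxn (f t) <= g t) ->
  `|part b (Imx f i j)| <= \int[mu]_(t in D) g t.
Proof.
move=> fi gi fg; rewrite part_Imx (le_trans (le_normr_Rintegral _ (fi b i j)))//.
apply: le_Rintegral => //; first exact: (integrable_norm (fi b i j)).
move=> t; rewrite /= in_itv/= andbT => /fg; apply: le_trans.
by rewrite (le_trans (le_part _ _))// normc_le_mxn.
Qed.

End MatrixIntegral.

Section GammaIntegrand.
Context {K : realType}.
Notation mu := (@lebesgue_measure K).
Local Notation D := (`]0%R, +oo[%classic : set K).

(* An integrable bound of the Gamma integrand with an elementary primitive: of order
   t^(d-1) at 0 and t^(-d-1) at infinity. *)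
Definition gdom (d t : K) : K :=
  d * expR (d * ln t) / (t * (1 + expR (d * ln t)) ^+ 2).

Definition gprim (d t : K) : K := - (1 + expR (d * ln t))^-1.

Lemma is_derive_expln (d t : K) : 0 < t ->
  is_derive t 1 (fun t => expR (d * ln t)) (expR (d * ln t) * (d * t^-1)).
Proof.
move=> t0; have hl := is_derive1_ln t0.
have h1 : is_derive t 1 (fun t => d * ln t) (d * t^-1) by exact: is_deriveZ.
exact: (is_derive1_comp (is_derive_expR _) h1).
Qed.

Lemma is_derive_gprim (d t : K) : 0 < t -> is_derive t 1 (gprim d) (gdom d t).
Proof.
move=> t0; have h2 := is_derive_expln d t0.
have n0 : 1 + expR (d * ln t) != 0 by rewrite gt_eqF// addr_gt0// expR_gt0.
apply: is_derive_eq; rewrite /gdom /GRing.scale /=.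
by field; rewrite n0 gt_eqF.
Qed.

Lemma derivable_gdom (d t : K) : 0 < t -> derivable (gdom d) t 1.
Proof.
move=> t0; have [h2 _] := is_derive_expln d t0.
have [h1 _] := is_derive_gprim d t0.
have h3 : derivable (fun s : K => s^-1) t 1.
  by apply: derivableV; [rewrite gt_eqF|exact: derivable_id].
have -> : gdom d = (d \*: (fun s => expR (d * ln s)))
    * ((fun s : K => s^-1) * (gprim d * gprim d)).
  apply/funext => s.
  rewrite -[RHS]/(d * expR (d * ln s) * (s^-1 * (gprim d s * gprim d s))).
  by rewrite /gdom /gprim mulrNN -!invfM expr2.
exact: derivableM (derivableZ h2) (derivableM h3 (derivableM h1 h1)).
Qed.

Lemma cvg_expln_natV (d : K) : 0 < d -> expR (d * ln (k.+2%:R)^-1) @[k --> \oo] --> (0 : K).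
Proof.
move=> d0; apply/cvgrPdist_lt => e e0; near=> k.
have k0 : 0 < k.+2%:R :> K by [].
rewrite sub0r normrN ger0_norm ?expR_ge0// lnV ?posrE//.
rewrite -[ltRHS]lnK ?posrE// ltr_expR mulrN ltrNl.
have ke : expR (- ln e / d) <= k%:R by near: k; exact: nbhs_infty_ger.
have : expR (- ln e / d) < k.+2%:R by rewrite (le_lt_trans ke)// ltr_nat.
rewrite -[X in _ < X -> _]lnK ?posrE// ltr_expR ltr_pdivrMr// mulrC//.
Unshelve. all: by end_near. Qed.

Lemma expln_nat (d : K) k : expR (d * ln k.+2%:R) = (expR (d * ln (k.+2%:R)^-1))^-1.
Proof. by rewrite lnV ?posrE// mulrN expRN invrK. Qed.

Lemma cvg_gprim0 (d : K) : 0 < d -> gprim d (k.+2%:R)^-1 @[k --> \oo] --> (- 1 : K).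
Proof.
move=> d0.
have H : 1 + expR (d * ln (k.+2%:R)^-1) @[k --> \oo] --> (1 : K).
  rewrite -[X in _ --> X]addr0; apply: cvgD; first exact: cvg_cst.
  exact: cvg_expln_natV.
by have h := cvgN (cvgV (oner_neq0 K) H); rewrite invr1 in h; exact: h.
Qed.

Lemma cvg_gprim1 (d : K) : 0 < d -> gprim d k.+2%:R @[k --> \oo] --> (0 : K).
Proof.
move=> d0; rewrite -oppr0; apply: cvgN.
apply: (squeeze_cvgr (f := cst 0) (h := fun k => expR (d * ln (k.+2%:R)^-1))).
- near=> k; rewrite invr_ge0 addr_ge0 ?expR_ge0//= expln_nat.
  have z0 := expR_gt0 (d * ln (k.+2%:R)^-1).
  by rewrite -[leRHS]invrK lef_pV2 ?posrE ?addr_gt0 ?invr_gt0// lerDr.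
- exact: cvg_cst.
- exact: cvg_expln_natV.
Unshelve. all: by end_near. Qed.

Lemma gdom_ge0 (d t : K) : 0 < d -> 0 < t -> 0 <= gdom d t.
Proof.
move=> d0 t0; rewrite divr_ge0 ?mulr_ge0 ?expR_ge0 ?(ltW d0) ?(ltW t0)//.
Qed.

Lemma integrable_gdom (d : K) : 0 < d -> mu.-integrable D (EFin \o gdom d).
Proof.
move=> d0; apply: (@ge0_integrable_half_line _ (gdom d) (gprim d) (- 1) 0).
- by move=> t; exact: gdom_ge0.
- exact: derivable_gdom.
- exact: is_derive_gprim.
- exact: cvg_gprim0.
- exact: cvg_gprim1.
Qed.

End GammaIntegrand.

Section GammaFun.
Context {K : realType} {n : nat}.
Local Notation M := 'M[K[i]]_n.+1.
Notation mu := (@lebesgue_measure K).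
Local Notation D := (`]0%R, +oo[%classic : set K).
Implicit Types (A B : M) (t : K).
Local Notation stable := (stable (@mxnorm K n)).

Lemma mxn_scale (r : K) (X : M) : mxn (r%:C *: X) = `|r| * mxn X.
Proof. by rewrite -mxiotaZ; exact: (nrmZ mxnorm). Qed.

(** For t <= 1, (A-1) ln t is split as (-ln t)(c-A) + (c-1) ln t: the adapted norm applies to a
    nonnegative multiple of c-A and yields t^(d-1). For t > 1 a crude power t^N suffices, because
    e^(-t) t^(N+2) <= (N+2)!. *)
Lemma Gamma_integrand_dom A : stable A -> exists C d,
  [/\ 0 < d, 0 <= C & forall t, 0 < t -> mxn (Gamma_integrand A t) <= C * gdom d t].
Proof.
move=> [nu [C1 [c [d1 [d10 nuC Ad1]]]]].
(* The cap gives t^d <= t for t > 1, so that [gdom] decays no faster than a multiple of t^(-2). *)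
pose d := Num.min d1 1.
have d0 : 0 < d by rewrite lt_min d10 ltr01.
have d_le1 : d <= 1 by rewrite ge_min lexx orbT.
have Ad : nu (mxiota c - A) <= c - d.
  by rewrite (le_trans Ad1)// lerD2l lerN2 ge_min lexx.
have C10 : 0 <= C1 by have := nuC 1; rewrite !nrm1 mulr1; exact: le_trans.
pose N := Num.bound (mxnorm (A - 1)).
pose fac : K := (N.+2)`!%:R.
exists (4 * C1 / d + 4 * fac / d), d; split=> //.
  by rewrite addr_ge0 ?divr_ge0 ?mulr_ge0 ?(ltW d0)//.
move=> t t0; rewrite /Gamma_integrand /powmx mxn_scale ger0_norm ?expR_ge0//.
set u := ln t; have tE : t = expR u by rewrite lnK.
have g0 := gdom_ge0 d0 t0.
have y0 : 0 < expR (d * u) by exact: expR_gt0.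
have [t1|t1] := leP t 1.
  apply: (@le_trans _ _ (4 * C1 / d * gdom d t)); last first.
    by rewrite ler_wpM2r// lerDl divr_ge0 ?mulr_ge0// ltW.
  have u0 : u <= 0 by exact: ln_le0.
  have E : u%:C *: (A - 1) = mxiota (- u) * (mxiota c - A) + mxiota (u * c - u).
    rewrite -mxiotaZ mulrBr mulr1 mulrBr -rmorphM.
    have -> : mxiota (- u) * A = - (mxiota u * A) by rewrite rmorphN mulNr.
    rewrite opprK [X in _ = X + _]addrC -addrA -rmorphD -rmorphN.
    by congr (_ + mxiota _); ring.
  rewrite E expmxD; last by rewrite -mxiotaC.
  rewrite expmx_iota mulrC.
  have h1 : mxnorm (expmx (mxiota (- u) * (mxiota c - A))) <= C1 * expR (- u * (c - d)).
    rewrite (le_trans (nrm_expmx _ nuC))// ler_wpM2l// ler_expR nrmZ.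
    by rewrite ger0_norm ?oppr_ge0// ler_wpM2l ?oppr_ge0.
  have h2 : mxn (expmx (mxiota (- u) * (mxiota c - A)) * mxiota (expR (u * c - u)))
     <= C1 * (expR (d * u) / t).
    rewrite -mxiotaC; rewrite [leLHS](nrmZ mxnorm) ger0_norm ?expR_ge0//.
    rewrite (le_trans (ler_wpM2l (expR_ge0 _) h1))// mulrCA ler_wpM2l//.
    rewrite -expRD tE -expRN -expRD ler_expR; lra.
  apply: (@le_trans _ _ (C1 * (expR (d * u) / t) * 1)).
    rewrite ler_pM ?expR_ge0//; first exact: (nrm_ge0 mxnorm).
    by rewrite -expR0 ler_expR oppr_le0 ltW.
  rewrite mulr1 /gdom -/u.
  have y1 : expR (d * u) <= 1 by rewrite -expR0 ler_expR mulr_ge0_le0// ltW.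
  move: (expR (d * u)) y0 y1 => y y0 y1.
  have -> : 4 * C1 / d * (d * y / (t * (1 + y) ^+ 2)) =
     C1 * (y / t) * (4 / (1 + y) ^+ 2).
    by field; rewrite !gt_eqF//= ?addr_gt0.
  rewrite ler_peMr ?mulr_ge0 ?invr_ge0 ?(ltW y0) ?(ltW t0)//.
  by rewrite ler_pdivlMr ?exprn_gt0 ?addr_gt0// mul1r; nra.
apply: (@le_trans _ _ (4 * fac / d * gdom d t)); last first.
  by rewrite ler_wpM2r// lerDr divr_ge0 ?mulr_ge0// ltW.
have u0 : 0 <= u by rewrite ln_ge0// ltW.
have h1 : mxn (expmx (u%:C *: (A - 1))) <= t ^+ N.
  rewrite (le_trans (mxn_expmx _))// [mxnorm _]mxn_scale ger0_norm// tE -expRM_natl.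
  rewrite ler_expR mulrC ler_wpM2r// ltW// archi_boundP//; exact: (nrm_ge0 mxnorm).
have h2 : expR (- t) * t ^+ N.+2 <= fac.
  rewrite expRN mulrC ler_pdivrMr ?expR_gt0// mulrC -ler_pdivrMr ?ltr0n ?fact_gt0//.
  by rewrite (le_trans _ (expR_ge1Dxn N.+1 (ltW t0)))// lerDr.
apply: (@le_trans _ _ (expR (- t) * t ^+ N)).
  by rewrite ler_wpM2l// expR_ge0.
have y1 : 1 <= expR (d * u) by rewrite -expR0 ler_expR mulr_ge0// ltW.
have yt : expR (d * u) <= t.
  by rewrite tE ler_expR ler_piMl.
rewrite /gdom -/u; move: (expR (d * u)) y0 y1 yt => y y0 y1 yt.
have -> : 4 * fac / d * (d * y / (t * (1 + y) ^+ 2)) =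
     fac * (4 * y / (t * (1 + y) ^+ 2)).
  by field; rewrite !gt_eqF//= ?addr_gt0.
apply: (@le_trans _ _ (fac * (t ^+ 2)^-1)).
  rewrite ler_pdivlMr ?exprn_gt0// -mulrA -exprD addn2//.
rewrite ler_wpM2l// ler_pdivlMr ?mulr_gt0 ?exprn_gt0 ?addr_gt0//.
rewrite mulrC ler_pdivrMr ?exprn_gt0//.
have : (1 + y) ^+ 2 <= 4 * y * t.
  apply: (@le_trans _ _ (4 * y * y)).
    rewrite -subr_ge0 (_ : _ - _ = (y - 1) * (3 * y + 1)); last by ring.
    by rewrite mulr_ge0 ?subr_ge0// addr_ge0// mulr_ge0// ltW.
  by rewrite ler_wpM2l// mulr_ge0// ltW.
move=> /(ler_wpM2l (ltW t0)) h.
by rewrite [leRHS](_ : _ = t * (4 * y * t))//; ring.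
Qed.

Lemma part_mxB b (X Y : M) i j : part b ((X - Y) i j) = part b (X i j) - part b (Y i j).
Proof. by rewrite !mxE partB. Qed.

Lemma part_mxZ b (r : K) (X : M) i j : part b ((r%:C *: X) i j) = r * part b (X i j).
Proof. by rewrite mxE partZ. Qed.

(** The function e^(-t) B t^A. At B = 1 its derivative is the integrand of A Gamma(A) -
    Gamma(A+1). *)
Definition expint A B t : M := (expR (- t))%:C *: (B * expmx ((ln t)%:C *: A)).

Lemma is_derive_expint A B b i j t : 0 < t -> is_derive t 1
  (fun t => part b (expint A B t i j))
  (part b ((t^-1%:C *: expint A (B * A) t - expint A B t) i j)).
Proof.
move=> t0; have hl := is_derive1_ln t0.
have h1 := is_derive1_comp (is_derive_expmx A B b i j (ln t)) hl.
have hN : is_derive t 1 (fun t : K => - t) (- 1) by exact: is_deriveN.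
have h2 := is_derive1_comp (is_derive_expR (- t)) hN.
have h3 := is_deriveM h2 h1.
rewrite (_ : (fun t => part b (expint A B t i j)) =
   (fun t => expR (- t) * part b ((B * expmx ((ln t)%:C *: A)) i j))); last first.
  by apply/funext => s; rewrite part_mxZ.
apply: (is_derive_eq h3); rewrite /GRing.scale /= part_mxB part_mxZ !part_mxZ.
by ring.
Qed.

Lemma derivable_expint A B b i j t : 0 < t ->
  derivable (fun t => part b (expint A B t i j)) t 1.
Proof. by move=> t0; have [] := is_derive_expint A B b i j t0. Qed.

Lemma Gamma_integrandE A t : Gamma_integrand A t = expint (A - 1) 1 t.
Proof. by rewrite /expint mul1r. Qed.

Lemma mxint_Gamma A : stable A -> mxint (Gamma_integrand A).
Proof.
move=> /Gamma_integrand_dom[C [d [d0 C0 dom]]] b i j.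
have ig := integrableMr C (integrable_gdom d0).
apply: le_integrable_half_line ig => t t0.
  under eq_fun do rewrite Gamma_integrandE; exact: derivable_expint.
rewrite mulrC (le_trans (le_part _ _))// (le_trans (normc_le_mxn _ _ _))//.
exact: dom.
Qed.

Lemma GammamxE A : Gammamx A = Imx (Gamma_integrand A).
Proof. by []. Qed.

Lemma Gammamx_comm A B : stable A -> A * B = B * A ->
  Gammamx A * B = B * Gammamx A.
Proof.
move=> sA AB; have iA := mxint_Gamma sA.
rewrite GammamxE -Imx_mulr// -Imx_mull//; apply: eq_Imx => t _.
rewrite /Gamma_integrand /powmx -scalerAl -scalerAr; congr (_ *: _).
apply: expmx_comm; rewrite -scalerAl -scalerAr; congr (_ *: _).
by rewrite mulrBl mulrBr mul1r mulr1 AB.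
Qed.

Lemma expmx_shift A t (r : K) : 0 < t ->
  expmx ((ln t)%:C *: (A + mxiota r)) = mxiota (expR (r * ln t)) * expmx ((ln t)%:C *: A).
Proof.
move=> t0; rewrite scalerDr -[_ *: mxiota r]mxiotaZ -rmorphM addrC expmxD.
  by rewrite expmx_iota mulrC.
exact: mxiotaC.
Qed.

Lemma Gamma_integrandS A t : 0 < t ->
  Gamma_integrand A t = t^-1%:C *: expint A 1 t.
Proof.
move=> t0; rewrite /Gamma_integrand /powmx.
have -> : expmx ((ln t)%:C *: (A - 1)) = mxiota t^-1 * expmx ((ln t)%:C *: A).
  have := expmx_shift A (- 1) t0.
  by rewrite [mxiota (- 1)]rmorphN1 mulN1r expRN lnK.
by rewrite mxiotaZ scalerA /expint mul1r scalerA [in RHS]mulrC.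
Qed.

Lemma gdom_mul_le (d t : K) : 0 < d -> 0 < t ->
  t * gdom d t <= d * expR (d * ln t) /\ t * gdom d t <= d * (expR (d * ln t))^-1.
Proof.
move=> d0 t0; rewrite /gdom; have := expR_gt0 (d * ln t).
move: (expR _) => y y0.
have -> : t * (d * y / (t * (1 + y) ^+ 2)) = d * (y / (1 + y) ^+ 2).
  by field; rewrite !gt_eqF//= ?addr_gt0.
have p0 : 0 < (1 + y) ^+ 2 by rewrite exprn_gt0// addr_gt0.
split; rewrite ler_wpM2l ?(ltW d0)// ler_pdivrMr//.
  by rewrite ler_peMr ?(ltW y0)//; nra.
by rewrite mulrC ler_pdivlMr//; nra.
Qed.

(** Integration by parts: the integrand of the difference is the derivative of e^(-t) t^A. The
    latter is t times the integrand of Gamma(A), and t times [gdom] tends to 0 at both ends. *)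
Lemma GammamxS A : stable A -> Gammamx (A + 1) = A * Gammamx A.
Proof.
move=> sA; have sA1 : stable (A + 1) by exact: (stableD 1 sA).
have iA := mxint_Gamma sA; have iA1 := mxint_Gamma sA1.
have iAA := mxint_mull A iA.
apply/esym/eqP; rewrite -subr_eq0 !GammamxE -Imx_mull// -ImxB//; apply/eqP.
have [C1 [d1 [d10 C10 dom1]]] := Gamma_integrand_dom sA.
have [C2 [d2 [d20 C20 dom2]]] := Gamma_integrand_dom sA1.
have dE t : 0 < t -> A * Gamma_integrand A t - Gamma_integrand (A + 1) t =
    t^-1%:C *: expint A A t - expint A 1 t.
  move=> t0; rewrite Gamma_integrandS// Gamma_integrandE addrK.
  by rewrite -scalerAr /expint -scalerAr mul1r.
apply: mx_partP => b i j; rewrite part_Imx mxE part0.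
pose a := mxn A * C1.
pose g := (a \*: gdom d1) + (C2 \*: gdom d2).
pose G := (a \*: gprim d1) + (C2 \*: gprim d2).
transitivity (\int[mu]_(t in D)
    part b ((t^-1%:C *: expint A A t - expint A 1 t) i j)).
  by apply: eq_Rintegral => t; rewrite inE /= in_itv/= andbT => /dE ->.
have a0 : 0 <= a by rewrite mulr_ge0// mxn_ge0.
(* One estimate for both ends: [u] will run to 0 and to infinity. *)
have Flim (u : nat -> K) (z : nat -> K) : (forall k, 0 < u k) ->
    (forall k, u k * gdom d1 (u k) <= d1 * z k) ->
    z @ \oo --> (0 : K) -> part b (expint A 1 (u k) i j) @[k --> \oo] --> (0 : K).
  move=> u0 uz z0; apply: norm_cvg0.
  apply: (squeeze_cvgr (f := cst 0) (h := fun k => C1 * (d1 * z k))).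
  - near=> k; rewrite normr_ge0 /= (le_trans (le_part _ _))//.
    rewrite (le_trans (normc_le_mxn _ _ _))//.
    have -> : expint A 1 (u k) = (u k)%:C *: Gamma_integrand A (u k).
      by rewrite Gamma_integrandS// scalerA -rmorphM divff ?gt_eqF// scale1r.
    rewrite mxn_scale ger0_norm ?(ltW (u0 k))//.
    rewrite (le_trans (ler_wpM2l (ltW (u0 k)) (dom1 _ (u0 k))))//.
    by rewrite mulrCA ler_wpM2l.
  - exact: cvg_cst.
  - rewrite -[X in _ --> X](mulr0 C1); apply: cvgMr.
    by rewrite -[X in _ --> X](mulr0 d1); apply: cvgMr.
apply: (@integral_derive_half_line _ _ (fun t => part b (expint A 1 t i j)) g G
  _ _ _ _ _ (a * -1 + C2 * -1) (a * 0 + C2 * 0)).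
- move=> t t0; rewrite (_ : (fun t => _) = (fun t => t^-1) * (fun t => part b (expint A A t i j))
    - (fun t => part b (expint A 1 t i j))); last first.
    by apply/funext => s; rewrite part_mxB part_mxZ.
  apply: derivableB; last exact: derivable_expint.
  apply: derivableM; last exact: derivable_expint.
  by apply: derivableV; [rewrite gt_eqF|exact: derivable_id].
- by move=> t t0; apply: derivableD; apply: derivableZ; exact: derivable_gdom.
- move=> t t0; rewrite -dE// (le_trans (le_part _ _))// (le_trans (normc_le_mxn _ _ _))//.
  rewrite (le_trans (nrmB mxnorm _ _))// -[leRHS]/(a * gdom d1 t + C2 * gdom d2 t).
  rewrite lerD ?dom2// (le_trans (nrmM mxnorm _ _))// /a -mulrA.
  by rewrite ler_wpM2l ?mxn_ge0// dom1.
- by move=> t t0; have := is_derive_expint A 1 b i j t0; rewrite mul1r.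
- move=> t t0; have h1 := is_derive_gprim d1 t0; have h2 := is_derive_gprim d2 t0.
  exact: is_deriveD (is_deriveZ a h1) (is_deriveZ C2 h2).
- exact: cvgD (cvgZr (cvg_gprim0 d10)) (cvgZr (cvg_gprim0 d20)).
- exact: cvgD (cvgZr (cvg_gprim1 d10)) (cvgZr (cvg_gprim1 d20)).
- apply: (Flim _ (fun k => expR (d1 * ln (k.+2%:R)^-1))).
  + by move=> k; rewrite invr_gt0.
  + by move=> k; have [] := gdom_mul_le d10 (_ : 0 < (k.+2%:R)^-1).
  + exact: cvg_expln_natV.
- apply: (Flim _ (fun k => expR (d1 * ln (k.+2%:R)^-1))).
  + by move=> k.
  + move=> k; rewrite -[expR _]invrK -expln_nat.
    by have [] := gdom_mul_le d10 (_ : 0 < k.+2%:R).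
  + exact: cvg_expln_natV.
Unshelve. all: by end_near. Qed.

End GammaFun.

Lemma cvg_near_eq {K : realType} {T : Type} {F : set_system T} {FF : Filter F}
    (f g : T -> K) (l : K) : (\forall x \near F, f x = g x) ->
  f x @[x --> F] --> l -> g x @[x --> F] --> l.
Proof. by move=> fg; apply: cvg_trans; exact: near_eq_cvg. Qed.

Section FactorialRatio.
Context {K : realType}.

Lemma cvg_divnS (c : K) : c / p.+1%:R @[p --> \oo] --> (0 : K).
Proof.
rewrite -[X in _ --> X](mulr0 c); apply: cvgMr.
exact: cvg_harmonic.
Qed.

Lemma cvg_fact_up k :
  (p + k)`!%:R / (p`!%:R * p.+1%:R ^+ k) @[p --> \oo] --> (1 : K).
Proof.
elim: k => [|k IH].
  rewrite (_ : (fun p => _) = cst 1); first exact: cvg_cst.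
  by apply/funext => p; rewrite addn0 expr0 mulr1 divff// pnatr_eq0 -lt0n fact_gt0.
have H : 1 + k%:R / p.+1%:R @[p --> \oo] --> (1 + 0 : K).
  by apply: cvgD; [exact: cvg_cst|exact: cvg_divnS].
rewrite -[X in _ --> X](_ : 1 * (1 + 0) = 1); last by rewrite addr0 mulr1.
apply: (cvg_near_eq _ (cvgM IH H)).
near=> p; rewrite /= addnS factS exprS natrM.
have f0 : (p`!%:R : K) != 0 by rewrite pnatr_eq0 -lt0n fact_gt0.
have p0 : (p.+1%:R : K) != 0 by rewrite pnatr_eq0.
have -> : (p + k).+1%:R = p.+1%:R + k%:R :> K by rewrite -natrD addSn.
by move: (p.+1%:R : K) p0 => m m0; field; rewrite f0 m0 expf_neq0.
Unshelve. all: by end_near. Qed.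

Lemma cvg_fact_down k :
  p.+1%:R ^+ k * (p - k)`!%:R / p`!%:R @[p --> \oo] --> (1 : K).
Proof.
elim: k => [|k IH].
  rewrite (_ : (fun p => _) = cst 1); first exact: cvg_cst.
  by apply/funext => p; rewrite subn0 expr0 mul1r divff// pnatr_eq0 -lt0n fact_gt0.
have H : (1 - k.+1%:R / p.+1%:R)^-1 @[p --> \oo] --> (1 : K).
  have h1 : 1 - k.+1%:R / p.+1%:R @[p --> \oo] --> (1 : K).
    rewrite -[X in _ --> X]subr0; apply: cvgB; first exact: cvg_cst.
    exact: cvg_divnS.
  have h2 := cvgV (oner_neq0 K) h1.
  by rewrite invr1 in h2; exact: h2.
rewrite -[X in _ --> X]mulr1; apply: (cvg_near_eq _ (cvgM IH H)).
near=> p; rewrite /=.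
have kp : (k < p)%N by near: p; exact: nbhs_infty_gt.
have e : (p - k)%N = (p - k.+1).+1 by rewrite subnSK.
have f0 : (p`!%:R : K) != 0 by rewrite pnatr_eq0 -lt0n fact_gt0.
have p0 : (p.+1%:R : K) != 0 by rewrite pnatr_eq0.
have d0 : (p.+1%:R - k.+1%:R : K) != 0 by rewrite subr_eq0 eqr_nat eqSS gtn_eqF.
have -> : (p - k)`!%:R = (p.+1%:R - k.+1%:R) * (p - k.+1)`!%:R :> K.
  by rewrite e factS natrM -e -natrB ?subSS// ltnW.
rewrite exprS.
have -> : 1 - k.+1%:R / p.+1%:R = (p.+1%:R - k.+1%:R) / p.+1%:R :> K.
  by rewrite mulrBl divff.
rewrite invf_div; move: (p.+1%:R - _) d0 => d d0.
by move: (p.+1%:R : K) => m; field; rewrite f0 d0.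
Unshelve. all: by end_near. Qed.

End FactorialRatio.

(** * Gamma along the integers, and its invertibility *)

Section GammaAsymptotics.
Context {K : realType} {n : nat}.
Local Notation M := 'M[K[i]]_n.+1.
Notation mu := (@lebesgue_measure K).
Local Notation D := (`]0%R, +oo[%classic : set K).
Implicit Types (A B : M) (t : K).
Local Notation stable := (stable (@mxnorm K n)).

Local Arguments part : simpl never.

Definition gpow p t : K := expR (- t) * t ^+ p.

Lemma part_mxiota b (r : K) (i j : 'I_n.+1) :
  part b ((mxiota r : M) i j) = (b && (i == j))%:R * r.
Proof.
rewrite mxE; case: (i == j); case: b; rewrite ?andbT ?andbF ?mulr1n ?mulr0n /=;
by rewrite ?mul1r ?mul0r.
Qed.

Lemma stable_mxiota (r : K) : 0 < r -> stable (mxiota r : M).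
Proof.
move=> r0; exists mxnorm, 1, r, r; split=> //; first by move=> x; rewrite mul1r.
by rewrite subrr nrm0 subrr.
Qed.

Lemma Gamma_integrand_addn A p t : 0 < t ->
  Gamma_integrand (A + mxiota p.+1%:R) t
  = (gpow p t)%:C *: expmx ((ln t)%:C *: A).
Proof.
move=> t0; rewrite /Gamma_integrand /powmx.
have -> : A + mxiota p.+1%:R - 1 = A + mxiota p%:R.
  by rewrite -natr1 rmorphD rmorph1 addrA addrK.
rewrite expmx_shift// expRM_natl lnK// mxiotaZ scalerA /gpow.
by rewrite -rmorphM.
Qed.

Lemma Gamma_integrand_nat p t : 0 < t ->
  Gamma_integrand (mxiota p.+1%:R : M) t = mxiota (gpow p t).
Proof.
move=> t0; rewrite -[mxiota _]add0r Gamma_integrand_addn// scaler0.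
have -> : expmx (0 : M) = 1.
  by rewrite -(rmorph0 (@mxiota K n)) expmx_iota expR0 rmorph1.
by rewrite -mxiotaZ mulr1.
Qed.

Lemma integrable_gpow p : mu.-integrable D (EFin \o gpow p).
Proof.
have sp : stable (mxiota p.+1%:R) by apply: stable_mxiota.
apply: eq_integrable (mxint_Gamma sp true ord0 ord0) => // t.
rewrite inE /= in_itv/= andbT => t0.
by rewrite Gamma_integrand_nat// part_mxiota eqxx mul1r.
Qed.

Lemma Gammamx1 : Gammamx (1 : M) = 1.
Proof.
rewrite -(rmorph1 (@mxiota K n)) GammamxE; apply: mx_partP => b i j.
rewrite part_Imx part_mxiota.
transitivity (\int[mu]_(t in D) ((b && (i == j))%:R * gpow 0 t)).
  apply: eq_Rintegral => t; rewrite inE /= in_itv/= andbT => t0.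
  by rewrite (Gamma_integrand_nat 0)// part_mxiota.
rewrite RintegralZl//; last exact: integrable_gpow.
congr (_ * _).
have dN (t : K) : is_derive t 1 (fun t => expR (- t)) (- expR (- t)).
  have hN : is_derive t 1 (fun t : K => - t) (- 1) by exact: is_deriveN.
  have := is_derive1_comp (is_derive_expR (- t)) hN.
  by rewrite mulrN1.
have g0E t : gpow 0 t = expR (- t) by rewrite /gpow expr0 mulr1.
suff I0 : (\int[mu]_(t in D) (gpow 0 t)%:E = (0 - - 1)%:E)%E.
  by rewrite /Rintegral I0 opprK add0r.
apply: (@ge0_integral_half_line _ _ (fun t => - expR (- t))).
- by move=> t _; rewrite g0E expR_ge0.
- move=> t _; rewrite (_ : gpow 0 = (fun t => expR (- t))); last exact/funext.
  by have [] := dN t.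
- by move=> t _; rewrite g0E; have := is_deriveN (dN t); rewrite opprK.
- apply: cvgN; rewrite -{2}[1]expR0 -oppr0.
  apply: (@continuous_cvg _ _ _ _ _ _ (@expR K)); first exact: continuous_expR.
  apply: cvgN; have := @cvg_harmonic K; rewrite -cvg_shiftS; exact.
- rewrite -oppr0; apply: cvgN.
  apply: (squeeze_cvgr (f := cst 0) (h := @harmonic K)).
  + near=> k; rewrite expR_ge0 /= expRN lef_pV2 ?posrE ?expR_gt0//.
    by rewrite (le_trans _ (expR_ge1Dx _))// nat1r ler_nat ltnW.
  + exact: cvg_cst.
  + exact: cvg_harmonic.
Unshelve. all: by end_near. Qed.

Lemma Gammamx_addn A p : stable A ->
  Gammamx (A + mxiota p%:R) = rpoch A p * Gammamx A.
Proof.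
move=> sA; elim: p => [|p IH].
  by rewrite rmorph0 addr0 rpoch0 mul1r.
rewrite -natr1 rmorphD rmorph1 addrA GammamxS; last first.
  by rewrite rmorph_nat; exact: stableD.
rewrite IH rpochS rmorph_nat mulrA; congr (_ * _).
apply: commr_prod => k _; apply: commrD; last exact: commr_nat.
by apply: commr_sym; apply: commrD; [|exact: commr_nat].
Qed.

(** The scalar integral is an entry of Gamma at the scalar matrix (p+1) I, which the functional
    equation computes. *)
Lemma integral_gpow p : \int[mu]_(t in D) gpow p t = p`!%:R.
Proof.
have GN : Gammamx (mxiota p.+1%:R : M) = mxiota p`!%:R.
  elim: p => [|p IH]; first by rewrite !rmorph1 Gammamx1.
  rewrite -natr1 rmorphD rmorph1 GammamxS; last exact: stable_mxiota.
  by rewrite IH -rmorphM -natrM.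
have := congr1 (fun X : M => part true (X ord0 ord0)) GN.
rewrite GammamxE part_Imx (part_mxiota true) eqxx mul1r => <-.
apply: eq_Rintegral => t; rewrite inE /= in_itv/= andbT => t0.
by rewrite Gamma_integrand_nat// (part_mxiota true) eqxx mul1r.
Qed.

(* exp(N |v|) is replaced by powers of exp(v) and exp(-v), so that for v = ln (t / m)
   the bound is a combination of powers of t. *)
Lemma expmxB1_bound A N (v e : K) : mxnorm A <= N%:R -> 0 < e ->
  mxn (expmx (v%:C *: A) - 1) <=
  e + e^-1 * (expR v ^+ (N + N) + (expR v ^+ (N + N))^-1 - 2).
Proof.
move=> AN e0; apply: (le_trans (mxn_expmxB1 _)).
rewrite [mxnorm _]mxn_scale.
have h : expR (`|v| * mxn A) <= expR `|v| ^+ N.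
  by rewrite -expRM_natl ler_expR mulrC ler_wpM2r.
(* The quantity to bound is q - 1, and (q-1)^2 <= q^2 + q^(-2) - 2. Either q - 1 <= e, or q - 1 <=
   (q-1)^2 / e; the claimed sum covers both cases. *)
pose q := expR `|v| ^+ N.
have -> : expR v ^+ (N + N) + (expR v ^+ (N + N))^-1 = q ^+ 2 + (q ^+ 2)^-1.
  have s : q ^+ 2 = expR `|v| ^+ (N + N) by rewrite /q -exprM muln2 addnn.
  rewrite s; have [v0|v0] := ger0P v; first by [].
  by rewrite expRN exprVn invrK addrC.
have q1 : 1 <= q by rewrite exprn_ege1// -expR0 ler_expR.
apply: (@le_trans _ _ (q - 1)); first by rewrite lerD2r.
have q0 : 0 < q by rewrite (lt_le_trans ltr01).
have h2 : (q - 1) ^+ 2 <= q ^+ 2 + (q ^+ 2)^-1 - 2.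
  have : q ^+ 2 + (q ^+ 2)^-1 - 2 = (q - 1) ^+ 2 * (1 + q^-1) ^+ 2.
    by field; rewrite gt_eqF.
  move=> ->; rewrite ler_peMr ?sqr_ge0// exprn_ege1// lerDl invr_ge0 ltW//.
have [qe|eq] := leP (q - 1) e.
  by rewrite (le_trans qe)// lerDl mulr_ge0 ?invr_ge0 ?(ltW e0)// (le_trans _ h2)// sqr_ge0.
have : q - 1 <= e^-1 * (q - 1) ^+ 2.
  by rewrite mulrC ler_pdivlMr// expr2 ler_wpM2l ?subr_ge0// ltW.
move=> /le_trans; apply; rewrite (le_trans (ler_wpM2l _ h2)) ?invr_ge0 ?(ltW e0)//.
by rewrite lerDr ltW.
Qed.

(** With m = p+1 and v = ln(t/m), Gamma(A+m) m^(-A) - p! I is the integral of e^(-t) t^p (exp(vA) -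
    I). [expmxB1_bound] bounds it by integrals of e^(-t) t^q for q = p, p+k, p-k, which are
    factorials. After division by p! the bound is e + rho/e, where rho tends to 0 and e is free. *)
Lemma Gammamx_asymptotic A : stable A ->
  ncvg mxnorm \oo (fun p => mxiota p`!%:R^-1 *
    (Gammamx (A + mxiota p.+1%:R) * expmx ((- ln p.+1%:R)%:C *: A))) 1.
Proof.
move=> sA; pose N := Num.bound (mxnorm A); pose k := (N + N)%N.
have AN : mxnorm A <= N%:R by rewrite ltW// archi_boundP// nrm_ge0.
pose rho p : K := (p + k)`!%:R / (p`!%:R * p.+1%:R ^+ k)
  + p.+1%:R ^+ k * (p - k)`!%:R / p`!%:R - 2.
have rho0 : rho @ \oo --> (0 : K).
  rewrite -(subrr 2); apply: cvgB; last exact: cvg_cst.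
  by rewrite -[X in _ --> X](_ : 1 + 1 = 2)//; apply: cvgD;
    [exact: cvg_fact_up|exact: cvg_fact_down].
have bound p b i j (e : K) : (k <= p)%N -> 0 < e ->
  `|part b ((mxiota p`!%:R^-1 *
    (Gammamx (A + mxiota p.+1%:R) * expmx ((- ln p.+1%:R)%:C *: A))) i j)
    - part b ((1 : M) i j)| <= e + e^-1 * rho p.
  move=> kp e0; have sAp : stable (A + mxiota p.+1%:R).
    by rewrite rmorph_nat; exact: stableD.
  pose m : K := p.+1%:R; have m0 : 0 < m by [].
  have f0 : (0 : K) < p`!%:R by rewrite ltr0n fact_gt0.
  set E := expmx ((- ln _)%:C *: A).
  have iX := mxint_mulr E (mxint_Gamma sAp).
  have sp : stable (mxiota p.+1%:R) by apply: stable_mxiota.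
  have i1 := mxint_Gamma sp.
  have e1 : Gammamx (mxiota p.+1%:R : M) = mxiota p`!%:R.
    rewrite GammamxE; apply: mx_partP => b' i' j'; rewrite part_Imx part_mxiota.
    rewrite -integral_gpow -RintegralZl//; last exact: integrable_gpow.
    apply: eq_Rintegral => t; rewrite inE /= in_itv/= andbT => t0.
    by rewrite Gamma_integrand_nat// part_mxiota.
  have diff : mxiota p`!%:R^-1 * (Gammamx (A + mxiota p.+1%:R) * E) - 1 =
     mxiota p`!%:R^-1 * Imx (fun t => Gamma_integrand (A + mxiota p.+1%:R) t * E
       - Gamma_integrand (mxiota p.+1%:R) t).
    rewrite (ImxB iX i1) (Imx_mulr E (mxint_Gamma sAp)) mulrBr.
    congr (_ - _).
    transitivity (mxiota p`!%:R^-1 * mxiota p`!%:R : M).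
      by rewrite -(rmorphM (@mxiota K n)) mulVf ?gt_eqF.
    by rewrite -e1.
  rewrite -part_mxB diff mxiotaZ part_mxZ normrM ger0_norm ?invr_ge0//.
  rewrite mulrC ler_pdivrMr//.
  pose g : K -> K := fun t => e * gpow p t + (e^-1 * ((m ^+ k)^-1 * gpow (p + k) t)
     + (e^-1 * (m ^+ k * gpow (p - k) t) + (- 2 * e^-1) * gpow p t)).
  have ig (c : K) q : mu.-integrable D (EFin \o (fun t => c * gpow q t)).
    apply: eq_integrable (integrableMr c (integrable_gpow q)) => // t _.
    by rewrite /= mulrC.
  have ig' (c c' : K) q : mu.-integrable D (EFin \o (fun t => c * (c' * gpow q t))).
    by apply: eq_integrable (ig (c * c') q) => // t _; rewrite /= mulrA.
  have ig1 := integrableD (mu := mu) (measurable_itv _) (ig' e^-1 (m ^+ k) (p - k)%N) (ig (- 2 * e^-1) p).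
  have ig2 := integrableD (mu := mu) (measurable_itv _) (ig' e^-1 (m ^+ k)^-1 (p + k)%N) ig1.
  have ig3 := integrableD (mu := mu) (measurable_itv _) (ig e p) ig2.
  apply: le_trans (part_Imx_le (g := g) b i j _ _ _) _.
  - exact: mxintB.
  - exact: ig3.
  - move=> t t0.
    rewrite Gamma_integrand_addn// Gamma_integrand_nat// -scalerAl -expmxD; last first.
      by rewrite -!scalerAl -!scalerAr scalerA [in RHS]scalerA mulrC.
    rewrite -scalerDl -rmorphD -[mxiota (gpow p t)]mulr1 mxiotaZ -scalerBr mxn_scale.
    have gp0 : 0 <= gpow p t by rewrite mulr_ge0 ?expR_ge0// exprn_ge0// ltW.
    rewrite ger0_norm//.
    apply: (le_trans (ler_wpM2l gp0 (expmxB1_bound _ AN e0))).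
    have -> : expR (ln t - ln p.+1%:R) = t / m.
      by rewrite expRD expRN !lnK ?posrE.
    rewrite -/k /g expr_div_n.
    have -> : gpow (p + k) t = gpow p t * t ^+ k by rewrite /gpow exprD mulrA.
    have tk : t ^+ k != 0 by rewrite expf_neq0// gt_eqF.
    have mk : m ^+ k != 0 by rewrite expf_neq0// gt_eqF.
    have -> : gpow (p - k) t = gpow p t / t ^+ k.
      by apply: (mulIf tk); rewrite divfK// /gpow -mulrA -exprD subnK.
    rewrite le_eqVlt; apply/orP; left; apply/eqP.
    move: (gpow p t) (t ^+ k) (m ^+ k) tk mk => w x y x0 y0.
    have {}e0 : e != 0 by rewrite gt_eqF.
    clear -x0 y0 e0; field.
    by rewrite x0 y0 e0.
  rewrite /g.
  rewrite (RintegralD (mu := mu) (measurable_itv _) (ig e p) ig2).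
  rewrite (RintegralD (mu := mu) (measurable_itv _) (ig' e^-1 (m ^+ k)^-1 (p + k)%N) ig1).
  rewrite (RintegralD (mu := mu) (measurable_itv _) (ig' e^-1 (m ^+ k) (p - k)%N) (ig (- 2 * e^-1) p)).
  rewrite !RintegralZl//; do ?[exact: integrable_gpow|exact: ig].
  rewrite !integral_gpow /rho le_eqVlt; apply/orP; left; apply/eqP.
  have mk : m ^+ k != 0 by rewrite expf_neq0// gt_eqF.
  have {}e0 : e != 0 by rewrite gt_eqF.
  have {}f0 : p`!%:R != 0 :> K by rewrite gt_eqF.
  rewrite -/m; move: (m ^+ k) (p`!%:R : K) mk f0 => x y x0 y0.
  move: ((p + k)`!%:R : K) ((p - k)`!%:R : K) => z w.
  clear -x0 y0 e0; field.
  by rewrite x0 y0 e0.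
apply/ncvg_part => b i j; apply/cvgrPdist_le => e e0.
have e2 : 0 < e / 2 by rewrite divr_gt0.
(* With the free parameter e/2, rho <= (e/2)^2 makes the second summand at most e/2. *)
have ee : 0 < (e / 2) ^+ 2 by rewrite exprn_gt0.
near=> p; rewrite distrC; apply: (le_trans (bound _ _ _ _ _ _ e2)).
  by near: p; exact: nbhs_infty_ge.
have : `|0 - rho p| <= (e / 2) ^+ 2.
  by near: p; move/cvgrPdist_le: rho0; exact.
rewrite sub0r normrN => /(le_trans (ler_norm _)) h.
rewrite -[leRHS](_ : e / 2 + (e / 2)^-1 * (e / 2) ^+ 2 = e).
  by rewrite lerD2l ler_wpM2l// invr_ge0 ltW.
by field; rewrite gt_eqF.
Unshelve. all: by end_near. Qed.

(** By the asymptotics, some product of Gamma(A), a Pochhammer symbol, an exponential and a scalar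
    is within distance 1 of I, hence invertible. All factors commute with Gamma(A), which can be
    moved to the right end and is then invertible. *)
Lemma Gammamx_unit A : stable A -> Gammamx A \is a GRing.unit.
Proof.
move=> sA; have /cvgrPdist_lt/(_ _ ltr01)[p _ /(_ p (leqnn p))] := Gammamx_asymptotic sA.
rewrite sub0r normrN ger0_norm ?nrm_ge0// => /unit_near1.
rewrite Gammamx_addn// !mulrA.
set G := Gammamx A; set Y := expmx _; set X := _ * rpoch A _ => XGY.
have GC B : A * B = B * A -> G * B = B * G by exact: Gammamx_comm.
have AY : A * Y = Y * A.
  by apply/esym; apply: expmx_comm; rewrite -scalerAl -scalerAr.
have AX : A * X = X * A.
  rewrite /X mulrA -mxiotaC -!mulrA; congr (_ * _).
  apply: commr_prod => k _; apply: commrD; last exact: commr_nat.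
  by [].
have GX := GC X AX; have GY := GC Y AY.
rewrite -mulrA GY mulrA in XGY.
have := XGY; rewrite -[_ \is a _]/(_ \in unitmx) unitmx_mul => /andP[_].
by [].
Qed.

End GammaAsymptotics.

(** * Gauss and Kummer summation for commuting matrices *)

Section Abel.
Context {K : realType} {A : nzRingType} {iota : {rmorphism K -> A}}.
Variable nu : algnorm iota.

(** Abel's theorem by summation by parts, with [d n] the error of the n-th partial sum. It
    identifies the radial limit with the series at -1 whenever the latter converges. *)
Lemma abel (c : nat -> A) s (f : K -> A) : nsum nu c s ->
  (forall r, 0 <= r < 1 -> nsum nu (fun k => iota (r ^+ k) * c k) (f r)) ->
  ncvg nu (1 : K)^'- f s.
Proof.
move=> cs fs; pose d n := \sum_(0 <= k < n) c k - s.
have dS k : d k.+1 = d k + c k by rewrite /d big_nat_recr//= addrAC.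
have id r n : \sum_(0 <= k < n) iota (r ^+ k) * c k - s =
    iota (r ^+ n) * d n + iota (1 - r) * \sum_(0 <= k < n) iota (r ^+ k) * d k.+1.
  elim: n => [|n IH].
    by rewrite /d !big_geq// expr0 rmorph1 mul1r mulr0 addr0.
  rewrite !big_nat_recr//= addrAC IH.
  have -> : c n = d n.+1 - d n by rewrite dS addrAC subrr add0r.
  have key (x y z : A) : x + y + (z - x) = y + z.
    by rewrite addrC addrA subrK addrC.
  rewrite [_ * (d n.+1 - _)]mulrBr key [in RHS](mulrDr (iota (1 - r))) [in RHS]addrCA.
  congr (_ + _); rewrite mulrA -rmorphM -mulrDl -rmorphD.
  by congr (iota _ * _); rewrite exprS; ring.
apply/cvgrPdist_le => e e0; have e2 : 0 < e / 2 by rewrite divr_gt0.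
have [N _ dN] : \forall n \near \oo, nu (d n) <= e / 2.
  have /cvgrPdist_le/(_ _ e2) := cs; apply: filterS => n.
  by rewrite sub0r normrN ger0_norm// nrm_ge0.
(* The errors before index N are paid for by the factor 1 - r; the later ones are at most e/2 and
   are averaged with the weights (1-r) r^k, of total at most 1. *)
pose B := \sum_(0 <= k < N) nu (d k.+1).
have B0 : 0 <= B by apply: sumr_ge0 => k _; exact: nrm_ge0.
near=> r; rewrite sub0r normrN ger0_norm ?nrm_ge0//.
have r0 : 0 <= r by near: r; exact: nbhs_left_ge.
have r1 : r < 1 by near: r; exact: nbhs_left_lt.
have rB : (1 - r) * B <= e / 2.
  have : 1 - e / 2 / (B + 1) <= r.
    by near: r; apply: nbhs_left_ge; rewrite ltrBlDr ltrDl divr_gt0// ltr_wpDl.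
  rewrite lerBlDl -lerBlDr ler_pdivlMr ?ltr_wpDl// => /(le_trans _); apply.
  by rewrite ler_wpM2l ?subr_ge0 ?(ltW r1)// lerDl.
have fr := fs r; rewrite r0 r1 in fr.
have le_n n : (N <= n)%N -> nu (\sum_(0 <= k < n) iota (r ^+ k) * c k - s)
    <= nu (d n) + (e / 2 + e / 2).
  move=> Nn; rewrite id (le_trans (nrmD _ _ _))// lerD//.
    by rewrite nrmZ ger0_norm ?exprn_ge0// ler_piMl ?nrm_ge0// exprn_ile1// ltW.
  rewrite nrmZ ger0_norm ?subr_ge0 ?(ltW r1)//.
  apply: (@le_trans _ _ ((1 - r) * (\sum_(0 <= k < n) r ^+ k * (e / 2) + B))).
    rewrite ler_wpM2l ?subr_ge0 ?(ltW r1)// (le_trans (nrm_sum _ _ _ _))//.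
    rewrite (@big_cat_nat _ _ _ N)//= [in leRHS](@big_cat_nat _ _ _ N)//=.
    rewrite [leRHS]addrAC lerD//.
      rewrite /B -big_split; apply: ler_sum => k _ /=.
      rewrite nrmZ ger0_norm ?exprn_ge0// (@le_trans _ _ (nu (d k.+1)))//.
        by rewrite ler_piMl ?nrm_ge0// exprn_ile1// ltW.
      by rewrite lerDr mulr_ge0 ?exprn_ge0// ltW.
    rewrite big_nat [leRHS]big_nat; apply: ler_sum => k /andP[Nk _].
    rewrite nrmZ ger0_norm ?exprn_ge0// ler_wpM2l ?exprn_ge0//.
    by apply: dN => /=; exact: leqW.
  rewrite mulrDr lerD// -mulr_suml [leLHS]mulrA -[leRHS]mul1r ler_wpM2r ?(ltW e2)//.
  have -> : (1 - r) * \sum_(0 <= k < n) r ^+ k = 1 - r ^+ n.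
    by rewrite big_mkord -opprB mulNr -subrX1 opprB.
  by rewrite lerBlDr lerDl exprn_ge0.
rewrite (_ : e = 0 + (e / 2 + e / 2)); last by field.
have H1 : nu (\sum_(0 <= k < n) iota (r ^+ k) * c k - s) @[n --> \oo] --> nu (f r - s).
  by apply: ncvg_nrm; apply: ncvgB; [exact: fr|exact: ncvg_cst].
have H2 : nu (d n) + (e / 2 + e / 2) @[n --> \oo] --> 0 + (e / 2 + e / 2).
  by apply: cvgD; [exact: cs|exact: cvg_cst].
apply: (ler_cvg_to H1 H2); near=> n; apply: le_n.
by near: n; exact: nbhs_infty_ge.
Unshelve. all: by end_near. Qed.

End Abel.

Section BicomNorm.
Context {K : realType} {n : nat} (c : commfam K n).
Local Notation M := 'M[K[i]]_n.+1.
Local Notation A := (bicom c).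

Definition bicom_iota (r : K) : A := Bicom (scalar_bicommutant c r%:C).

Lemma bicom_iota_zmod : zmod_morphism bicom_iota.
Proof. by move=> x y; apply: val_inj; rewrite /= !rmorphB. Qed.

Lemma bicom_iota_monoid : monoid_morphism bicom_iota.
Proof.
by split=> [|x y]; apply: val_inj; rewrite /= ?rmorph1 ?rmorphM.
Qed.

HB.instance Definition _ :=
  GRing.isZmodMorphism.Build K A bicom_iota bicom_iota_zmod.
HB.instance Definition _ :=
  GRing.isMonoidMorphism.Build K A bicom_iota bicom_iota_monoid.

Definition bicom_norm : algnorm bicom_iota :=
  @pull_norm K M A mxiota bicom_iota (val : {rmorphism A -> M})
    (fun _ => erefl) val_inj mxnorm.

Lemma ncvg_bicom T (F : set_system T) (u : T -> A) l :
  ncvg bicom_norm F u l <-> ncvg mxnorm F (fun x => val (u x)) (val l).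
Proof.
rewrite /ncvg (_ : (fun x => bicom_norm (u x - l))
  = (fun x => mxnorm (val (u x) - val l)))//.
Qed.

Lemma nsum_bicom (u : nat -> A) l :
  nsum bicom_norm u l <-> nsum mxnorm (fun k => val (u k)) (val l).
Proof.
rewrite /nsum ncvg_bicom; split; apply: ncvg_near; near=> m;
by rewrite rmorph_sum.
Unshelve. all: by end_near. Qed.

Lemma bicom_complete : ncomplete bicom_norm.
Proof.
move=> u cu; have [s Hs] := mx_complete (u := fun k => val (u k)) cu.
have sB : s \in bicommutant c.
  apply/bicommutantP => Z cZ; apply: ncvg_unique (ncvgMr Z Hs) _.
  apply: ncvg_near (ncvgMl Z Hs); near=> m.
  rewrite mulr_sumr mulr_suml; apply: eq_bigr => k _.
  by have /bicommutantP/(_ Z cZ) := valP (u k).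
by exists (Bicom sB); apply/nsum_bicom.
Unshelve. all: by end_near. Qed.

Lemma bicom_stable (S : A) : stable mxnorm (val S) -> stable bicom_norm S.
Proof.
move=> [nu [C [b [d [d0 nuC Sd]]]]].
exists (@pull_norm K M A mxiota bicom_iota (val : {rmorphism A -> M})
    (fun _ => erefl) val_inj nu), C, b, d; split=> //.
  by move=> x; exact: nuC.
Qed.

Lemma val_rpoch (X : A) m : val (rpoch X m) = poch (val X) m.
Proof.
rewrite /rpoch rmorph_prod; apply: eq_bigr => k _.
by rewrite rmorphD rmorph_nat.
Qed.

(* The witnesses are sealed to keep unification from unfolding them. *)
Lemma expb_subproof (X : A) : {Y : A | val Y = expmx (val X)}.
Proof.
suff h : expmx (val X) \in bicommutant c by exists (Bicom h).
apply/bicommutantP => Z cZ; apply: expmx_comm.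
by have /bicommutantP/(_ Z cZ) := valP X.
Qed.

Definition expb X : A := sval (expb_subproof X).

Lemma val_expb X : val (expb X) = expmx (val X).
Proof. exact: (svalP (expb_subproof X)). Qed.

(* Rewriting with [val_expb] would compare [expmx] of different matrices by
   unfolding the limits, hence the explicit congruences. *)
Lemma expbD a b : expb a * expb b = expb (a + b).
Proof.
have ab : val a * val b = val b * val a by exact: (congr1 val (mulrC a b)).
have vab : val (a + b) = val a + val b by exact: rmorphD.
apply: val_inj.
transitivity (expmx (val a) * expmx (val b)).
  exact: (congr2 (fun x y : M => x * y) (val_expb a) (val_expb b)).
apply: etrans (esym (expmxD ab)) _; apply: etrans (congr1 _ (esym vab)) _.
exact/esym/val_expb.
Qed.

Lemma gam_subproof (X : A) :
  {Y : A | stable mxnorm (val X) -> val Y = Gammamx (val X)}.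
Proof.
(* The default 0 covers values outside the bicommutant; for stable X it is never taken, as
   [Gammamx_comm] shows. *)
exists (insubd 0 (Gammamx (val X))) => sX; apply: insubdK.
apply/bicommutantP => Z cZ; apply: Gammamx_comm => //.
by have /bicommutantP/(_ Z cZ) := valP X.
Qed.

Definition gam X : A := sval (gam_subproof X).

Lemma val_gam X : stable mxnorm (val X) -> val (gam X) = Gammamx (val X).
Proof. exact: (svalP (gam_subproof X)). Qed.

Lemma gam_unit X : stable mxnorm (val X) -> gam X \is a GRing.unit.
Proof.
move=> sX; have := Gammamx_unit sX; rewrite -(val_gam sX) => u.
rewrite unfold_in; exact: u.
Qed.

End BicomNorm.

(** * Gauss and Kummer sums from abstract properties of Gamma *)

Section GammaData.
Context {K : realType} {A : comUnitRingType} {iota : {rmorphism K -> A}}.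
Variable nu : algnorm iota.
Hypothesis nuC : ncomplete nu.
Variables (st : A -> Prop) (gam : A -> A) (E : A -> nat -> A) (p q r : A).
Hypotheses (st_nat : forall x j, st x -> st (x + j%:R))
  (st_stable : forall x, st x -> stable nu x)
  (gam_unit : forall x, st x -> gam x \is a GRing.unit)
  (gam_addn : forall x j, st x -> gam (x + j%:R) = rpoch x j * gam x)
  (gam_limit : forall x, st x ->
     ncvg nu \oo (fun m => rpoch x m * E x m) (gam x)^-1)
  (E_add : forall x y z t m, x + y = z + t -> E x m * E y m = E z m * E t m).
Hypotheses (st_r : st r) (st_rp : st (r - p)) (st_rq : st (r - q))
  (st_rpq : st (r - p - q)) (ru : units_from r) (rpu : units_from (r - p)).

Definition gamma_quotient : A :=
  gam r * gam (r - p - q) * (gam (r - p))^-1 * (gam (r - q))^-1.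

Lemma gamma_quotient_unit : gamma_quotient \is a GRing.unit.
Proof. by rewrite /gamma_quotient !unitrM !unitrV !gam_unit. Qed.

(** Shifting q and r together leaves r-p-q and r-q fixed, so only Gamma(r) and Gamma(r-p) acquire
    Pochhammer factors. *)
Lemma gauss_gamma j : nsum nu (gauss_term iota p (q + j%:R) (r + j%:R))
  (gamma_quotient * (rpoch r j * (rpoch (r - p) j)^-1)).
Proof.
have rju : units_from (r + j%:R) by exact: units_fromD.
have e1 : r + j%:R - p - (q + j%:R) = r - p - q by ring.
have e2 : r + j%:R - p = r - p + j%:R by ring.
have e3 : r + j%:R - (q + j%:R) = r - q by ring.
have st1 : stable nu (r + j%:R - p - (q + j%:R)) by rewrite e1; exact: st_stable.
have [F HF] := gauss_exists nuC rju st1.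
suff -> : gamma_quotient * (rpoch r j * (rpoch (r - p) j)^-1) = F by [].
have := @gauss_sum _ _ _ nu nuC p (q + j%:R) (r + j%:R) F
  (fun x => (gam x)^-1) E rju st1 HF.
rewrite e1 e2 e3 => H.
have {}H : (gam (r + j%:R))^-1 * (gam (r - p - q))^-1 * F
    = (gam (r - p + j%:R))^-1 * (gam (r - q))^-1.
  apply: H => [x|m]; last by apply: E_add; ring.
  by rewrite !inE => /or4P[] /eqP ->; apply: gam_limit => //; exact: st_nat.
have u1 : gam (r + j%:R) \is a GRing.unit by exact/gam_unit/st_nat.
have u2 : gam (r - p - q) \is a GRing.unit by exact/gam_unit.
have -> : F = gam (r + j%:R) * gam (r - p - q)
    * ((gam (r + j%:R))^-1 * (gam (r - p - q))^-1 * F).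
  transitivity ((gam (r + j%:R) * (gam (r + j%:R))^-1)
    * (gam (r - p - q) * (gam (r - p - q))^-1) * F); last by ring.
  by rewrite !mulrV// !mul1r.
rewrite H !gam_addn// invrM ?gam_unit ?rpoch_unit// /gamma_quotient.
by ring.
Qed.

(** [kummer_limit] gives the limit of the product with the Gamma quotient. Dividing by this unit
    shows that 2F1 itself has a limit, which the existence of the boundary value requires. *)
Lemma kummer_gamma : exists S,
  nsum nu (fun m => alpha iota p m * poch_ratio q r m.*2) (gamma_quotient * S) /\
  forall f : K -> A, (forall t, 0 <= t < 1 ->
    nsum nu (fun j => alpha iota p j * poch_ratio q (r - p) j * iota (- t) ^+ j) (f t)) ->
  ncvg nu (1 : K)^'- f S.
Proof.
have Gu := gamma_quotient_unit.
have [L [HL Hf]] := kummer_limit nuC ru (st_stable st_rpq) gauss_gamma.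
exists (gamma_quotient^-1 * L); rewrite mulVKr//; split.
  exact: kummer_term_one_sum HL.
move=> f /Hf /(ncvgMl gamma_quotient^-1); apply: ncvg_near.
by near=> t; rewrite mulKr.
Unshelve. all: by end_near. Qed.

End GammaData.

Section HypTerms.
Context {K : realType} {n : nat} (c : commfam K n).
Local Notation M := 'M[K[i]]_n.+1.
Local Notation A := (bicom c).
Local Notation iota := (@bicom_iota K n c).
Implicit Types (p q r x y : A).

Lemma bvalM x y : val (x * y) = val x * val y.
Proof. exact: rmorphM. Qed.

Lemma bvalD x y : val (x + y) = val x + val y.
Proof. exact: rmorphD. Qed.

Lemma bvalB x y : val (x - y) = val x - val y.
Proof. exact: rmorphB. Qed.

Lemma bval1 : val (1 : A) = 1.
Proof. exact: rmorph1. Qed.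

Lemma bvalX x k : val (x ^+ k) = val x ^+ k.
Proof. exact: rmorphXn. Qed.

Lemma bvalV x : x \is a GRing.unit -> val x^-1 = (val x)^-1.
Proof. exact: rmorphV. Qed.

Lemma bval_nat k : val (k%:R : A) = k%:R.
Proof. exact: rmorph_nat. Qed.

Lemma val_iota (x : K) : val (iota x) = x%:C%:M.
Proof. by []. Qed.

Definition scalar_bicom (z : K[i]) : A := Bicom (scalar_bicommutant c z).

Lemma val_scalar z : val (scalar_bicom z) = z%:M.
Proof. by []. Qed.

Lemma bval_unit x : (x \is a GRing.unit) = (val x \is a GRing.unit).
Proof. by []. Qed.

Lemma val_alpha p m : val (alpha iota p m) = (m`!%:R)^-1 *: poch (val p) m.
Proof.
rewrite /alpha bvalM val_rpoch -mul_scalar_mx val_iota.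
by congr (_%:M * _); rewrite fmorphV rmorph_nat.
Qed.

Lemma scalarX (z : K[i]) k : (z%:M : M) ^+ k = (z ^+ k)%:M.
Proof. by rewrite rmorphXn. Qed.

Lemma hyp_term2 p q r (z : K[i]) m : units_from r ->
  hyp_term [:: val p; val q] [:: val r] z m =
  val (alpha iota p m * poch_ratio q r m * scalar_bicom z ^+ m).
Proof.
move=> ru; rewrite /hyp_term !big_cons !big_nil !mulr1.
rewrite [in RHS]mulrC bvalM bvalX val_scalar scalarX.
rewrite [(_ ^+ _)%:M * _]mul_scalar_mx bvalM val_alpha -!scalerAl scalerA.
rewrite /poch_ratio bvalM bvalV ?rpoch_unit// !val_rpoch mulrA.
by [].
Qed.

Let h : A := iota 2^-1.
Let h2 : h * 2 = 1.
Proof. by rewrite -(rmorph_nat iota) -rmorphM mulVf ?rmorph1// pnatr_eq0. Qed.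

Lemma rpoch_double x m :
  rpoch (h * x) m * rpoch (h * (x + 1)) m = h ^+ m.*2 * rpoch x m.*2.
Proof.
elim: m => [|m IH]; first by rewrite double0 !rpoch0 expr0.
rewrite doubleS !rpochS !exprS.
transitivity (rpoch (h * x) m * rpoch (h * (x + 1)) m
  * ((h * x + m%:R) * (h * (x + 1) + m%:R))); first by ring.
rewrite IH.
have e k : k%:R = h * (k.*2)%:R :> A.
  by rewrite -mul2n natrM mulrA h2 mul1r.
have -> : h * x + m%:R = h * (x + m.*2%:R) by rewrite mulrDr -e.
have -> : h * (x + 1) + m%:R = h * (x + m.*2.+1%:R).
  by rewrite -[m.*2.+1%:R]natr1 !mulrDr -e; ring.
by ring.
Qed.

Lemma half_val x : 2^-1 *: val x = val (h * x).
Proof.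
rewrite bvalM val_iota -[RHS]/(_%:M *m _) mul_scalar_mx.
by rewrite fmorphV rmorph_nat.
Qed.

Lemma half_val1 x : 2^-1 *: (val x + 1) = val (h * (x + 1)).
Proof. by rewrite -half_val bvalD bval1. Qed.

Lemma hyp_term3 p q r m : units_from r ->
  hyp_term [:: val p; 2^-1 *: val q; 2^-1 *: (val q + 1)]
           [:: 2^-1 *: val r; 2^-1 *: (val r + 1)] 1 m =
  val (alpha iota p m * poch_ratio q r m.*2).
Proof.
move=> ru; rewrite /hyp_term !big_cons !big_nil !mulr1 expr1n div1r.
rewrite !half_val !half_val1 -!val_rpoch.
have hu : h ^+ m.*2 \is a GRing.unit.
  by rewrite unitrX//; apply/unitrP; exists 2; rewrite h2 mulrC h2.
have pu : h ^+ m.*2 * rpoch r m.*2 \is a GRing.unit.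
  by rewrite unitrM hu rpoch_unit.
have /andP[u1 u2] : (rpoch (h * r) m \is a GRing.unit)
    && (rpoch (h * (r + 1)) m \is a GRing.unit).
  by rewrite -unitrM rpoch_double.
rewrite -!bvalV// -!bvalM.
have -> : rpoch p m * (rpoch (h * q) m * rpoch (h * (q + 1)) m)
    * ((rpoch (h * r) m)^-1 * (rpoch (h * (r + 1)) m)^-1)
    = rpoch p m * poch_ratio q r m.*2.
  rewrite rpoch_double -invrM// [rpoch (h * (r + 1)) m * _]mulrC rpoch_double.
  rewrite invrM ?rpoch_unit// /poch_ratio.
  transitivity (rpoch p m * (rpoch q m.*2 / rpoch r m.*2) * (h ^+ m.*2 / h ^+ m.*2)).
    by ring.
  by rewrite mulrV// mulr1.
by rewrite [RHS]bvalM val_alpha -scalerAl bvalM val_rpoch.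
Qed.

End HypTerms.

Section GammaBicom.
Context {K : realType} {n : nat} (c : commfam K n).
Local Notation M := 'M[K[i]]_n.+1.
Local Notation A := (bicom c).
Local Notation iota := (@bicom_iota K n c).
Local Notation nu := (bicom_norm c).

Lemma stab_nat (x : A) j : stable mxnorm (val x) -> stable mxnorm (val (x + j%:R : A)).
Proof. by rewrite bvalD bval_nat; exact: stableD. Qed.

Definition Egam (x : A) m : A := iota (m.-1)`!%:R^-1 * expb (iota (- ln m%:R) * x).

Lemma gam_addn (x : A) j : stable mxnorm (val x) ->
  gam (x + j%:R) = rpoch x j * gam x.
Proof.
move=> sx; apply: val_inj; rewrite val_gam; last exact: stab_nat.
rewrite bvalM val_rpoch val_gam// bvalD bval_nat.
by rewrite -(rmorph_nat (@mxiota K n)) Gammamx_addn.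
Qed.

(** The asymptotics of Gamma at m = p+1, rewritten by Gamma(x+m) = (x)_m Gamma(x) and divided by
    Gamma(x). *)
Lemma gam_limit (x : A) : stable mxnorm (val x) ->
  ncvg nu \oo (fun m => rpoch x m * Egam x m) (gam x)^-1.
Proof.
move=> sx; have gu := gam_unit sx.
suff H : ncvg nu \oo (fun m => rpoch x m.+1 * Egam x m.+1) (gam x)^-1.
  by rewrite /ncvg -cvg_shiftS.
have H : ncvg nu \oo (fun m => gam x * (rpoch x m.+1 * Egam x m.+1)) 1.
  apply/ncvg_bicom; apply: (ncvg_near _ (Gammamx_asymptotic sx)); near=> m.
  have -> : (- ln m.+1%:R)%:C *: val x = val (iota (- ln m.+1%:R) * x).
    by rewrite bvalM val_iota -[RHS]/(_ *m _) mul_scalar_mx.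
  rewrite -val_expb [mxiota m.+1%:R]rmorph_nat -(@bval_nat _ _ c) -bvalD.
  rewrite -val_gam; last exact: stab_nat.
  rewrite gam_addn// -[mxiota _]/(val (iota m`!%:R^-1)) -!bvalM.
  by congr (val _); rewrite /Egam /=; ring.
rewrite -[X in ncvg _ _ _ X]mulr1.
apply: (ncvg_near _ (ncvgMl (gam x)^-1 H)); near=> m.
by rewrite mulrA mulVr// mul1r.
Unshelve. all: by end_near. Qed.

Lemma Egam_add (x y z t : A) m : x + y = z + t -> Egam x m * Egam y m = Egam z m * Egam t m.
Proof.
move=> xyzt.
have key (u v : A) : Egam u m * Egam v m = iota (m.-1)`!%:R^-1 * iota (m.-1)`!%:R^-1
    * expb (iota (- ln m%:R) * (u + v)).
  apply: etrans (mulrACA _ _ _ _) _; congr (_ * _).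
  exact: etrans (expbD _ _) (congr1 _ (esym (mulrDr _ _ _))).
by apply: etrans (key x y) _; rewrite xyzt; exact/esym/key.
Qed.

End GammaBicom.

(* Keeps unification from unfolding integrals and limits of distinct matrices. *)
Local Opaque Gammamx expmx hypF.

Section Hypergeometric.
Context {K : realType} {n : nat}.
Local Notation M := 'M[K[i]]_n.+1.

Lemma nsum_series (u : nat -> M) s : nsum mxnorm u s ->
  cvgn (series u) /\ limn (series u) = s.
Proof.
move=> us; split; last exact: mx_lim us.
by apply/cvg_ex; exists s; apply/mx_cvgP.
Qed.

Variables (c : commfam K n) (p q r : bicom c).
Local Notation A := (bicom c).
Local Notation iota := (@bicom_iota K n c).
Local Notation nu := (bicom_norm c).
Hypotheses (hr : positive_stable (val r)) (hrp : positive_stable (val r - val p))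
  (hrq : positive_stable (val r - val q))
  (hrqp : positive_stable (val r - val q - val p)).

Let st (x : A) := stable mxnorm (val x).

Let st_r : st r.
Proof. exact: (positive_stable_stable hr). Qed.

Let st_rp : st (r - p).
Proof. by rewrite /st bvalB; exact: (positive_stable_stable hrp). Qed.

Let st_rq : st (r - q).
Proof. by rewrite /st bvalB; exact: (positive_stable_stable hrq). Qed.

Let st_rpq : st (r - p - q).
Proof. by rewrite /st !bvalB addrAC; exact: (positive_stable_stable hrqp). Qed.

Let ru : units_from r.
Proof.
by move=> k; rewrite bval_unit bvalD bval_nat; exact: (positive_stable_unit k hr).
Qed.

Let rpu : units_from (r - p).
Proof.
move=> k; rewrite bval_unit bvalD bval_nat bvalB.
exact: (positive_stable_unit k hrp).
Qed.

Let G : A := gamma_quotient (@gam K n c) p q r.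

Let val_G : val G = Gammamx (val r) * Gammamx (val r - val q - val p)
  * (Gammamx (val r - val p))^-1 * (Gammamx (val r - val q))^-1.
Proof.
have erpq : val (r - p - q) = val r - val q - val p by rewrite bvalB bvalB addrAC.
apply: etrans (bvalM _ _) _; apply: congr2; last first.
  apply: etrans (bvalV (gam_unit st_rq)) _; apply: congr1.
  exact: etrans (val_gam st_rq) (congr1 _ (bvalB _ _)).
apply: etrans (bvalM _ _) _; apply: congr2; last first.
  apply: etrans (bvalV (gam_unit st_rp)) _; apply: congr1.
  exact: etrans (val_gam st_rp) (congr1 _ (bvalB _ _)).
apply: etrans (bvalM _ _) _; apply: congr2; first exact: val_gam st_r.
exact: etrans (val_gam st_rpq) (congr1 _ erpq).
Qed.

Let disc_term z := fun j => alpha iota p j * poch_ratio q (r - p) j * scalar_bicom c z ^+ j.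

Let disc_exists z : `|z| < 1 -> exists s, nsum nu (disc_term z) s.
Proof.
move=> z1; apply: bicom_complete; apply: disc_cvg => //.
rewrite (_ : nu _ = Normc.normc z); first by rewrite -ltcR -normr_normc.
have r1 i : rowsum (z%:M : M) i = Normc.normc z.
  rewrite /rowsum (bigD1 i)//= mxE eqxx mulr1n big1 ?addr0// => j ij.
  by rewrite mxE eq_sym (negbTE ij) mulr0n Normc.normc0.
apply/le_anti/andP; split; last by rewrite -(r1 ord0); exact: rowsum_le_mxn.
by apply: mxn_le => [|i]; [exact: normc_ge0|rewrite r1].
Qed.

Let disc_hyp z s : nsum nu (disc_term z) s ->
  nsum mxnorm (hyp_term [:: val p; val q] [:: val r - val p] z) (val s).
Proof.
move=> /nsum_bicom; apply: nsum_eq => k; rewrite -bvalB hyp_term2//.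
Qed.

Let disc_val z s : nsum nu (disc_term z) s ->
  hypF [:: val p; val q] [:: val r - val p] z = val s.
Proof. by move=> /disc_hyp /nsum_series[_]. Qed.

Let radial t : 0 <= t < 1 -> `|t%:C * - 1 : K[i]| < 1.
Proof.
move=> /andP[t0 t1]; rewrite normrM normrN normr1 mulr1 normr_normc normc_real.
by rewrite ltcR ger0_norm.
Qed.

Let radial_scalar t : scalar_bicom c (t%:C * - 1) = iota (- t).
Proof.
apply: val_inj; rewrite val_scalar val_iota mulrN1; congr (_%:M).
exact/esym/rmorphN.
Qed.

Lemma theorem_bicom :
  [/\ hyp_cvg [:: val p; 2^-1 *: val q; 2^-1 *: (val q + 1)]
              [:: 2^-1 *: val r; 2^-1 *: (val r + 1)] 1,
      (forall z : K[i], `|z| < 1 -> hyp_cvg [:: val p; val q] [:: val r - val p] z),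
      hyp_boundary_cvg [:: val p; val q] [:: val r - val p] (- 1),
      hypF [:: val p; 2^-1 *: val q; 2^-1 *: (val q + 1)]
           [:: 2^-1 *: val r; 2^-1 *: (val r + 1)] 1
      = Gammamx (val r) * Gammamx (val r - val q - val p)
        * (Gammamx (val r - val p))^-1 * (Gammamx (val r - val q))^-1
        * hypF_boundary [:: val p; val q] [:: val r - val p] (- 1)
    & hyp_cvg [:: val p; val q] [:: val r - val p] (- 1) ->
      hypF [:: val p; 2^-1 *: val q; 2^-1 *: (val q + 1)]
           [:: 2^-1 *: val r; 2^-1 *: (val r + 1)] 1
      = Gammamx (val r) * Gammamx (val r - val q - val p)
        * (Gammamx (val r - val p))^-1 * (Gammamx (val r - val q))^-1
        * hypF [:: val p; val q] [:: val r - val p] (- 1)].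
Proof.
have [S [H3 Hf]] := kummer_gamma (bicom_complete (c := c)) (@stab_nat _ _ c)
  (@bicom_stable _ _ c) (@gam_unit _ _ c) (@gam_addn _ _ c) (@gam_limit _ _ c)
  (@Egam_add _ _ c) st_r st_rp st_rq st_rpq ru rpu.
have sum3 : nsum mxnorm (hyp_term [:: val p; 2^-1 *: val q; 2^-1 *: (val q + 1)]
           [:: 2^-1 *: val r; 2^-1 *: (val r + 1)] 1) (val (G * S)).
  have /nsum_bicom := H3; apply: nsum_eq => k.
  exact/esym/hyp_term3.
have [cvg3 lim3] := nsum_series sum3.
have disc z : `|z| < 1 -> hyp_cvg [:: val p; val q] [:: val r - val p] z.
  by move=> /disc_exists[s /disc_hyp/nsum_series[]].
(* [kummer_gamma] takes a total function of t; the default 0 concerns only t for which the series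
   has no sum. *)
pose f t := xget 0 [set s | nsum nu (disc_term (t%:C * - 1)) s].
have fP t : 0 <= t < 1 -> nsum nu (disc_term (t%:C * - 1)) (f t).
  move=> /radial/disc_exists[s Hs].
  exact: (@xgetPex _ 0 [set s | nsum nu (disc_term (t%:C * - 1)) s] (ex_intro _ s Hs)).
have t01 : \forall t \near (1 : K)^'-, 0 <= t < 1.
  near=> t; apply/andP; split; near: t; [exact: nbhs_left_ge|exact: nbhs_left_lt].
have fS : ncvg nu (1 : K)^'- f S.
  apply: Hf => t /fP; apply: nsum_eq => j.
  by rewrite /disc_term radial_scalar.
pose F (t : K) := hypF [:: val p; val q] [:: val r - val p] (t%:C * - 1).
have FS : ncvg mxnorm (1 : K)^'- F (val S).
  move/ncvg_bicom : fS; apply: ncvg_near; near=> t.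
  have t1 : 0 <= t < 1 by near: t.
  by rewrite /F (disc_val (fP t t1)).
have boundary : hypF_boundary [:: val p; val q] [:: val r - val p] (- 1) = val S.
  exact: mx_lim FS.
have main : hypF [:: val p; 2^-1 *: val q; 2^-1 *: (val q + 1)]
           [:: 2^-1 *: val r; 2^-1 *: (val r + 1)] 1
   = Gammamx (val r) * Gammamx (val r - val q - val p)
        * (Gammamx (val r - val p))^-1 * (Gammamx (val r - val q))^-1
        * val S.
  apply: etrans lim3 _; apply: etrans (bvalM _ _) _.
  exact: (congr1 (fun y => y * val S) val_G).
split; [exact: cvg3|exact: disc| | |].
- by apply/cvg_ex; exists (val S); apply/mx_cvgP.
- exact: etrans main (congr1 _ (esym boundary)).
- move=> cN1; apply: etrans main (congr1 _ (esym _)).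
  set cN := hyp_term [:: val p; val q] [:: val r - val p] (- 1).
  have [l Hl] : exists l, nsum mxnorm cN l.
    by have [l Hl] := (cvg_ex _).1 cN1; exists l; apply/mx_cvgP.
  have hl : hypF [:: val p; val q] [:: val r - val p] (- 1) = l.
    by have [_] := nsum_series Hl.
  apply: etrans hl _; apply: ncvg_unique FS; apply: (abel Hl) => t t1.
  have /disc_hyp := fP t t1; rewrite -(disc_val (fP t t1)); apply: nsum_eq => k.
  (* The terms at -t are t^k times those at -1, which is the form that [abel] expects. *)
  rewrite /cN /hyp_term mxiotaZ scalerA; congr (_ *: _).
  by rewrite exprMn rmorphXn mulrA.
Unshelve. all: by end_near. Qed.

End Hypergeometric.

Theorem theorem2p2 (K : realType) (n : nat) (P Q R : 'M[K[i]]_n.+1)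
    (hPQ : P * Q = Q * P) (hPR : P * R = R * P) (hQR : Q * R = R * Q)
    (hR : positive_stable R) (hRP : positive_stable (R - P))
    (hRQ : positive_stable (R - Q)) (hRQP : positive_stable (R - Q - P)) :
  [/\ hyp_cvg [:: P; 2^-1 *: Q; 2^-1 *: (Q + 1)]
              [:: 2^-1 *: R; 2^-1 *: (R + 1)] 1,
      (forall z : K[i], `|z| < 1 -> hyp_cvg [:: P; Q] [:: R - P] z),
      hyp_boundary_cvg [:: P; Q] [:: R - P] (- 1),
      hypF [:: P; 2^-1 *: Q; 2^-1 *: (Q + 1)]
           [:: 2^-1 *: R; 2^-1 *: (R + 1)] 1
      = Gammamx R * Gammamx (R - Q - P) * (Gammamx (R - P))^-1
        * (Gammamx (R - Q))^-1 * hypF_boundary [:: P; Q] [:: R - P] (- 1)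
    & hyp_cvg [:: P; Q] [:: R - P] (- 1) ->
      hypF [:: P; 2^-1 *: Q; 2^-1 *: (Q + 1)]
           [:: 2^-1 *: R; 2^-1 *: (R + 1)] 1
      = Gammamx R * Gammamx (R - Q - P) * (Gammamx (R - P))^-1
        * (Gammamx (R - Q))^-1 * hypF [:: P; Q] [:: R - P] (- 1)].
Proof.
have PQR_comm X Y : [\/ X = P, X = Q | X = R] -> [\/ Y = P, Y = Q | Y = R] ->
  X * Y = Y * X by case=> ->; case=> ->.
pose c := CommFam PQR_comm.
pose p := Bicom (fam_bicommutant (c := c) (Or31 _ _ erefl)).
pose q := Bicom (fam_bicommutant (c := c) (Or32 _ _ erefl)).
pose r := Bicom (fam_bicommutant (c := c) (Or33 _ _ erefl)).
exact: (@theorem_bicom K n c p q r hR hRP hRQ hRQP).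
Qed.
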